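(* Let $\Omega\subset\mathbb{C}$ be a simply connected domain, let $\zeta\in\Omega$, and let $\mathfrak{F}\subset\mathbb{N}\times\mathbb{N}$ be a set containing a sequence $(\tilde p_n,\tilde q_n)$, $n=0,1,2,\dots$, with $\tilde p_n\to+\infty$. Then there is a dense $G_\delta$ subset of $\mathcal{H}(\Omega)$ such that every $f$ in this subset has the following property: for every polynomial $h$ and every compact set $K\subset\mathbb{C}$ with $K\cap\Omega=\emptyset$ and $\mathbb{C}\setminus K$ connected, there exists a sequence $(p_n,q_n)\in\mathfrak{F}$, $n=0,1,2,\dots$, such that the Padé approximants $[p_n/q_n]_{f,\zeta}$ exist for all $n$ and $$\sup_{z\in K}\bigl|[p_n/q_n]_{f,\zeta}(z)-h(z)\bigr|\to 0\quad\text{as } n\to+\infty .$$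
   Context: $\mathbb{N}=\{0,1,2,\dots\}$. $\mathcal{H}(\Omega)$ is the space of holomorphic functions on $\Omega$ with the topology of uniform convergence on compact subsets of $\Omega$. Padé approximants: let $f$ be holomorphic near $\zeta\in\mathbb{C}$, with Taylor expansion $f(z)=\sum_{v\ge 0}a_v(z-\zeta)^v$, and let $p,q\in\mathbb{N}$. The Padé approximant $[p/q]_{f,\zeta}$ is a rational function $A(z)/B(z)$, where $A,B$ are polynomials with $\deg A\le p$, $\deg B\le q$, $B(\zeta)=1$, whose Taylor expansion $\sum_{v\ge0} b_v(z-\zeta)^v$ at $\zeta$ satisfies $b_v=a_v$ for all $v=0,1,\dots,p+q$. It need not exist, but if it exists it is unique as a rational function. For $q=0$ it is the Taylor partial sum $\sum_{v=0}^p a_v(z-\zeta)^v$. Padé approximants are regarded as rational functions; a supremum of differences over a set containing a pole is $+\infty$. *)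

(* Defs.v *)
From HB Require Import structures.
From mathcomp Require Import all_boot all_order all_algebra fraction.
From mathcomp Require Import complex.
From mathcomp Require Import all_classical all_reals all_analysis.

Set Implicit Arguments.
Unset Strict Implicit.
Unset Printing Implicit Defensive.

Import Order.TTheory GRing.Theory Num.Theory.
Import numFieldNormedType.Exports.

Local Open Scope classical_set_scope.
Local Open Scope ring_scope.

(* The canonical topology, uniformity and norm of a numFieldType are not
   found on R[i] without this instance. *)
#[warnings="-redundant-canonical-projection"]
HB.instance Definition _ (R : rcfType) := NormedModule.copy R[i] R[i]^o.

Section definitions.
Variable R : realType.
Local Notation C := R[i].

(* Every loop in D is homotopic in D, with fixed base point, to a constant. *)
Definition loops_contract (D : set C) : Prop :=
  forall gamma : R -> C,
    {within `[0, 1], continuous gamma} ->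
    (forall t : R, t \in `[0, 1] -> D (gamma t)) ->
    gamma 0 = gamma 1 ->
  exists H : R * R -> C,
    [/\ {within `[0, 1] `*` `[0, 1], continuous H},
        forall s t : R, s \in `[0, 1] -> t \in `[0, 1] -> D (H (s, t)),
        forall t : R, t \in `[0, 1] -> H (0, t) = gamma t,
        forall t : R, t \in `[0, 1] -> H (1, t) = gamma 0 &
        forall s : R, s \in `[0, 1] -> H (s, 0) = gamma 0 /\ H (s, 1) = gamma 0].

Definition simply_connected_domain (D : set C) : Prop :=
  [/\ D !=set0, open D, connected D & loops_contract D].

(* A holomorphic function on the open set D is represented by its extension
   by 0 outside D, so that two elements are equal iff they agree on D. *)
Definition holomorphic_on (D : set C) : set {family compactly_in D, C -> C} :=
  [set f | (forall z, D z -> derivable (f : C -> C) z 1) /\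
           (forall z, ~ D z -> f z = 0)].
Arguments holomorphic_on : clear implicits.

(* The topology of uniform convergence on the compact subsets of D. *)
Definition holo (D : set C) : topologicalType := set_type (holomorphic_on D).

Definition holo_fun (D : set C) (f : holo D) : C -> C := \val f.

Definition taylor_expansion (f : C -> C) (zeta : C) (a : C^nat) : Prop :=
  \forall z \near zeta,
    series (fun v : nat => a v * (z - zeta) ^+ v) n @[n --> \oo] --> f z.

Local Notation ratfun := {fraction {poly C}}.

(* The reduced form of r: the pair representing an element of {fraction _}
   need not be coprime. *)
Definition rnum (r : ratfun) : {poly C} :=
  let x := frac (repr r) in x.1 %/ gcdp x.1 x.2.
Definition rden (r : ratfun) : {poly C} :=
  let x := frac (repr r) in x.2 %/ gcdp x.1 x.2.

Definition pole (r : ratfun) (z : C) : bool := root (rden r) z.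
Definition reval (r : ratfun) (z : C) : C := (rnum r).[z] / (rden r).[z].

(* [r] is the Padé approximant [p/q]_{f,zeta}. *)
Definition is_pade (f : C -> C) (zeta : C) (p q : nat) (r : ratfun) : Prop :=
  exists A B : {poly C},
    [/\ (size A <= p.+1)%N, (size B <= q.+1)%N, B.[zeta] = 1,
        r = FracField.tofrac A / FracField.tofrac B &
        exists a b : C^nat,
          [/\ taylor_expansion f zeta a,
              taylor_expansion (fun z => A.[z] / B.[z]) zeta b &
              forall v, (v <= p + q)%N -> b v = a v]].

Definition rdist (r : ratfun) (h : {poly C}) (z : C) : \bar R :=
  if pole r z then +oo%E else (complex.Re `|reval r z - h.[z]|)%:E.

(* The supremum is taken in [0, +oo]: it is 0, not -oo, when K is empty. *)
Definition sup_dist (K : set C) (r : ratfun) (h : {poly C}) : \bar R :=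
  ereal_sup ([set 0%E] `|` [set rdist r h z | z in K]).

End definitions.

(* Main.v *)
(* Proof. By Baire's theorem it is enough to treat one target at a time: a
   polynomial [h] with rational coefficients, an accuracy, and one member [X] of
   a countable family of compact sets [core] disjoint from [Omega] that absorbs
   every admissible [K]. Let [f0] be holomorphic on [Omega] and let [L] be a
   compact subset of [Omega]. Filling the holes of [L] keeps it inside [Omega],
   which is simply connected, and then [L] and [X] are disjoint and the union
   does not separate the plane, so by Runge's theorem some polynomial [P] is
   close to [f0] on [L] and to [h] on [X]. Choose [(p, q)] in [F] with
   [p >= deg P]. In powers of [w = z - zeta], a Taylor polynomial [G] of
   [P / (1 + u w^q)], with [u] small, is close to [P] on [L] and on [X], and its
   Pade approximant of order [(p, q)] is [P / (1 + u w^q)], in lowest terms and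
   with denominator of degree exactly [q]. The linear system defining it is
   therefore regular, so the Pade approximants of all functions near [G] exist
   and depend continuously on finitely many Taylor coefficients. Hence the
   functions whose approximant is close to [h] on [X] contain a dense open set.

   Nonseparation of the plane by a compact set is expressed by [outer]: every
   point of the complement can be reached from infinity by pole pushing. The
   link with simple connectedness is a winding number that counts quarter
   turns. *)

Require Import Defs.
From mathcomp Require Import all_boot all_order all_algebra fraction.
From mathcomp Require Import complex.
From mathcomp Require Import all_classical all_reals all_analysis borel_hierarchy.
From mathcomp Require Import cyclic separable cyclotomic.
From mathcomp Require Import ring lra zify.

Set Implicit Arguments.
Unset Strict Implicit.
Unset Printing Implicit Defensive.

Import Order.TTheory GRing.Theory Num.Theory.
Import numFieldNormedType.Exports.

Local Open Scope classical_set_scope.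
Local Open Scope ring_scope.

(** No integral occurs. Cauchy's formula is used through midpoint sums over grid squares, and the
    value 2 pi i of the winding integral is never computed: the kernel sum of [g] is divided by the
    kernel sum of the constant 1, for which a lower bound on the modulus is enough. Likewise
    Cauchy's estimates are averages over roots of unity. On the Pade side the obstacle is
    degeneracy. A polynomial [P] is its own approximant of order [(p, q)], but when [deg P < p] and
    [0 < q] its linear system is singular, and arbitrarily close functions may have no approximant
    or a distant one. Since [F] leaves no control over [p] beyond its size, the degeneracy is
    removed by a denominator of exact degree [q]. Pole pushing alone does not handle unions, because
    a chain for one compact set may cross the other; branches of the argument do glue, which is why
    winding numbers enter there too. Baire's theorem is proved with tubes around polynomials, so
    that the limit function is a locally uniform limit of polynomials and its holomorphy follows
    from estimates on polynomials. *)

Local Notation "x %:C" := (real_complex _ x) (format "x %:C").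

(** * The real-valued modulus, compactness and complex differentiability *)

Section complex_norm.
Variable R : realType.
Local Notation C := R[i].

Definition nrm (z : C) : R := complex.Re `|z|.

Lemma normE (z : C) : `|z| = (nrm z)%:C.
Proof. by rewrite /nrm normc_def. Qed.

Lemma nrmE (z : C) : nrm z = `|z : Rcomplex R|.
Proof. by rewrite /nrm normc_def; case: z. Qed.

Lemma nrm_ge0 z : 0 <= nrm z. Proof. by rewrite nrmE. Qed.
Lemma nrm0 : nrm 0 = 0. Proof. by rewrite nrmE normr0. Qed.
Lemma nrm1 : nrm 1 = 1. Proof. by rewrite /nrm normr1. Qed.
Lemma nrm_eq0 z : (nrm z == 0) = (z == 0). Proof. by rewrite nrmE normr_eq0. Qed.
Lemma nrm_gt0 z : (0 < nrm z) = (z != 0). Proof. by rewrite nrmE normr_gt0. Qed.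
Lemma nrmN z : nrm (- z) = nrm z. Proof. by rewrite !nrmE; exact: normrN. Qed.
Lemma nrmD x y : nrm (x + y) <= nrm x + nrm y.
Proof. by rewrite !nrmE; exact: ler_normD. Qed.
Lemma nrmB x y : nrm (x - y) <= nrm x + nrm y.
Proof. by rewrite -(nrmN y); exact: nrmD. Qed.
Lemma nrmBC x y : nrm (x - y) = nrm (y - x).
Proof. by rewrite -nrmN opprB. Qed.
Lemma nrm_dist y x z : nrm (x - z) <= nrm (x - y) + nrm (y - z).
Proof. by rewrite -{1}(subrK y x) -addrA; exact: nrmD. Qed.
Lemma nrmM x y : nrm (x * y) = nrm x * nrm y.
Proof. by apply: (@complexI R); rewrite rmorphM -!normE normrM. Qed.
Lemma nrmV x : nrm x^-1 = (nrm x)^-1.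
Proof. by apply: (@complexI R); rewrite fmorphV -!normE normfV. Qed.
Lemma nrm_div x y : nrm (x / y) = nrm x / nrm y.
Proof. by rewrite nrmM nrmV. Qed.
Lemma nrmX x n : nrm (x ^+ n) = nrm x ^+ n.
Proof. by apply: (@complexI R); rewrite rmorphXn -!normE normrX. Qed.
Lemma nrm_sum (I : Type) (r : seq I) (P : pred I) (F : I -> C) :
  nrm (\sum_(i <- r | P i) F i) <= \sum_(i <- r | P i) nrm (F i).
Proof.
elim/big_rec2: _ => [|i y x _ le]; first by rewrite nrm0.
by apply: (le_trans (nrmD _ _)); rewrite lerD2l.
Qed.
Lemma nrm_real (x : R) : nrm x%:C = `|x|.
Proof.
by rewrite /nrm normc_def /= expr0n /= addr0 sqrtr_sqr.
Qed.
Lemma nrm_nat n : nrm n%:R = n%:R.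
Proof. by rewrite /nrm normr_nat -(rmorph_nat (real_complex R)). Qed.
Lemma nrm_sqr (z : C) : nrm z ^+ 2 = complex.Re z ^+ 2 + complex.Im z ^+ 2.
Proof. by apply: (@complexI R); rewrite rmorphXn /= -normE -add_Re2_Im2. Qed.
Lemma nrm_Re z : `|complex.Re z| <= nrm z.
Proof.
rewrite -(@ler_pXn2r _ 2) ?nnegrE ?nrm_ge0 // nrm_sqr real_normK ?num_real //.
by rewrite lerDl sqr_ge0.
Qed.
Lemma nrm_Im z : `|complex.Im z| <= nrm z.
Proof.
rewrite -(@ler_pXn2r _ 2) ?nnegrE ?nrm_ge0 // nrm_sqr real_normK ?num_real //.
by rewrite lerDr sqr_ge0.
Qed.
Lemma nrm_ReIm z : nrm z <= `|complex.Re z| + `|complex.Im z|.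
Proof.
rewrite -(@ler_pXn2r _ 2) ?nnegrE ?nrm_ge0 ?addr_ge0 // nrm_sqr.
rewrite sqrrD !real_normK ?num_real // lerD2r lerDl.
by rewrite mulrn_wge0 // mulr_ge0.
Qed.
Lemma ReD (x y : C) : complex.Re (x + y) = complex.Re x + complex.Re y.
Proof. by case: x; case: y. Qed.
Lemma ImD (x y : C) : complex.Im (x + y) = complex.Im x + complex.Im y.
Proof. by case: x; case: y. Qed.
Lemma ReN (x : C) : complex.Re (- x) = - complex.Re x.
Proof. by case: x. Qed.
Lemma ImN (x : C) : complex.Im (- x) = - complex.Im x.
Proof. by case: x. Qed.

Lemma pos_complex (e : C) : 0 < e -> exists2 r : R, 0 < r & e = r%:C.
Proof.
move=> e0; exists (complex.Re e); first by move: e0; rewrite ltcE => /andP[].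
by apply/esym/RRe_real; rewrite realE ltW.
Qed.

Lemma nbhs_nrmP (z : C) (A : set C) :
  nbhs z A <-> exists2 r : R, 0 < r & forall w, nrm (w - z) < r -> A w.
Proof.
split=> [/nbhs_ballP[e /= /pos_complex[r r0 ->]] zA|[r r0 zA]].
  exists r => // w wz; apply: zA => /=.
  by rewrite -ball_normE /= normE ltcR nrmBC.
apply/nbhs_ballP; exists r%:C; rewrite /= ?ltcR// => w.
by rewrite -ball_normE /= normE ltcR nrmBC => /zA.
Qed.

(** Finitely many of the local radii suffice by compactness, and [P] passes to the smallest of them.
    Lebesgue numbers, common bounds and common thresholds are all obtained from this one form. *)
Lemma compact_uniform (T : topologicalType) (X : set T) (P : R -> T -> Prop) :
  compact X ->
  (forall e e' x, 0 < e' -> e' <= e -> P e x -> P e' x) ->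
  (forall x, X x -> exists2 r : R, 0 < r & \forall w \near x, X w -> P r w) ->
  exists2 r : R, 0 < r & forall w, X w -> P r w.
Proof.
move=> cX mP locP.
have /compact_near_coveringP/near_covering_withinP cov := cX.
have : \forall e \near (0:R)^'+, X `<=` P e.
  apply: cov => x Xx; have [r r0 Ur] := locP x Xx.
  exists ([set w | X w -> P r w], [set e : R | 0 < e <= r]) => /=.
    split=> //=; near=> e; apply/andP; split; near: e.
      exact: nbhs_right_gt.
    by apply: nbhs_right_le.
  by move=> [w e] /= [Pw /andP[e0 er]] Xw; apply: mP er (Pw Xw).
move=> near0; have [e [e0 eP]] : exists e : R, 0 < e /\ X `<=` P e.
  have [e []] := @filter_ex _ _ _ _ (filterI (nbhs_right_gt (0:R)) near0).
  by exists e.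
by exists e.
Unshelve. all: by end_near.
Qed.

Lemma compact_uniform_nrm (X : set C) (P : R -> C -> Prop) :
  compact X ->
  (forall e e' x, 0 < e' -> e' <= e -> P e x -> P e' x) ->
  (forall x, X x -> exists2 r : R, 0 < r & forall w, nrm (w - x) < r -> P r w) ->
  exists2 r : R, 0 < r & forall w, X w -> P r w.
Proof.
move=> cX mP locP; apply: (@compact_uniform C) => // x /locP[r r0 rP].
by exists r => //; apply/nbhs_nrmP; exists r => // w /rP.
Qed.

Lemma compact_nrm_bounded (X : set C) : compact X ->
  exists2 B : R, 0 < B & forall z, X z -> nrm z <= B.
Proof.
move=> cX; case: (@compact_uniform_nrm X (fun e z => nrm z <= e^-1) cX) => [||r r0 rX].
- by move=> e e' x e0 ee /le_trans; apply; rewrite lef_pV2 ?posrE// (lt_le_trans e0).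
- move=> x _; have b0 : 0 < nrm x + 1 by rewrite ltr_pwDr// nrm_ge0.
  have i0 : 0 < (nrm x + 1)^-1 by rewrite invr_gt0.
  exists (nrm x + 1)^-1 => // w wx; rewrite invrK.
  rewrite -(subrK x w) (le_trans (nrmD _ _))// addrC lerD2l (le_trans (ltW wx))//.
  by rewrite invf_le1// lerDr nrm_ge0.
- by exists r^-1; rewrite ?invr_gt0.
Qed.

Lemma openP (D : set C) : open D <->
  forall z, D z -> exists2 r : R, 0 < r & forall w, nrm (w - z) < r -> D w.
Proof.
rewrite openE; split=> [oD z /oD /nbhs_nrmP//|h z Dz].
by apply/nbhs_nrmP; exact: h.
Qed.

Lemma compact_closedC (X : set C) : compact X -> closed X.
Proof. by apply: compact_closed; exact: norm_hausdorff. Qed.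

Lemma compact_in_open (X D : set C) : compact X -> open D -> X `<=` D ->
  exists2 r : R, 0 < r & forall z w, X z -> nrm (w - z) < r -> D w.
Proof.
move=> cX oD XD; case: (@compact_uniform_nrm X
  (fun r z => forall w, nrm (w - z) < r -> D w) cX) => [||r r0 h].
- by move=> e e' x e0 ee h w /lt_le_trans/(_ ee)/h.
- move=> x /XD/((openP D).1 oD)[r r0 rD]; exists (r/2); first lra.
  move=> w wx v vw; apply: rD; have := nrm_dist w v x; lra.
- by exists r => // z w /h; exact.
Qed.

Lemma compact_dist (X : set C) a : compact X -> ~ X a ->
  exists2 r : R, 0 < r & forall z, X z -> r <= nrm (z - a).
Proof.
move=> cX Xa; have /openP/(_ a Xa)[r r0 h] : open (~` X).
  by rewrite openC; exact: compact_closedC.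
exists r => // z Xz; rewrite leNgt; apply/negP => /h; exact.
Qed.

Lemma continuous_Complex : continuous (fun p : R * R => (Complex p.1 p.2 : C)).
Proof.
move=> [x y]/= A /nbhs_nrmP[r r0 rA].
rewrite nbhs_simpl /=.
exists (ball x (r/2), ball y (r/2)) => /=.
  by split; apply: nbhsx_ballx; lra.
move=> [u v] /= [xu yv]; apply: rA.
apply: (le_lt_trans (nrm_ReIm _)) => /=.
move: xu yv; rewrite /ball /= [`|x - u|]distrC [`|y - v|]distrC; lra.
Qed.

Lemma closed_bounded_compact (X : set C) (B : R) : closed X ->
  (forall z, X z -> nrm z <= B) -> compact X.
Proof.
move=> clX XB.
pose Q := [set z : C | exists2 p : R * R, (`[-B, B]%classic `*` `[-B, B]%classic) p & Complex p.1 p.2 = z].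
have cQ : compact Q.
  apply: (@continuous_compact _ _ (fun p : R * R => (Complex p.1 p.2 : C))).
    by apply: continuous_subspaceT => p; exact: continuous_Complex.
  by apply: compact_setX; exact: segment_compact.
apply: (subclosed_compact clX cQ) => z /XB zB; exists (complex.Re z, complex.Im z).
  split; rewrite /= in_itv /= -ler_norml (le_trans _ zB)//.
    exact: nrm_Re.
  exact: nrm_Im.
by case: z {zB}.
Qed.

(** The form without a quotient does not exclude [w = z], and it isolates the affine part, on which
    midpoint sums are exact. *)
Definition cdiff (f : C -> C) (z : C) := exists D : C, forall e : R, 0 < e ->
  exists2 d : R, 0 < d & forall w, nrm (w - z) < d ->
    nrm (f w - f z - D * (w - z)) <= e * nrm (w - z).

Lemma cdiffP f z : derivable (f : C -> C) z 1 <-> cdiff f z.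
Proof.
split.
  move=> /cvg_ex[/= D fD]; exists D => e e0.
  have e0' : 0 < e%:C by rewrite ltcR.
  have := (@cvgrPdist_lt _ _ _ _ _ _ _).1 fD _ e0'; rewrite near_withinE => h0. have [d d0 h] := (nbhs_nrmP (0 : C) _).1 (h0 _).
  exists d => // w wd; have [->|wz] := eqVneq w z.
    by rewrite !subrr mulr0 subr0 nrm0 mulr0.
  have nz : w - z != 0 by rewrite subr_eq0.
  have := h (w - z); rewrite subr0 => /(_ wd nz) /=.
  rewrite normE ltcR -[_ *: _]/(_ * _) -[(w - z) *: 1]/((w - z) * 1) mulr1 addrC subrK.
  move=> hh; have -> : f w - f z - D * (w - z) = - ((D + - ((w - z)^-1 * (f w - f z))) * (w - z)).
    by field.
  by rewrite nrmN nrmM ler_wpM2r ?nrm_ge0//  addrC ltW.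
move=> [D h]; apply/cvg_ex; exists D; apply/(@cvgrPdist_le _ _ _ _ _ _ _) => e0 /pos_complex[e epos ->].
have [d d0 {}h] := h e epos; rewrite near_withinE; apply: (nbhs_nrmP (0 : C) _).2; exists d => // t td tn0 /=.
rewrite normE lecR -[_ *: _]/(_ * _) -[t *: 1]/(t * 1) mulr1.
move: (h (t + z)); rewrite addrK; rewrite subr0 in td => /(_ td).
have -> : f (t + z) - f z - D * t = - ((D - t^-1 * (f (t + z) - f z)) * t).
  by field.
by rewrite nrmN nrmM ler_pM2r // nrm_gt0.
Qed.

(** The local equivalence makes both [Z] and its complement relatively open in [D]. *)
Lemma connected_induction (D Z : set C) : open D -> connected D ->
  (exists2 z, D z & Z z) ->
  (forall z, D z -> exists2 r : R, 0 < r & forall w, nrm (w - z) < r -> Z z <-> Z w) ->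
  forall z, D z -> Z z.
Proof.
move=> oD cD [z0 Dz0 Zz0] loc.
have op (P : Prop -> Prop) : (forall A A', (A <-> A') -> P A -> P A') ->
    open [set z | D z /\ P (Z z)].
  move=> PP; apply/openP => z [Dz Pz].
  have [r r0 rD] := (openP D).1 oD z Dz; have [s s0 sZ] := loc z Dz.
  exists (Num.min r s) => [|w]; first by rewrite lt_min r0.
  by rewrite lt_min => /andP[/rD Dw /sZ ZZ]; split=> //; exact: PP ZZ Pz.
have E : [set z | D z /\ Z z] = D.
  apply: cD; first by exists z0.
  - exists [set z | D z /\ Z z]; first by apply: (op id) => A A' [].
    by apply/seteqP; split=> [z [? ?]|z [? []]].
  - exists (~` [set z | D z /\ ~ Z z]).
      by rewrite closedC; apply: (op not) => A A' AA' nA /AA'; exact: nA.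
    apply/seteqP; split=> [z [Dz Zz]|z [Dz nz]]; first by split=> // -[].
    by split=> //; apply: contrapT => nZ; apply: nz.
by move=> z; rewrite -{1}E => -[].
Qed.
End complex_norm.

(** * Goursat's theorem *)

Section midpoint_sums.
Variable R : realType.
Local Notation C := R[i].

(* Midpoint Riemann sum of [g dw] over the segment [a, b], cut in 2^n pieces: it
   is exact for affine [g], and exactly additive when a square is bisected. *)
Fixpoint mid (n : nat) (g : C -> C) (a b : C) : C :=
  if n is m.+1 then mid m g a ((a + b) / 2%:R) + mid m g ((a + b) / 2%:R) b
  else g ((a + b) / 2%:R) * (b - a).

Definition midconvex (P : set C) := forall x y, P x -> P y -> P ((x + y) / 2%:R).

Lemma mid_sym n g a b : mid n g b a = - mid n g a b.
Proof.
elim: n a b => [|n IH] a b /=; first by rewrite (addrC b a); ring.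
by rewrite (addrC b a) (IH _ b) (IH a _); ring.
Qed.

Lemma mid_lin n g h k a b :
  mid n (fun w => k * g w + h w) a b = k * mid n g a b + mid n h a b.
Proof.
elim: n a b => [|n IH] a b /=; first by ring.
by rewrite !IH; ring.
Qed.

Lemma mid_affine n k l a b :
  mid n (fun w => k * w + l) a b = k * (b ^+ 2 - a ^+ 2) / 2%:R + l * (b - a).
Proof.
elim: n a b => [|n IH] a b /=; first by field.
by rewrite !IH; field.
Qed.

Lemma half_dist (a b : C) : nrm ((a + b) / 2%:R - a) = nrm (b - a) / 2%:R /\
  nrm (b - (a + b) / 2%:R) = nrm (b - a) / 2%:R.
Proof.
by split; rewrite -(nrm_nat R 2) -nrm_div; congr nrm; field.
Qed.

Lemma mid_bound n (P : set C) g M a b : midconvex P -> P a -> P b ->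
  (forall w, P w -> nrm (g w) <= M) -> nrm (mid n g a b) <= M * nrm (b - a).
Proof.
move=> cP + + gh; elim: n a b => [|n IH] a b Pa Pb /=.
  by rewrite nrmM ler_wpM2r ?nrm_ge0 ?gh//; exact: cP.
apply: (le_trans (nrmD _ _)); have Pm := cP _ _ Pa Pb.
have := IH _ _ Pa Pm; have := IH _ _ Pm Pb.
have [-> ->] := half_dist a b; lra.
Qed.

(** Each term is a nonnegative real step times [g w * u], so a lower bound on the imaginary part
    survives the summation. For the Cauchy kernel this stands in for the value of the winding
    integral. *)
Lemma mid_Im_ge n (P : set C) g m a b u s : midconvex P -> P a -> P b ->
  b = a + s%:C * u -> 0 <= s ->
  (forall w, P w -> m <= complex.Im (g w * u)) -> m * s <= complex.Im (mid n g a b).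
Proof.
move=> cP + + + + gh; elim: n s a b => [|n IH] s a b Pa Pb bE s0 /=.
  rewrite bE; set w := (_ / _).
  have -> : g w * (a + s%:C * u - a) = s%:C * (g w * u) by ring.
  have : m <= complex.Im (g w * u) by apply: gh; rewrite /w -bE; exact: cP.
  by case: (g w * u) => x y /= ?; rewrite mul0r addr0 mulrC ler_wpM2l.
have Pm := cP _ _ Pa Pb.
have sE : s%:C = (s / 2%:R)%:C * 2%:R :> C.
  by rewrite -(rmorph_nat (real_complex R)) -rmorphM /= divfK.
rewrite ImD; have h1 := IH (s / 2%:R) _ _ Pa Pm; have h2 := IH (s / 2%:R) _ _ Pm Pb.
have : m * (s/2%:R) <= complex.Im (mid n g a ((a+b)/2%:R)).
  by apply: h1; [rewrite bE sE; field | lra].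
have : m * (s/2%:R) <= complex.Im (mid n g ((a+b)/2%:R) b).
  by apply: h2; [rewrite bE sE; field | lra].
lra.
Qed.

Definition bd n g (c s : C) : C :=
  mid n g c (c + s) + mid n g (c + s) (c + s + 'i * s) +
  mid n g (c + s + 'i * s) (c + 'i * s) + mid n g (c + 'i * s) c.

Lemma bd_split n g c s : bd n.+1 g c (s + s) =
  bd n g c s + bd n g (c + s) s + bd n g (c + 'i * s) s + bd n g (c + s + 'i * s) s.
Proof.
rewrite /bd /=.
have -> : (c + (c + (s + s))) / 2%:R = c + s by field.
have -> : (c + (s + s) + (c + (s + s) + 'i * (s + s))) / 2%:R = c + s + s + 'i * s by field.
have -> : (c + (s + s) + 'i * (s + s) + (c + 'i * (s + s))) / 2%:R = c + s + 'i * s + 'i * s by field.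
have -> : (c + 'i * (s + s) + c) / 2%:R = c + 'i * s by field.
have -> : c + (s + s) = c + s + s by ring.
have -> : c + 'i * (s + s) = c + 'i * s + 'i * s by ring.
have -> : c + s + s + 'i * (s + s) = c + s + 'i * s + s + 'i * s by ring.
have -> : c + 'i * s + s = c + s + 'i * s by ring.
have -> : c + s + 'i * s + s = c + s + s + 'i * s by ring.
rewrite (mid_sym n g (c + s + 'i * s) (c + s)).
rewrite (mid_sym n g (c + s + 'i * s) (c + 'i * s)).
rewrite (mid_sym n g (c + s + s + 'i * s) (c + s + 'i * s)).
rewrite (mid_sym n g (c + s + 'i * s + 'i * s) (c + s + 'i * s)).
by ring.
Qed.

Lemma bd_lin n g h k c s :
  bd n (fun w => k * g w + h w) c s = k * bd n g c s + bd n h c s.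
Proof. by rewrite /bd !mid_lin; ring. Qed.

Lemma bd_affine n k l c s : bd n (fun w => k * w + l) c s = 0.
Proof. by rewrite /bd !mid_affine; field. Qed.

Definition sq (c : C) (s : R) : set C := [set z |
  complex.Re c <= complex.Re z <= complex.Re c + s /\
  complex.Im c <= complex.Im z <= complex.Im c + s].

Lemma ReM2 (x : C) : complex.Re (x / 2%:R) = complex.Re x / 2%:R.
Proof.
have -> : (2%:R : C)^-1 = (2%:R^-1)%:C.
  by rewrite fmorphV rmorph_nat.
by case: x => a b /=; rewrite mulr0 subr0.
Qed.
Lemma ImM2 (x : C) : complex.Im (x / 2%:R) = complex.Im x / 2%:R.
Proof.
have -> : (2%:R : C)^-1 = (2%:R^-1)%:C.
  by rewrite fmorphV rmorph_nat.
by case: x => a b /=; rewrite mulr0 add0r.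
Qed.

Lemma sq_midconvex c s : midconvex (sq c s).
Proof.
move=> x y [x1 x2] [y1 y2]; split; rewrite ?ReM2 ?ImM2 ?ReD ?ImD; lra.
Qed.

Lemma ReiM (s : R) : complex.Re ('i * s%:C) = 0.
Proof. by rewrite -complexiE /= !mul0r mul1r subr0. Qed.
Lemma ImiM (s : R) : complex.Im ('i * s%:C) = s.
Proof. by rewrite -complexiE /= mul0r mul1r add0r. Qed.

Lemma sq_corners c s : 0 <= s -> [/\ sq c s c, sq c s (c + s%:C),
  sq c s (c + s%:C + 'i * s%:C) & sq c s (c + 'i * s%:C)].
Proof.
by move=> s0; split; rewrite /sq /= ?(ReD, ImD) ?ReiM ?ImiM /=; lra.
Qed.

Lemma sq_dist c s x y : sq c s x -> sq c s y -> nrm (x - y) <= 2 * s.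
Proof.
move=> [x1 x2] [y1 y2]; apply: (le_trans (nrm_ReIm _)).
rewrite ReD ImD ReN ImN.
have : `|complex.Re x - complex.Re y| <= s by rewrite ler_norml; lra.
have : `|complex.Im x - complex.Im y| <= s by rewrite ler_norml; lra.
lra.
Qed.

Lemma nrm_i : nrm ('i : C) = 1.
Proof. by rewrite /nrm normCi. Qed.

Lemma bd_bound n g M c s : 0 <= s -> (forall w, sq c s w -> nrm (g w) <= M) ->
  nrm (bd n g c s%:C) <= 4 * M * s.
Proof.
move=> s0 gM; have [h1 h2 h3 h4] := sq_corners c s0.
have cv := @sq_midconvex c s.
have := mid_bound n cv h1 h2 gM; have := mid_bound n cv h2 h3 gM.
have := mid_bound n cv h3 h4 gM; have := mid_bound n cv h4 h1 gM.
rewrite /bd; set a := mid _ _ _ _; set b := mid _ _ _ _; set d := mid _ _ _ _.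
set e := mid _ _ _ _.
have -> : c + s%:C - c = s%:C by ring.
have -> : c + s%:C + 'i * s%:C - (c + s%:C) = 'i * s%:C by ring.
have -> : c + 'i * s%:C - (c + s%:C + 'i * s%:C) = - s%:C by ring.
have -> : c - (c + 'i * s%:C) = - ('i * s%:C) by ring.
rewrite !nrmN !nrmM nrm_i !nrm_real ger0_norm // mul1r.
have := nrmD (e + d + b) a; have := nrmD (e + d) b; have := nrmD e d; lra.
Qed.

End midpoint_sums.

Section goursat.
Variable R : realType.
Local Notation C := R[i].

Lemma nrmD4 (a b c d : C) : nrm (a + b + c + d) <= nrm a + nrm b + nrm c + nrm d.
Proof. have := nrmD (a + b + c) d; have := nrmD (a + b) c; have := nrmD a b; lra. Qed.

Lemma nested_intervals (a b : nat -> R) : (forall k l, a k <= b l) ->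
  exists x, forall k, a k <= x <= b k.
Proof.
move=> ab; exists (sup (range a)) => k; apply/andP; split.
  by apply: ub_le_sup; [exists (b 0%N) => _ [l _ <-] | exists k].
by apply: ge_sup; [exists (a 0%N), 0%N | move=> _ [l _ <-]].
Qed.

Lemma half_pow_lt (s d : R) : 0 < d -> exists k, s / 2 ^+ k < d.
Proof.
move=> d0; have [k hk] : exists k : nat, s / d < k%:R.
  by exists (Num.truncn `|s / d|).+1; apply: (le_lt_trans (ler_norm _)); exact: truncnS_gt.
exists k; rewrite ltr_pdivrMr ?exprn_gt0//.
have : (k%:R : R) < 2 ^+ k by rewrite -natrX ltr_nat ltn_expl.
rewrite ltr_pdivrMr // in hk; move=> h; apply: (lt_le_trans hk).
by rewrite mulrC ler_pM2l // ltW.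
Qed.

(* [wt x x0 s] is the mass in [x0, x0 + s] of the Dirac measure at x, averaged
   between open and closed intervals so that it is additive under bisection. *)
Definition wt (x x0 s : R) := (Num.sg (x - x0) - Num.sg (x - (x0 + s))) / 2.

Lemma wt_split x x0 s : wt x x0 (s + s) = wt x x0 s + wt x (x0 + s) s.
Proof. by rewrite /wt addrA; field. Qed.

Lemma wt_bounds x x0 s : 0 < s -> 0 <= wt x x0 s <= 1.
Proof. by move=> s0; rewrite /wt; case: (sgrP (x - x0)); case: (sgrP (x - (x0 + s))); lra. Qed.

Lemma wt_in x x0 s : 0 < s -> x0 <= x <= x0 + s -> 2^-1 <= wt x x0 s.
Proof. by move=> s0; rewrite /wt; case: (sgrP (x - x0)); case: (sgrP (x - (x0 + s))); lra. Qed.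

Definition mu (z c : C) (s : R) :=
  wt (complex.Re z) (complex.Re c) s * wt (complex.Im z) (complex.Im c) s.

Lemma mu_split z c s : mu z c (s + s) = mu z c s + mu z (c + s%:C) s +
  mu z (c + 'i * s%:C) s + mu z (c + s%:C + 'i * s%:C) s.
Proof.
by rewrite /mu !wt_split !(ReD, ImD) !ReiM !ImiM /= !addr0; ring.
Qed.

Lemma mu_bounds z c s : 0 < s -> 0 <= mu z c s <= 1.
Proof.
move=> s0; rewrite /mu; have /andP[a b] := wt_bounds (complex.Re z) (complex.Re c) s0.
have /andP[d e] := wt_bounds (complex.Im z) (complex.Im c) s0.
by rewrite mulr_ge0 //= mulr_ile1.
Qed.

Lemma mu_in z c s : 0 < s -> sq c s z -> 4^-1 <= mu z c s.
Proof.
move=> s0 [/(wt_in s0) a /(wt_in s0) b]; rewrite /mu.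
have -> : 4^-1 = 2^-1 * 2^-1 :> R by field.
by apply: ler_pM.
Qed.

Lemma sq_child (c : C) (h : R) (w : C) : 0 < h ->
  [\/ sq c h w, sq (c + h%:C) h w, sq (c + 'i * h%:C) h w |
      sq (c + h%:C + 'i * h%:C) h w] -> sq c (h + h) w.
Proof.
move=> h0; rewrite /sq /= !(ReD, ImD) !ReiM !ImiM /=.
by case=> -[/andP[? ?] /andP[? ?]]; split; lra.
Qed.

(** Bisection with the budget [e * (area + mu)], which is additive under subdivision, so a square
    that exceeds its budget has a child that does. In the limit the affine approximation beats the
    area term away from [z]; at [z] the bound [M] gives a sum of order the side, paid for by the
    mass of [z], at least [4^-1] in every square that contains it. *)
Lemma goursat g z c0 s0 : 0 < s0 ->
  (forall w, sq c0 s0 w -> w != z -> cdiff g w) ->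
  (exists2 r : R, 0 < r & exists M, forall w, nrm (w - z) < r -> nrm (g w) <= M) ->
  forall e, 0 < e -> exists N, forall n, (N <= n)%N -> nrm (bd n g c0 s0%:C) <= e.
Proof.
move=> s00 gd [r r0 [M gM]] e0 e00.
(* The mass of [z] is at most 1, so the whole budget is at most [e0]. *)
pose e := e0 / (s0 ^+ 2 + 1).
have s1 : 0 < s0 ^+ 2 + 1 by rewrite ltr_pwDr// sqr_ge0.
have epos : 0 < e by rewrite divr_gt0.
pose good c s := exists N, forall n, (N <= n)%N ->
  nrm (bd n g c s%:C) <= e * (s ^+ 2 + mu z c s).
suff [N hN] : good c0 s0.
  exists N => n /hN /le_trans; apply; rewrite /e mulrAC ler_pdivrMr//.
  rewrite ler_pM2l// lerD2l; by have /andP[] := mu_bounds z c0 s00.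
have split_good c h : 0 < h -> good c h -> good (c + h%:C) h ->
    good (c + 'i * h%:C) h -> good (c + h%:C + 'i * h%:C) h -> good c (h + h).
  move=> h0 [N1 g1] [N2 g2] [N3 g3] [N4 g4].
  (* The successor pays for the level that a bisection consumes. *)
  exists (N1 + N2 + N3 + N4).+1 => -[//|n] nN.
  rewrite rmorphD bd_split mu_split.
  have := g1 n ltac:(lia); have := g2 n ltac:(lia); have := g3 n ltac:(lia).
  have := g4 n ltac:(lia).
  have := nrmD4 (bd n g c h%:C) (bd n g (c + h%:C) h%:C)
    (bd n g (c + 'i * h%:C) h%:C) (bd n g (c + h%:C + 'i * h%:C) h%:C).
  have -> : e * ((h + h) ^+ 2 + (mu z c h + mu z (c + h%:C) h + mu z (c + 'i * h%:C) h +
    mu z (c + h%:C + 'i * h%:C) h)) = e * (h ^+ 2 + mu z c h) +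
    e * (h ^+ 2 + mu z (c + h%:C) h) + e * (h ^+ 2 + mu z (c + 'i * h%:C) h) +
    e * (h ^+ 2 + mu z (c + h%:C + 'i * h%:C) h) by ring.
  lra.
apply: contrapT => bad0.
have /choice[f fP] : forall x : C * R, exists y, 0 < x.2 ->
    ~ good x.1 (x.2 + x.2) ->
    ~ good y x.2 /\ (sq y x.2 `<=` sq x.1 (x.2 + x.2)).
  move=> -[c h] /=.
  have [h0|h0] := ltP 0 h; last by exists c => h1; lra.
  have [g1|b1] := pselect (good c h); last first.
    by exists c => _ _; split=> // w W; apply: sq_child => //; exact: Or41.
  have [g2|b2] := pselect (good (c + h%:C) h); last first.
    by exists (c + h%:C) => _ _; split=> // w W; apply: sq_child => //; exact: Or42.
  have [g3|b3] := pselect (good (c + 'i * h%:C) h); last first.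
    by exists (c + 'i * h%:C) => _ _; split=> // w W; apply: sq_child => //; exact: Or43.
  exists (c + h%:C + 'i * h%:C) => _ b; split; last first.
    by move=> w W; apply: sq_child => //; exact: Or44.
  by move=> g4; apply: b; exact: split_good.
pose s k := s0 / 2 ^+ k.
have sS k : s k = s k.+1 + s k.+1.
  by rewrite /s exprS; field; rewrite expf_neq0.
have spos k : 0 < s k by rewrite divr_gt0// exprn_gt0.
pose F := fix F k := if k is l.+1 then f (F l, s l.+1) else c0.
have Fbad k : ~ good (F k) (s k).
  elim: k => [|k IH]; first by rewrite /s expr0 divr1.
  by have := fP (F k, s k.+1) (spos _); rewrite /= -sS => /(_ IH)[].
have Fsub k : sq (F k.+1) (s k.+1) `<=` sq (F k) (s k).
  by have := fP (F k, s k.+1) (spos _); rewrite /= -sS => /(_ (Fbad k))[].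
have Fle k l : sq (F (k + l)%N) (s (k + l)%N) `<=` sq (F k) (s k).
  elim: l => [|l IH]; first by rewrite addn0.
  by rewrite addnS; apply: subset_trans IH; exact: Fsub.
have Fin k l : sq (F k) (s k) (F (k + l)%N).
  by apply: (Fle k l); have [] := sq_corners (F (k + l)%N) (ltW (spos (k + l)%N)).
have Fkl k l : complex.Re (F k) <= complex.Re (F l) + s l /\
    complex.Im (F k) <= complex.Im (F l) + s l.
  have [kl|lk] := leqP k l.
    have := Fin k (l - k)%N; rewrite subnKC// => -[/andP[? ?] /andP[? ?]].
    by have := spos l; split; lra.
  have := Fin l (k - l)%N; rewrite subnKC 1?ltnW// => -[/andP[? ?] /andP[? ?]].
  by split.
have [x xP] := @nested_intervals (fun k => complex.Re (F k)) (fun k => complex.Re (F k) + s k)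
  (fun k l => (Fkl k l).1).
have [y yP] := @nested_intervals (fun k => complex.Im (F k)) (fun k => complex.Im (F k) + s k)
  (fun k l => (Fkl k l).2).
have pin k : sq (F k) (s k) (Complex x y) by split; [exact: xP | exact: yP].
have pin0 : sq c0 s0 (Complex x y) by have := pin 0%N; rewrite /s expr0 divr1.
have M0 : 0 <= M by apply: le_trans (gM z _); rewrite ?subrr ?nrm0 ?nrm_ge0.
have [pz|pz] := eqVneq (Complex x y) z.
  rewrite pz in pin.
  (* With diameter bound [2 * s k < d] the square lies in the disc where [g] is bounded, and
     [4 * M * s k <= e / 4]. *)
  pose d := Num.min r (e / (16 * M + 1)).
  have d0 : 0 < d by rewrite lt_min r0 divr_gt0//; lra.
  have [k] := half_pow_lt (s0 + s0) d0; rewrite -/(s k) lt_min => /andP[kr].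
  rewrite ltr_pdivlMr; last lra.
  move=> ke; apply: (Fbad k); exists 0%N => n _.
  have s2 : (s0 + s0) / 2 ^+ k = 2 * s k by rewrite /s; ring.
  rewrite s2 in ke kr.
  apply: (le_trans (@bd_bound _ n g M (F k) (s k) (ltW (spos k)) _)).
    move=> w wF; apply: gM; apply: le_lt_trans kr; exact: sq_dist wF (pin k).
  have m4 := mu_in (spos k) (pin k).
  have sk := spos k.
  have : e * 4^-1 <= e * (s k ^+ 2 + mu z (F k) (s k)).
    by rewrite ler_pM2l//; have := sqr_ge0 (s k); lra.
  have := mulr_ge0 M0 (ltW sk); lra.
have [D gD] := gd _ pin0 pz.
(* Two points of the square are at distance at most [2 * s k], so the non-affine remainder is at
   most [e / 4 * s k] and its boundary sum at most [e * s k ^+ 2]. *)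
have e8 : 0 < e / 8 by lra.
have [d d0 {}gD] := gD _ e8.
have [k kd] := half_pow_lt (s0 + s0) d0.
have s2 : (s0 + s0) / 2 ^+ k = 2 * s k by rewrite /s; ring.
rewrite s2 in kd.
apply: (Fbad k); exists 0%N => n _.
set p := Complex x y in pin gD.
pose rem w := g w - g p - D * (w - p).
have gE : g = (fun w => 1 * rem w + (D * w + (g p - D * p))).
  by apply/funext => w; rewrite /rem; ring.
rewrite gE bd_lin bd_affine mul1r addr0.
apply: (le_trans (@bd_bound _ n rem (e / 4 * s k) (F k) (s k) (ltW (spos k)) _)).
  move=> w wF; have wd := sq_dist wF (pin k).
  apply: (le_trans (gD w _)); first exact: le_lt_trans kd.
  by have := ler_wpM2l (ltW e8) wd; lra.
have -> : 4 * (e / 4 * s k) * s k = e * s k ^+ 2 by field.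
by rewrite ler_pM2l// lerDl; have /andP[] := mu_bounds z (F k) (spos k).
Qed.

End goursat.

(** * Differentiability rules and the Cauchy kernel on a square *)

Section kernels.
Variable R : realType.
Local Notation C := R[i].

Lemma cdiff_ext (f g : C -> C) z r : 0 < r -> (forall w, nrm (w - z) < r -> f w = g w) ->
  cdiff f z -> cdiff g z.
Proof.
move=> r0 fg [D fD]; exists D => e e0; have [d d0 dP] := fD e e0.
exists (Num.min d r) => [|w]; first by rewrite lt_min d0.
by rewrite lt_min => /andP[/dP wd wr]; rewrite -!fg// subrr nrm0.
Qed.

Lemma cdiff_cst (k : C) z : cdiff (fun _ => k) z.
Proof.
by exists 0 => e e0; exists 1 => // w _; rewrite subrr mul0r subr0 nrm0 mulr_ge0 ?nrm_ge0 ?ltW.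
Qed.

Lemma cdiff_id z : cdiff (fun w : C => w) z.
Proof.
by exists 1 => e e0; exists 1 => // w _; rewrite mul1r subrr nrm0 mulr_ge0 ?nrm_ge0 ?ltW.
Qed.

Lemma cdiff_lip (f : C -> C) z : cdiff f z -> exists K : R, 0 <= K /\
  exists2 d, 0 < d & forall w, nrm (w - z) < d -> nrm (f w - f z) <= K * nrm (w - z).
Proof.
move=> [D fD]; have [d d0 dP] := fD 1 ltr01; exists (1 + nrm D).
split; first by rewrite addr_ge0 ?nrm_ge0.
exists d => // w /dP; rewrite mul1r mulrDl mul1r -nrmM => h.
by have := nrmD (f w - f z - D * (w - z)) (D * (w - z)); rewrite subrK; lra.
Qed.

Lemma cdiffB (f g : C -> C) z : cdiff f z -> cdiff g z -> cdiff (fun w => f w - g w) z.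
Proof.
move=> [D fD] [E gE]; exists (D - E) => e e0; have e2 : 0 < e / 2 by lra.
have [d1 d10 h1] := fD _ e2; have [d2 d20 h2] := gE _ e2.
exists (Num.min d1 d2) => [|w]; first by rewrite lt_min d10.
rewrite lt_min => /andP[/h1 {}h1 /h2 {}h2].
have -> : f w - g w - (f z - g z) - (D - E) * (w - z) =
  (f w - f z - D * (w - z)) - (g w - g z - E * (w - z)) by ring.
apply: (le_trans (nrmB _ _)); lra.
Qed.

Lemma cdiffM (f g : C -> C) z : cdiff f z -> cdiff g z -> cdiff (fun w => f w * g w) z.
Proof.
move=> fz gz; have [K [K0 [d3 d30 h3]]] := cdiff_lip gz.
move: fz gz => [D fD] [E gE]; exists (D * g z + f z * E) => e e0.
pose B := nrm (g z) + K; have B0 : 0 <= B by rewrite addr_ge0 ?nrm_ge0.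
pose e1 := e / (3 * (B + 1)); pose e2 := e / (3 * (nrm (f z) + 1)).
pose e3 := e / (3 * (K * nrm D + 1)).
have fz0 := nrm_ge0 (f z); have D0 := nrm_ge0 D; have KD := mulr_ge0 K0 D0.
have e10 : 0 < e1 by rewrite divr_gt0//; lra.
have e20 : 0 < e2 by rewrite divr_gt0//; lra.
have e30 : 0 < e3 by rewrite divr_gt0//; lra.
have e1E : e1 * (B + 1) = e / 3 by rewrite /e1; field; lra.
have e2E : e2 * (nrm (f z) + 1) = e / 3 by rewrite /e2; field; lra.
have e3E : e3 * (K * nrm D + 1) = e / 3 by rewrite /e3; field; lra.
have [d1 d10 h1] := fD _ e10; have [d2 d20 h2] := gE _ e20.
exists (Num.min (Num.min d1 d2) (Num.min d3 (Num.min 1 e3))) => [|w].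
  by rewrite !lt_min d10 d20 d30 ltr01 e30.
rewrite !lt_min -!andbA => /and5P[/h1 {}h1 /h2 {}h2 /h3 {}h3 w1 we].
have -> : f w * g w - f z * g z - (D * g z + f z * E) * (w - z) =
  (f w - f z - D * (w - z)) * g w + f z * (g w - g z - E * (w - z)) +
  D * (w - z) * (g w - g z) by ring.
set x := nrm (w - z) in h1 h2 h3 w1 we *; have x0 : 0 <= x by exact: nrm_ge0.
have gB : nrm (g w) <= B.
  have := nrmD (g w - g z) (g z); rewrite subrK /B.
  by have := ler_wpM2l K0 (ltW w1); lra.
apply: (le_trans (nrmD _ _)); apply: (le_trans (lerD (nrmD _ _) (lexx _))).
rewrite !nrmM -/x.
have t1 : nrm (f w - f z - D * (w - z)) * nrm (g w) <= (e / 3) * x.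
  apply: (le_trans (ler_pM (nrm_ge0 _) (nrm_ge0 _) h1 gB)).
  have : e1 * B <= e / 3 by rewrite -e1E ler_pM2l//; lra.
  by move=> /(ler_wpM2r x0); lra.
have t2 : nrm (f z) * nrm (g w - g z - E * (w - z)) <= (e / 3) * x.
  apply: (le_trans (ler_wpM2l fz0 h2)).
  have : e2 * nrm (f z) <= e / 3 by rewrite -e2E ler_pM2l//; lra.
  by move=> /(ler_wpM2r x0); lra.
have t3 : nrm D * x * nrm (g w - g z) <= (e / 3) * x.
  apply: (le_trans (ler_wpM2l (mulr_ge0 D0 x0) h3)).
  have : e3 * (K * nrm D) <= e / 3 by rewrite -e3E ler_pM2l//; lra.
  move=> /(ler_wpM2r x0); have := ler_wpM2r (mulr_ge0 KD x0) (ltW we); lra.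
lra.
Qed.

Lemma cdiff_inv (a z : C) : z != a -> cdiff (fun w => (w - a)^-1) z.
Proof.
move=> za; exists (- (z - a) ^- 2) => e e0.
have n0 : 0 < nrm (z - a) by rewrite nrm_gt0 subr_eq0.
exists (Num.min (nrm (z - a) / 2) (e * nrm (z - a) ^+ 3 / 2)) => [|w].
  by rewrite lt_min !divr_gt0// mulr_gt0// exprn_gt0.
rewrite lt_min => /andP[w1 w2].
have wa : nrm (z - a) / 2 < nrm (w - a).
  by have := nrm_dist w z a; rewrite [nrm (z - w)]nrmBC; lra.
have wa0 : w - a != 0 by rewrite -nrm_gt0; lra.
have za0 : z - a != 0 by rewrite -nrm_gt0; lra.
have -> : (w - a)^-1 - (z - a)^-1 - - (z - a) ^- 2 * (w - z) =
  (w - z) * ((w - z) / ((w - a) * (z - a) ^+ 2)) by field; rewrite wa0 za0.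
rewrite nrmM mulrC ler_wpM2r ?nrm_ge0// nrm_div nrmM nrmX.
rewrite ler_pdivrMr; last by rewrite mulr_gt0 ?exprn_gt0//; lra.
apply: (le_trans (ltW w2)).
have -> : e * nrm (z - a) ^+ 3 / 2 = e * (nrm (z - a) / 2 * nrm (z - a) ^+ 2) by ring.
by rewrite ler_pM2l// ler_pM2r ?exprn_gt0// ltW.
Qed.

(* The bad point of [goursat] is [z] itself, where the quotient takes the
   junk value 0 but stays bounded nearby. *)
Lemma goursat_quotient (g : C -> C) (z c : C) (s : R) : 0 < s -> (forall w, sq c s w -> cdiff g w) ->
  cdiff g z ->
  forall e, 0 < e -> exists N, forall n, (N <= n)%N ->
    nrm (bd n (fun w => (w - z)^-1 * (g w - g z)) c s%:C) <= e.
Proof.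
move=> s0 gd gz; apply: (@goursat _ _ z) => //.
  move=> w wQ wz; apply: cdiffM; first exact: cdiff_inv.
  by apply: cdiffB; [exact: gd | exact: cdiff_cst].
have [K [K0 [d d0 dP]]] := cdiff_lip gz.
exists d => //; exists K => w /dP; have [->|wz] := eqVneq w z.
  by rewrite !subrr mulr0 nrm0.
by move=> h; rewrite nrmM nrmV [X in X <= _]mulrC ler_pdivrMr// nrm_gt0 subr_eq0.
Qed.

Lemma goursat_inv (z c : C) (s : R) : 0 < s -> ~ sq c s z ->
  forall e, 0 < e -> exists N, forall n, (N <= n)%N ->
    nrm (bd n (fun w => (w - z)^-1) c s%:C) <= e.
Proof.
move=> s0 zQ.
have wz w : sq c s w -> w != z by move=> wQ; apply/eqP => wz; rewrite wz in wQ.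
(* There is no bad point here: the corner [c] is a dummy, near which the kernel is bounded by
   differentiability. *)
apply: (@goursat _ _ c) => // [w /wz + _|]; first exact: cdiff_inv.
have cz : c != z by apply: wz; have [] := sq_corners c (ltW s0).
have [K [K0 [d d0 dP]]] := cdiff_lip (cdiff_inv cz).
exists (Num.min d 1); first by rewrite lt_min d0 ltr01.
exists (K + nrm ((c - z)^-1)) => w; rewrite lt_min => /andP[/dP h w1].
have := nrmD ((w - z)^-1 - (c - z)^-1) ((c - z)^-1); rewrite subrK.
by have := ler_wpM2l K0 (ltW w1); lra.
Qed.

Lemma Im_inv (x y : R) : complex.Im ((Complex x y : C)^-1) = - (y / (x ^+ 2 + y ^+ 2)).
Proof. by []. Qed.
Lemma Re_inv (x y : R) : complex.Re ((Complex x y : C)^-1) = x / (x ^+ 2 + y ^+ 2).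
Proof. by []. Qed.

(** The alternative [a = 0] is for a pole lying on the side of the square, where both quotients are
    0. *)
Lemma div_sqr_ge (a x y s : R) : 0 <= a -> 0 < s -> `|x| <= s -> `|y| <= s ->
  (a = 0 \/ x ^+ 2 + y ^+ 2 != 0) -> a / (2 * s ^+ 2) <= a / (x ^+ 2 + y ^+ 2).
Proof.
move=> a0 s0 xs ys [->|n0]; first by rewrite !mul0r.
have p : 0 < x ^+ 2 + y ^+ 2 by rewrite lt_def n0 addr_ge0 ?sqr_ge0.
rewrite ler_wpM2l// lef_pV2 ?posrE// ?mulr_gt0 ?exprn_gt0//.
have h t : `|t| <= s -> t ^+ 2 <= s ^+ 2.
  by move=> ts; rewrite -(real_normK (num_real t)) ler_pXn2r ?nnegrE ?(ltW s0).
by have := h _ xs; have := h _ ys; lra.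
Qed.

(** On a side at distance [t] from [z] the imaginary part of the kernel times the direction is
    [t / |w - z|^2], at least [t / (2 * s ^+ 2)]. The distances to opposite sides add up to [s], so
    the four sides give at least [2 * s * s / (2 * s ^+ 2) = 1]. The bound holds at every level [n]
    and also for [z] on the boundary. *)
Lemma bd_inv_Im n (z c : C) (s : R) : 0 < s -> sq c s z ->
  1 <= complex.Im (bd n (fun w => (w - z)^-1) c s%:C).
Proof.
move=> s0 zQ; have [q1 q2 q3 q4] := sq_corners c (ltW s0).
case: (zQ) => /andP[x1 x2] /andP[y1 y2].
have Ri (w : C) : complex.Re (w * 'i) = - complex.Im w.
  by rewrite -complexiE; case: w => a b /=; rewrite mulr0 mulr1 sub0r.
have Ii (w : C) : complex.Im (w * 'i) = complex.Re w.
  by rewrite -complexiE; case: w => a b /=; rewrite mulr0 mulr1 addr0.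
have wE (w : C) : w - z = Complex (complex.Re w - complex.Re z) (complex.Im w - complex.Im z).
  by case: w; case: (z).
have side (P : set C) a b u t : midconvex P -> P a -> P b -> b = a + s%:C * u -> 0 <= t ->
    (forall w, P w -> sq c s w /\
      exists2 v, complex.Im ((w - z)^-1 * u) = v / ((complex.Re w - complex.Re z) ^+ 2 + (complex.Im w - complex.Im z) ^+ 2) &
      v = t /\ (`|v| = `|complex.Re w - complex.Re z| \/ `|v| = `|complex.Im w - complex.Im z|)) ->
    t / (2 * s ^+ 2) * s <= complex.Im (mid n (fun w => (w - z)^-1) a b).
  move=> cP Pa Pb bE t0 PP; apply: (@mid_Im_ge _ n P _ _ a b u) => //; first exact: ltW.
  move=> w /PP[[/andP[w1 w2] /andP[w3 w4]] [v -> [-> vt]]].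
  apply: div_sqr_ge => //; rewrite ?ler_norml; [lra|lra|].
  have [->|tn0] := eqVneq t 0; first by left.
  right; rewrite paddr_eq0 ?sqr_ge0// !sqrf_eq0 negb_and.
  by case: vt => vt; apply/orP; [left|right]; rewrite -normr_eq0 -vt normr_eq0.
have h1 : (complex.Im z - complex.Im c) / (2 * s ^+ 2) * s <=
    complex.Im (mid n (fun w => (w - z)^-1) c (c + s%:C)).
  apply: (@side [set w | sq c s w /\ complex.Im w = complex.Im c] _ _ 1).
  - move=> x y [a1 a2] [b1 b2]; split; first exact: sq_midconvex.
    by rewrite ImM2 ImD; lra.
  - by split.
  - by split => //; rewrite ImD /=; lra.
  - by rewrite mulr1.
  - lra.
  - move=> w [wQ wI]; split=> //; exists (complex.Im z - complex.Im c) => //.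
      by rewrite mulr1 wE Im_inv -wI -mulNr opprB.
    by split => //; right; rewrite wI distrC.
have h2 : (complex.Re c + s - complex.Re z) / (2 * s ^+ 2) * s <=
    complex.Im (mid n (fun w => (w - z)^-1) (c + s%:C) (c + s%:C + 'i * s%:C)).
  apply: (@side [set w | sq c s w /\ complex.Re w = complex.Re c + s] _ _ 'i).
  - move=> x y [a1 a2] [b1 b2]; split; first exact: sq_midconvex.
    by rewrite ReM2 ReD; lra.
  - by split => //; rewrite ReD.
  - by split => //; rewrite !ReD ReiM /=; lra.
  - by rewrite mulrC.
  - lra.
  - move=> w [wQ wI]; split=> //; exists (complex.Re c + s - complex.Re z) => //.
      by rewrite Ii wE Re_inv wI.
    by split => //; left; rewrite wI.
have h3 : (complex.Im c + s - complex.Im z) / (2 * s ^+ 2) * s <=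
    complex.Im (mid n (fun w => (w - z)^-1) (c + s%:C + 'i * s%:C) (c + 'i * s%:C)).
  apply: (@side [set w | sq c s w /\ complex.Im w = complex.Im c + s] _ _ (-1)).
  - move=> x y [a1 a2] [b1 b2]; split; first exact: sq_midconvex.
    by rewrite ImM2 ImD; lra.
  - by split => //; rewrite !ImD ImiM /=; lra.
  - by split => //; rewrite !ImD ImiM.
  - by ring.
  - lra.
  - move=> w [wQ wI]; split=> //; exists (complex.Im c + s - complex.Im z) => //.
      by rewrite mulrN1 ImN wE Im_inv opprK wI.
    by split => //; right; rewrite wI.
have h4 : (complex.Re z - complex.Re c) / (2 * s ^+ 2) * s <=
    complex.Im (mid n (fun w => (w - z)^-1) (c + 'i * s%:C) c).
  apply: (@side [set w | sq c s w /\ complex.Re w = complex.Re c] _ _ (- 'i)).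
  - move=> x y [a1 a2] [b1 b2]; split; first exact: sq_midconvex.
    by rewrite ReM2 ReD; lra.
  - by split => //; rewrite !ReD ReiM; lra.
  - by split.
  - by ring.
  - lra.
  - move=> w [wQ wI]; split=> //; exists (complex.Re z - complex.Re c) => //.
      by rewrite mulrN ImN Ii wE Re_inv wI -mulNr opprB.
    by split => //; left; rewrite wI distrC.
rewrite /bd !ImD.
apply: (le_trans _ (lerD (lerD (lerD h1 h2) h3) h4)).
rewrite le_eqVlt; apply/orP; left; apply/eqP; field; lra.
Qed.
End kernels.

(** * Polynomial approximation and pole pushing *)

Section polynomial_approximation.
Variable R : realType.
Local Notation C := R[i].
Implicit Types (X : set C) (f g : C -> C).

Definition approximable X f := forall e : R, 0 < e ->
  exists p : {poly C}, forall z, X z -> nrm (f z - p.[z]) <= e.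

Definition bounded_on X f := exists B : R, forall z, X z -> nrm (f z) <= B.

Lemma approx_ext X f g : (forall z, X z -> f z = g z) -> approximable X f -> approximable X g.
Proof. by move=> fg af e /af[p pP]; exists p => z Xz; rewrite -fg// pP. Qed.

Lemma approx_poly X (p : {poly C}) : approximable X (horner p).
Proof. by move=> e e0; exists p => z _; rewrite subrr nrm0 ltW. Qed.

Lemma approx_cst X (k : C) : approximable X (fun _ => k).
Proof. by apply: approx_ext (approx_poly X k%:P) => z _; rewrite hornerC. Qed.

Lemma approx_lim X f : (forall e : R, 0 < e -> exists2 g, approximable X g &
  forall z, X z -> nrm (f z - g z) <= e) -> approximable X f.
Proof.
move=> fP e e0; have e2 : 0 < e / 2 by lra.
have [g gA fg] := fP _ e2; have [p pP] := gA _ e2; exists p => z Xz.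
by have := nrm_dist (g z) (f z) p.[z]; have := fg z Xz; have := pP z Xz; lra.
Qed.

Lemma approxD X f g : approximable X f -> approximable X g ->
  approximable X (fun z => f z + g z).
Proof.
move=> fA gA e e0; have e2 : 0 < e / 2 by lra.
have [p pP] := fA _ e2; have [q qP] := gA _ e2; exists (p + q) => z Xz.
rewrite hornerD; have -> : f z + g z - (p.[z] + q.[z]) = (f z - p.[z]) + (g z - q.[z]) by ring.
by apply: (le_trans (nrmD _ _)); have := pP z Xz; have := qP z Xz; lra.
Qed.

Lemma approx_sum X (I : Type) (r : seq I) (F : I -> C -> C) :
  (forall i, approximable X (F i)) -> approximable X (fun z => \sum_(i <- r) F i z).
Proof.
move=> FA; elim: r => [|i r IH].
  by apply: approx_ext (approx_cst X 0) => z _; rewrite big_nil.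
by apply: approx_ext (approxD (FA i) IH) => z _; rewrite big_cons.
Qed.

Lemma poly_bounded X (p : {poly C}) : bounded_on X id -> bounded_on X (horner p).
Proof.
move=> [B XB]; elim/poly_ind: p => [|p c [M pM]].
  by exists 0 => z _; rewrite horner0 nrm0.
exists (M * B + nrm c) => z Xz; rewrite !hornerE.
by rewrite (le_trans (nrmD _ _))// lerD2r nrmM ler_pM ?nrm_ge0 ?pM ?XB.
Qed.

Lemma approx_bounded X f : bounded_on X id -> approximable X f -> bounded_on X f.
Proof.
move=> bX /(_ 1 ltr01)[p pP]; have [B pB] := poly_bounded p bX; exists (1 + B) => z Xz.
by have := nrmD (f z - p.[z]) p.[z]; rewrite subrK; have := pP z Xz; have := pB z Xz; lra.
Qed.

Lemma approxM X f g : bounded_on X id -> approximable X f -> approximable X g ->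
  approximable X (fun z => f z * g z).
Proof.
move=> bX fA gA e e0.
have [Bf fB] := approx_bounded bX fA.
pose M := Num.max Bf 0; have M0 : 0 <= M by rewrite le_max lexx orbT.
have fM z : X z -> nrm (f z) <= M by move=> /fB h; rewrite le_max h.
have e1 : 0 < e / (2 * (M + 1)) by rewrite divr_gt0//; lra.
have [q qP] := gA _ e1; have [Bq qB] := poly_bounded q bX.
pose N := Num.max Bq 0; have N0 : 0 <= N by rewrite le_max lexx orbT.
have e2 : 0 < e / (2 * (N + 1)) by rewrite divr_gt0//; lra.
have [p pP] := fA _ e2; exists (p * q) => z Xz.
rewrite hornerM; have -> : f z * g z - p.[z] * q.[z] =
  f z * (g z - q.[z]) + (f z - p.[z]) * q.[z] by ring.
apply: (le_trans (nrmD _ _)); rewrite !nrmM.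
have qN : nrm q.[z] <= N by rewrite le_max qB.
have h1 := ler_pM (nrm_ge0 _) (nrm_ge0 _) (fM z Xz) (qP z Xz).
have h2 := ler_pM (nrm_ge0 _) (nrm_ge0 _) (pP z Xz) qN.
have h3 : M * (e / (2 * (M + 1))) <= e / 2.
  by rewrite mulrA ler_pdivrMr; [have := mulr_ge0 M0 (ltW e0); lra | lra].
have h4 : e / (2 * (N + 1)) * N <= e / 2.
  by rewrite mulrAC ler_pdivrMr; [have := mulr_ge0 N0 (ltW e0); lra | lra].
lra.
Qed.

Lemma geometric_lt (rho e : R) : 0 <= rho < 1 -> 0 < e -> exists n, rho ^+ n < e.
Proof.
move=> /andP[r0 r1] e0.
have /(@cvgrPdist_lt _ R^o _ _ _ _ _)/(_ _ e0)[N _ NP] : rho ^+ n @[n --> \oo] --> (0 : R).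
  by apply: cvg_expr; rewrite ger0_norm.
by exists N; have := NP N (leqnn N); rewrite sub0r normrN ger0_norm ?exprn_ge0.
Qed.

Lemma approx_geometric X f (rho : R) : bounded_on X id -> approximable X f ->
  0 <= rho < 1 -> (forall z, X z -> nrm (f z) <= rho) ->
  approximable X (fun z => (1 - f z)^-1).
Proof.
move=> bX fA /andP[r0 r1] fr; apply: approx_lim => e e0.
have [n nP] : exists n, rho ^+ n < e * (1 - rho).
  by apply: geometric_lt; [rewrite r0 r1 | rewrite mulr_gt0//; lra].
exists (fun z => \sum_(0 <= i < n) f z ^+ i).
  apply: approx_sum => i; elim: i => [|i IH].
    by apply: approx_ext (approx_cst X 1) => z _; rewrite expr0.
  by apply: approx_ext (approxM bX fA IH) => z _; rewrite exprS.
move=> z Xz; have n1 : 1 - rho <= nrm (1 - f z).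
  have := nrmD (1 - f z) (f z); rewrite subrK nrm1; have := fr z Xz; lra.
have nz : 1 - f z != 0 by rewrite -nrm_gt0; lra.
have -> : (1 - f z)^-1 - \sum_(0 <= i < n) f z ^+ i = f z ^+ n / (1 - f z).
  have E : 1 - f z ^+ n = (1 - f z) * \sum_(0 <= i < n) f z ^+ i.
    rewrite -{1}(expr1n _ n) subrXX big_mkord.
    by congr (_ * _); apply: eq_bigr => i _; rewrite expr1n mul1r.
  apply: (mulfI nz); rewrite mulrBr -E; field; exact: nz.
rewrite nrm_div nrmX ler_pdivrMr; last lra.
have h1 : nrm (f z) ^+ n <= rho ^+ n by rewrite lerXn2r ?nnegrE ?nrm_ge0 ?fr.
have := ler_wpM2l (ltW e0) n1; lra.
Qed.

(* The points reached from infinity by pole pushing: at each step [1 / (z - c)]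
   is a geometric series in [1 / (z - b)] that converges uniformly on [X]. *)
Inductive outer X : C -> Prop :=
| outer_far a (k : R) : 0 < k -> (forall z, X z -> nrm z + k <= nrm a) -> outer X a
| outer_step b c (k : R) : 0 < k -> outer X b ->
    (forall z, X z -> nrm (b - c) + k <= nrm (z - b)) -> outer X c.

Lemma outer_notin X a : outer X a -> ~ X a.
Proof.
case=> [{}a k k0 h /h|b c k k0 _ h /h]; first lra.
by rewrite nrmBC; lra.
Qed.

Lemma approx_inv_outer X a : bounded_on X id -> outer X a ->
  approximable X (fun z => (z - a)^-1).
Proof.
move=> bX; elim=> {a} [a k k0 h|b c k k0 ob IH h].
  have [X0|/set0P[x Xx]] := eqVneq X set0.
    by move=> e e0; exists 0 => z; rewrite X0.
  have na : 0 < nrm a by have := h x Xx; have := nrm_ge0 x; lra.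
  have a0 : a != 0 by rewrite -nrm_gt0.
  apply: (@approx_ext _ (fun z => - a^-1 * (1 - a^-1 * z)^-1)).
    move=> z Xz; have za : z - a != 0.
      by rewrite subr_eq0; apply/eqP => E; have := h z Xz; rewrite E; lra.
    have az : a - z != 0 by rewrite -opprB oppr_eq0.
    by field; rewrite a0 za az.
  apply: approxM => //; first exact: approx_cst.
  apply: (@approx_geometric _ _ (1 - k / nrm a)) => //.
  - apply: approxM => //; first exact: approx_cst.
    by apply: approx_ext (approx_poly X 'X) => z _; rewrite hornerX.
  - have := h x Xx; have := nrm_ge0 x => h1 h2.
    rewrite subr_ge0 ler_pdivrMr// ltrBlDr ltrDl divr_gt0// andbT; lra.
  - move=> z Xz; rewrite nrmM nrmV mulrC ler_pdivrMr// mulrBl divfK ?gt_eqF//.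
    by have := h z Xz; lra.
have cb := nrm_ge0 (b - c).
apply: (@approx_ext _ (fun z => (z - b)^-1 * (1 - (c - b) * (z - b)^-1)^-1)).
  move=> z Xz; have := h z Xz => hz.
  have zb : z - b != 0 by rewrite -nrm_gt0; lra.
  have zc : z - c != 0.
    by rewrite subr_eq0; apply/eqP => E; move: hz; rewrite E nrmBC; lra.
  have zc' : z - b - (c - b) != 0 by have -> : z - b - (c - b) = z - c by ring.
  by field; rewrite ?zb ?zc ?zc'.
apply: approxM => //.
apply: (@approx_geometric _ _ (nrm (b - c) / (nrm (b - c) + k))) => //.
- by apply: approxM => //; exact: approx_cst.
- by rewrite divr_ge0 ?ltr_pdivrMr /=; lra.
- move=> z Xz; have hz := h z Xz; rewrite nrm_div [nrm (c - b)]nrmBC.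
  by rewrite ler_wpM2l// lef_pV2 ?posrE//; lra.
Qed.

(** A polynomial close to [f] has no root on [X], so all its roots are outer and its inverse is a
    product of the kernels handled by [approx_inv_outer]. *)
Lemma approx_inv X f (m : R) : bounded_on X id -> (forall a, ~ X a -> outer X a) ->
  approximable X f -> 0 < m -> (forall z, X z -> m <= nrm (f z)) ->
  approximable X (fun z => (f z)^-1).
Proof.
move=> bX oX fA m0 fm; apply: approx_lim => e e0.
(* The first bound keeps [p] above [m / 2] in modulus; the second then makes the inverses differ by
   at most [e]. *)
have d0 : 0 < Num.min (m / 2) (e * m ^+ 2 / 2).
  by rewrite lt_min; apply/andP; split; rewrite divr_gt0// mulr_gt0// exprn_gt0.
have [p pP] := fA _ d0.
have pm z : X z -> m / 2 <= nrm p.[z].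
  move=> Xz; have := pP z Xz; rewrite le_min => /andP[h1 _].
  have := nrmD (f z - p.[z]) p.[z]; rewrite subrK; have := fm z Xz; lra.
exists (fun z => p.[z]^-1); last first.
  move=> z Xz; have := pP z Xz; rewrite le_min => /andP[_ h].
  have f0 : f z != 0 by rewrite -nrm_gt0; have := fm z Xz; lra.
  have p0 : p.[z] != 0 by rewrite -nrm_gt0; have := pm z Xz; lra.
  have -> : (f z)^-1 - p.[z]^-1 = (p.[z] - f z) / (f z * p.[z]) by field; rewrite f0 p0.
  rewrite nrm_div nrmM nrmBC ler_pdivrMr; last by rewrite mulr_gt0 ?nrm_gt0.
  apply: (le_trans h); have -> : e * m ^+ 2 / 2 = e * (m * (m / 2)) by ring.
  by rewrite ler_pM2l//; apply: ler_pM; [lra|lra|exact: fm|exact: pm].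
have [r pr] := closed_field_poly_normal p.
have [X0|/set0P[x Xx]] := eqVneq X set0.
  by move=> e' e0'; exists 0 => z; rewrite X0.
have pn0 : lead_coef p != 0.
  rewrite lead_coef_eq0; apply/eqP => p0; have := pm x Xx; rewrite p0 horner0 nrm0; lra.
have rX a : a \in r -> ~ X a.
  move=> ar Xa; have := pm a Xa; rewrite pr hornerZ horner_prod.
  by rewrite (big_rem a)//= hornerXsubC subrr mul0r mulr0 nrm0; lra.
apply: (@approx_ext _ (fun z => (lead_coef p)^-1 * (\prod_(a <- r) (z - a)^-1))).
  move=> z Xz; rewrite {2}pr hornerZ horner_prod invfM prodfV; congr (_ * _ ^-1).
  by apply: eq_bigr => a _; rewrite hornerXsubC.
apply: approxM => //; first exact: approx_cst.
elim: r rX {pr} => [|a r IH] rX.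
  by apply: approx_ext (approx_cst X 1) => z _; rewrite big_nil.
apply: (@approx_ext _ (fun z => (z - a)^-1 * \prod_(a <- r) (z - a)^-1)).
  by move=> z _; rewrite big_cons.
apply: approxM => //.
  by apply: approx_inv_outer => //; apply: oX; apply: rX; rewrite mem_head.
by apply: IH => b br; apply: rX; rewrite in_cons br orbT.
Qed.

End polynomial_approximation.

(** * Runge's theorem *)

Section grid.
Variable R : realType.
Local Notation C := R[i].

Lemma abel_sum (A : comPzRingType) J (chi H : nat -> A) : chi 0%N = 0 -> chi J = 0 ->
  \sum_(k < J) chi k * (H k - H k.+1) = \sum_(k < J) (chi k.+1 - chi k) * H k.+1.
Proof.
move=> c0 cJ; apply/eqP; rewrite -subr_eq0 -sumrB.
rewrite (eq_bigr (fun k : 'I_J => - (chi k.+1 * H k.+1 - chi k * H k))); last first.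
  by move=> k _; ring.
rewrite sumrN -(big_mkord predT (fun k => chi k.+1 * H k.+1 - chi k * H k)).
by rewrite telescope_sumr// c0 cJ !mul0r subrr oppr0.
Qed.

(* Abel summation: edges shared by two squares with the same [chi] cancel. *)
Lemma grid_boundary (A : comPzRingType) J (chi H V : nat -> nat -> A) :
  (forall i, chi 0%N i = 0) -> (forall i, chi J i = 0) ->
  (forall i, chi i 0%N = 0) -> (forall i, chi i J = 0) ->
  \sum_(i < J) \sum_(k < J) chi i k * (H i k + V i.+1 k - H i k.+1 - V i k) =
  \sum_(i < J) \sum_(k < J) ((chi i k.+1 - chi i k) * H i k.+1 +
                             (chi i k - chi i.+1 k) * V i.+1 k).
Proof.
move=> c1 c2 c3 c4.
have hH : \sum_(i < J) \sum_(k < J) chi i k * (H i k - H i k.+1) =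
    \sum_(i < J) \sum_(k < J) (chi i k.+1 - chi i k) * H i k.+1.
  by apply: eq_bigr => i _; rewrite (abel_sum (chi := chi i)).
have hV : \sum_(i < J) \sum_(k < J) chi i k * (V i k - V i.+1 k) =
    \sum_(i < J) \sum_(k < J) (chi i.+1 k - chi i k) * V i.+1 k.
  rewrite exchange_big /= [RHS]exchange_big /=; apply: eq_bigr => k _.
  by rewrite (abel_sum (chi := chi^~ k) (fun i => V i k)).
transitivity (\sum_(i < J) \sum_(k < J) chi i k * (H i k - H i k.+1) -
    \sum_(i < J) \sum_(k < J) chi i k * (V i k - V i.+1 k)).
  rewrite -sumrB; apply: eq_bigr => i _; rewrite -sumrB; apply: eq_bigr => k _; ring.
rewrite hH hV -sumrB; apply: eq_bigr => i _; rewrite -sumrB; apply: eq_bigr => k _; ring.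
Qed.
End grid.

Section runge.
Variable R : realType.
Local Notation C := R[i].

Lemma approx_mid (X : set C) (u : C -> C) (P : set C) n a b :
  bounded_on X id -> (forall z, ~ X z -> outer X z) ->
  midconvex P -> (forall w, P w -> ~ X w) -> P a -> P b ->
  approximable X (fun z => mid n (fun w => (w - z)^-1 * u w) a b).
Proof.
move=> bX oX cP PX; elim: n a b => [|n IH] a b Pa Pb /=; last first.
  by apply: approxD; apply: IH => //; exact: cP.
apply: approxM => //; last exact: approx_cst.
apply: approxM => //; last exact: approx_cst.
apply: (@approx_ext _ _ (fun z => - 1 * (z - (a + b) / 2%:R)^-1)).
  by move=> z _; rewrite mulN1r -invrN opprB.
apply: approxM => //; first exact: approx_cst.
by apply: approx_inv_outer => //; apply: oX; apply: PX; exact: cP.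
Qed.

(** An edge with coefficient 0 has been cancelled and may cross [X], so nothing is asked of it. *)
Definition edge_away (X : set C) (h M : R) (u : C -> C) (coef : C) (P : set C) :=
  coef != 0 -> forall w, P w -> nrm (u w) <= M /\ forall x, X x -> h < nrm (w - x).

Definition good_edge (X : set C) (h M : R) (u : C -> C) (coef a b : C) :=
  [/\ nrm coef <= 1, nrm (b - a) = h &
    exists2 P, [/\ midconvex P, P a & P b] & edge_away X h M u coef P].

Lemma edge_approx X (h M : R) u coef a b n : 0 < h -> bounded_on X id ->
  (forall z, ~ X z -> outer X z) -> good_edge X h M u coef a b ->
  approximable X (fun z => coef * mid n (fun w => (w - z)^-1 * u w) a b).
Proof.
move=> h0 bX oX [coef1 lab [P [cP Pa Pb] PX]].
have [->|c0] := eqVneq coef 0.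
  by apply: approx_ext (approx_cst X 0) => z _; rewrite mul0r.
apply: approxM => //; first exact: approx_cst.
by apply: (@approx_mid X u P) => // w /(PX c0)[_ h1] /h1; rewrite subrr nrm0 => /(lt_trans h0); rewrite ltxx.
Qed.

Lemma edge_bound X (h M : R) u coef a b n z : 0 < h ->
  good_edge X h M u coef a b -> X z -> nrm (coef * mid n (fun w => (w - z)^-1 * u w) a b) <= `|M|.
Proof.
move=> h0 [coef1 lab [P [cP Pa Pb] PX]] Xz; have [->|c0] := eqVneq coef 0; first by rewrite mul0r nrm0.
rewrite nrmM -[X in _ <= X]mul1r; apply: ler_pM; rewrite ?nrm_ge0//.
have -> : `|M| = h^-1 * `|M| * nrm (b - a) by rewrite lab; field; rewrite gt_eqF.
apply: (mid_bound n cP Pa Pb) => w /(PX c0)[uM /(_ z Xz) hw].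
rewrite nrmM nrmV ler_pM ?invr_ge0 ?nrm_ge0//; last first.
  exact: le_trans uM (ler_norm _).
by rewrite lef_pV2 ?posrE//; lra.
Qed.

(** The Lipschitz constant does not depend on the level [n]. This equicontinuity later turns
    convergence at each point of [X] into uniform convergence. *)
Lemma edge_lipschitz X (h M : R) u coef a b n z z' : 0 < h ->
  good_edge X h M u coef a b -> X z -> X z' ->
  nrm (coef * mid n (fun w => (w - z)^-1 * u w) a b -
       coef * mid n (fun w => (w - z')^-1 * u w) a b) <= `|M| / h * nrm (z - z').
Proof.
move=> h0 [coef1 lab [P [cP Pa Pb] PX]] Xz Xz'; have [->|c0] := eqVneq coef 0.
  by rewrite !mul0r subrr nrm0 !mulr_ge0 ?invr_ge0 ?nrm_ge0// ltW.
rewrite -mulrBr nrmM -[X in _ <= X]mul1r; apply: ler_pM; rewrite ?nrm_ge0//.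
have -> : mid n (fun w => (w - z)^-1 * u w) a b - mid n (fun w => (w - z')^-1 * u w) a b =
  mid n (fun w => - 1 * ((w - z')^-1 * u w) + (w - z)^-1 * u w) a b.
  by rewrite mid_lin; ring.
have -> : `|M| / h * nrm (z - z') = (h * h)^-1 * nrm (z - z') * `|M| * nrm (b - a).
  by rewrite lab; field; rewrite gt_eqF.
apply: (mid_bound n cP Pa Pb) => w /(PX c0)[uM hw].
have h1 := hw z Xz; have h2 := hw z' Xz'.
have w1 : w - z != 0 by rewrite -nrm_gt0; lra.
have w2 : w - z' != 0 by rewrite -nrm_gt0; lra.
have -> : - 1 * ((w - z')^-1 * u w) + (w - z)^-1 * u w =
  ((w - z) * (w - z'))^-1 * (z - z') * u w by field; rewrite w1 w2.
rewrite !nrmM nrmV nrmM; apply: ler_pM; rewrite ?mulr_ge0 ?invr_ge0 ?mulr_ge0 ?nrm_ge0//.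
  rewrite ler_wpM2r ?nrm_ge0// lef_pV2 ?posrE ?mulr_gt0//; [|lra|lra].
  by apply: ler_pM; lra.
exact: le_trans uM (ler_norm _).
Qed.

Definition node (o : C) (h : R) (i k : nat) : C :=
  o + (i%:R * h)%:C + 'i * (k%:R * h)%:C.

Lemma nodeSl o h i k : node o h i.+1 k = node o h i k + h%:C.
Proof. by rewrite /node -natr1 mulrDl mul1r rmorphD /=; ring. Qed.
Lemma nodeSr o h i k : node o h i k.+1 = node o h i k + 'i * h%:C.
Proof. by rewrite /node -natr1 mulrDl mul1r rmorphD /=; ring. Qed.
Lemma Re_node o h i k : complex.Re (node o h i k) = complex.Re o + i%:R * h.
Proof. by rewrite /node !ReD ReiM /= addr0. Qed.
Lemma Im_node o h i k : complex.Im (node o h i k) = complex.Im o + k%:R * h.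
Proof. by rewrite /node !ImD ImiM /= addr0. Qed.

Lemma bd_node n f o h i k : bd n f (node o h i k) h%:C =
  mid n f (node o h i k) (node o h i.+1 k) + mid n f (node o h i.+1 k) (node o h i.+1 k.+1)
  - mid n f (node o h i k.+1) (node o h i.+1 k.+1) - mid n f (node o h i k) (node o h i k.+1).
Proof.
rewrite /bd -nodeSl -!nodeSr.
by rewrite (mid_sym n f (node o h i k.+1)) (mid_sym n f (node o h i k)); ring.
Qed.

Lemma midconvexI (P Q : set C) : midconvex P -> midconvex Q -> midconvex (P `&` Q).
Proof. by move=> cP cQ x y [Px Qx] [Py Qy]; split; [exact: cP | exact: cQ]. Qed.

Lemma sum_ge (J : nat) (a : 'I_J -> R) (e m : R) (i : 'I_J) : 0 <= e ->
  (forall l, - e <= a l) -> m <= a i -> m - J%:R * e <= \sum_(l < J) a l.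
Proof.
move=> e0 ae ai; rewrite (bigD1 i)//= lerD//.
apply: (@le_trans _ _ (\sum_(l < J | l != i) - e)); last by apply: ler_sum.
rewrite sumr_const mulNrn lerN2 mulr_natl; apply: ler_wpMn2l => //.
by rewrite -[X in (_ <= X)%N]card_ord max_card.
Qed.

Lemma sum_ge_low (J : nat) (a : 'I_J -> R) (e : R) :
  (forall l, - e <= a l) -> - (J%:R * e) <= \sum_(l < J) a l.
Proof.
move=> ae; apply: (@le_trans _ _ (\sum_(l < J) - e)); last exact: ler_sum.
by rewrite sumr_const card_ord mulNrn mulr_natl.
Qed.

Lemma eventually_finite (J : nat) (P : 'I_J -> nat -> Prop) :
  (forall i, exists N, forall n, (N <= n)%N -> P i n) ->
  exists N, forall n, (N <= n)%N -> forall i, P i n.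
Proof.
move=> /choice[N NP]; exists (\max_i N i) => n Nn i; apply: NP.
exact: leq_trans (leq_bigmax i) Nn.
Qed.

Lemma nrm_sum_le (J : nat) (F : 'I_J -> C) (c : R) :
  (forall i, nrm (F i) <= c) -> nrm (\sum_(i < J) F i) <= J%:R * c.
Proof.
move=> Fc; apply: (le_trans (nrm_sum _ _ _)).
by apply: (le_trans (ler_sum _ (fun i _ => Fc i))); rewrite sumr_const card_ord mulr_natl.
Qed.

Definition chi (Q : nat -> nat -> Prop) i k : C := (`[< Q i k >])%:R.

(** The sum over the oriented boundary of the union of the squares in [Q]: an edge is weighted by
    the jump of [chi] across it. *)
Definition bsum Q o h J n (f : C -> C) : C := \sum_(i < J) \sum_(k < J)
  ((chi Q i k.+1 - chi Q i k) * mid n f (node o h i k.+1) (node o h i.+1 k.+1) +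
   (chi Q i k - chi Q i.+1 k) * mid n f (node o h i.+1 k) (node o h i.+1 k.+1)).

Lemma bsum_lin Q o h J n f g a :
  bsum Q o h J n (fun w => a * f w + g w) = a * bsum Q o h J n f + bsum Q o h J n g.
Proof.
rewrite /bsum mulr_sumr -big_split; apply: eq_bigr => i _ /=.
rewrite mulr_sumr -big_split; apply: eq_bigr => k _ /=.
by rewrite !mid_lin; ring.
Qed.

Lemma chiB Q i k i' k' : nrm (chi Q i k - chi Q i' k') <= 1 /\
  (chi Q i k - chi Q i' k' != 0 -> (Q i k /\ ~ Q i' k') \/ (~ Q i k /\ Q i' k')).
Proof.
rewrite /chi; case: asboolP => q1; case: asboolP => q2;
  rewrite ?subrr ?subr0 ?sub0r ?nrmN ?nrm0 ?nrm1 ?eqxx; split => //; by [left|right].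
Qed.

Section grid_of_squares.
Variables (X : set C) (o : C) (h : R) (J : nat).

(** The squares within [h] of [X], not only those that meet it: an edge shared with a square that is
    not touching then stays farther than [h] from [X]. *)
Definition touching (i k : nat) : Prop :=
  exists2 x, X x & exists2 w, sq (node o h i k) h w & nrm (w - x) <= h.

(** A surviving edge lies in two adjacent squares of which exactly one is touching: that one bounds
    [u], the other keeps the edge away from [X]. The midconvex set required around the edge is the
    intersection of the two squares. *)
Lemma good_edges (M : R) (u : C -> C) i k : 0 < h ->
  (forall i k w, touching i k -> sq (node o h i k) h w -> nrm (u w) <= M) ->
  good_edge X h M u (chi touching i k.+1 - chi touching i k)
    (node o h i k.+1) (node o h i.+1 k.+1) /\
  good_edge X h M u (chi touching i k - chi touching i.+1 k)
    (node o h i.+1 k) (node o h i.+1 k.+1).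
Proof.
move=> h0 uM.
have q i' k' : [/\ sq (node o h i' k') h (node o h i' k'), sq (node o h i' k') h (node o h i'.+1 k'),
    sq (node o h i' k') h (node o h i'.+1 k'.+1) & sq (node o h i' k') h (node o h i' k'.+1)].
  by have := sq_corners (node o h i' k') (ltW h0); rewrite -nodeSl -!nodeSr.
have aw i1 k1 i2 k2 : edge_away X h M u (chi touching i1 k1 - chi touching i2 k2)
    (sq (node o h i1 k1) h `&` sq (node o h i2 k2) h).
  move=> c0 w [w1 w2]; case: ((chiB touching i1 k1 i2 k2).2 c0) => -[t nt].
    split; first exact: uM w1.
    move=> x Xx; rewrite ltNge; apply/negP => wx; apply: nt.
    by exists x => //; exists w.
  split; first exact: uM w2.
  move=> x Xx; rewrite ltNge; apply/negP => wx; apply: t.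
  by exists x => //; exists w.
split; split; try exact: (chiB _ _ _ _ _).1.
- by rewrite nodeSl addrAC subrr add0r nrm_real ger0_norm// ltW.
- exists (sq (node o h i k.+1) h `&` sq (node o h i k) h); last exact: aw.
  split; first by apply: midconvexI; exact: sq_midconvex.
    by split; [have [] := q i k.+1 | have [] := q i k].
  by split; [have [] := q i k.+1 | have [] := q i k].
- by rewrite nodeSr addrAC subrr add0r nrmM nrm_i mul1r nrm_real ger0_norm// ltW.
- exists (sq (node o h i k) h `&` sq (node o h i.+1 k) h); last exact: aw.
  split; first by apply: midconvexI; exact: sq_midconvex.
    by split; [have [] := q i k | have [] := q i.+1 k].
  by split; [have [] := q i k | have [] := q i.+1 k].
Qed.

Lemma bsumE n f :
  (forall i, ~ touching 0 i) -> (forall i, ~ touching J i) ->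
  (forall i, ~ touching i 0) -> (forall i, ~ touching i J) ->
  bsum touching o h J n f =
  \sum_(i < J) \sum_(k < J) chi touching i k * bd n f (node o h i k) h%:C.
Proof.
move=> t1 t2 t3 t4; under [RHS]eq_bigr => i _ do under eq_bigr => k _ do rewrite bd_node.
rewrite (@grid_boundary _ J (chi touching) (fun i k => mid n f (node o h i k) (node o h i.+1 k))
  (fun i k => mid n f (node o h i k) (node o h i k.+1)))//.
all: by move=> i; rewrite /chi asboolF.
Qed.

Lemma bsum_approx (M : R) (u : C -> C) n : 0 < h -> bounded_on X id ->
  (forall z, ~ X z -> outer X z) ->
  (forall i k w, touching i k -> sq (node o h i k) h w -> nrm (u w) <= M) ->
  approximable X (fun z => bsum touching o h J n (fun w => (w - z)^-1 * u w)).
Proof.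
move=> h0 bX oX uM; apply: approx_sum => i; apply: approx_sum => k.
have [e1 e2] := @good_edges M u i k h0 uM.
by apply: approxD; apply: edge_approx; eauto.
Qed.

Lemma bsum_bound (M : R) (u : C -> C) n z : 0 < h -> 0 <= M ->
  (forall i k w, touching i k -> sq (node o h i k) h w -> nrm (u w) <= M) -> X z ->
  nrm (bsum touching o h J n (fun w => (w - z)^-1 * u w)) <= J%:R * (J%:R * (M + M)).
Proof.
move=> h0 M0 uM Xz; apply: nrm_sum_le => i; apply: nrm_sum_le => k.
have [e1 e2] := @good_edges M u i k h0 uM.
apply: (le_trans (nrmD _ _)); rewrite -{1 2}(ger0_norm M0).
by apply: lerD; apply: edge_bound; eauto.
Qed.

Lemma bsum_lipschitz (M : R) (u : C -> C) n z z' : 0 < h -> 0 <= M ->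
  (forall i k w, touching i k -> sq (node o h i k) h w -> nrm (u w) <= M) -> X z -> X z' ->
  nrm (bsum touching o h J n (fun w => (w - z)^-1 * u w) -
       bsum touching o h J n (fun w => (w - z')^-1 * u w)) <=
  J%:R * (J%:R * ((M + M) / h)) * nrm (z - z').
Proof.
move=> h0 M0 uM Xz Xz'; rewrite -!mulrA -sumrB; apply: nrm_sum_le => i.
rewrite -sumrB; apply: nrm_sum_le => k.
have [e1 e2] := @good_edges M u i k h0 uM.
have L1 := edge_lipschitz n h0 e1 Xz Xz'; have L2 := edge_lipschitz n h0 e2 Xz Xz'.
rewrite opprD addrACA; apply: (le_trans (nrmD _ _)).
apply: (le_trans (lerD L1 L2)); rewrite (ger0_norm M0) -mulrDl; lra.
Qed.
End grid_of_squares.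

(** The one parameter [r] is both the radius and, through [r^-1], the bound, so that
    [compact_uniform_nrm] applies. *)
Lemma bound_near (X : set C) (g : C -> C) (eta : R) : compact X -> 0 < eta ->
  (forall x w, X x -> nrm (w - x) < eta -> cdiff g w) ->
  exists2 r : R, 0 < r & r <= eta /\
    forall x w, X x -> nrm (w - x) < r -> nrm (g w) <= r^-1.
Proof.
move=> cX eta0 gd.
case: (@compact_uniform_nrm R X (fun r x => r <= eta /\
    forall w, nrm (w - x) < r -> nrm (g w) <= r^-1) cX) => [e e' x e0 ee [e1 e2]|x Xx|r r0 rP].
- split; first exact: le_trans e1.
  move=> w we; apply: (le_trans (e2 w (lt_le_trans we ee))).
  by rewrite lef_pV2 ?posrE//; lra.
- have [K [K0 [d d0 dP]]] : exists K : R, 0 <= K /\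
    exists2 d, 0 < d & forall w, nrm (w - x) < d -> nrm (g w - g x) <= K * nrm (w - x).
    by apply: cdiff_lip; apply: (gd x) => //; rewrite subrr nrm0.
  have Kd := mulr_ge0 K0 (ltW d0); have gx := nrm_ge0 (g x).
  pose b := nrm (g x) + K * d + 1; have b0 : 0 < b by rewrite /b; lra.
  exists (Num.min (d / 2) (Num.min eta b^-1)).
    by rewrite !lt_min eta0 invr_gt0 b0 !andbT; lra.
  move=> y yx; split; first by rewrite !ge_min lexx orbT.
  move=> w wy; set r := Num.min _ _ in yx wy *.
  have r0 : 0 < r by apply: le_lt_trans yx; exact: nrm_ge0.
  have rd : r <= d / 2 by rewrite ge_min lexx.
  have rb : r <= b^-1 by rewrite !ge_min lexx !orbT.
  apply: (@le_trans _ _ b); last by rewrite -[b]invrK lef_pV2 ?posrE ?invr_gt0.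
  have wx : nrm (w - x) < d by have := nrm_dist y w x; lra.
  have := nrmD (g w - g x) (g x); rewrite subrK; have := dP w wx.
  by have := ler_wpM2l K0 (ltW wx); rewrite /b; lra.
- exists (Num.min r eta); first by rewrite lt_min r0.
  split=> [|x w Xx]; first by rewrite ge_min lexx orbT.
  rewrite lt_min => /andP[wr _]; apply: (le_trans ((rP x Xx).2 w wr)).
  by rewrite lef_pV2 ?posrE ?lt_min ?r0// ge_min lexx.
Qed.

(** Let [G] and [D] be the kernel sums of [g] and of 1 over the boundary of the touching squares.
    Then [G - g * D] is the sum of the difference quotients of [g], which tends to 0 by Goursat,
    while [D] stays away from 0. So [G / D] tends to [g], and both [G] and the inverse of [D] are
    approximable because the edges avoid [X]. *)
Theorem runge (X : set C) (g : C -> C) : compact X -> (forall z, ~ X z -> outer X z) ->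
  (exists2 eta : R, 0 < eta & forall x w, X x -> nrm (w - x) < eta -> cdiff g w) ->
  approximable X g.
Proof.
move=> cX oX [eta eta0 gd].
have [B B0 XB] := compact_nrm_bounded cX.
have bX : bounded_on X id by exists B.
have [r r0 [r_eta gr]] := bound_near cX eta0 gd.
(* The points of a touching square are within [3 * h] of [X], hence within [r]. *)
pose h := r / 8; have h0 : 0 < h by rewrite /h; lra.
(* The grid covers the square of half-side [B + 4 * h]; the margin keeps the squares of index 0 and
   of index [J], just outside the range, from touching [X]. *)
pose J := (Num.truncn (2 * (B + 4 * h) / h)).+1.
have Jh : 2 * (B + 4 * h) <= J%:R * h.
  by rewrite -ler_pdivrMr//; apply/ltW; exact: truncnS_gt.
pose o : C := Complex (- (B + 4 * h)) (- (B + 4 * h)).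
pose Q := touching X o h; pose M := r^-1 + 1.
have ri : 0 < r^-1 by rewrite invr_gt0.
have M0 : 0 <= M by rewrite /M; lra.
have XRe x : X x -> - B <= complex.Re x <= B.
  by move=> /XB xB; rewrite -ler_norml; exact: le_trans (nrm_Re _) xB.
have XIm x : X x -> - B <= complex.Im x <= B.
  by move=> /XB xB; rewrite -ler_norml; exact: le_trans (nrm_Im _) xB.
have reim (w x : C) : nrm (w - x) <= h ->
    - h <= complex.Re w - complex.Re x <= h /\ - h <= complex.Im w - complex.Im x <= h.
  move=> wx; rewrite -!ler_norml -ReN -ReD -ImN -ImD.
  by split; apply: le_trans wx; [exact: nrm_Re | exact: nrm_Im].
have border i : [/\ ~ Q 0%N i, ~ Q J i, ~ Q i 0%N & ~ Q i J].
  split=> -[x Xx [w [/andP[w1 w2] /andP[w3 w4]] /reim[/andP[d1 d2] /andP[d3 d4]]]];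
    move: w1 w2 w3 w4; rewrite !Re_node !Im_node /= ?mul0r ?addr0;
    have /andP[x1 x2] := XRe x Xx; have /andP[x3 x4] := XIm x Xx; lra.
have bE n f : bsum Q o h J n f =
    \sum_(i < J) \sum_(k < J) chi Q i k * bd n f (node o h i k) h%:C.
  by apply: bsumE => i; have [] := border i.
have locate (t : R) : - B <= t <= B ->
    exists i : 'I_J, - (B + 4 * h) + i%:R * h <= t <= - (B + 4 * h) + i%:R * h + h.
  move=> /andP[t1 t2]; pose i := Num.truncn ((t + (B + 4 * h)) / h).
  have ti : i%:R <= (t + (B + 4 * h)) / h < i.+1%:R.
    by apply: truncn_itv; rewrite divr_ge0 ?(ltW h0)//; lra.
  move: ti; rewrite ler_pdivlMr// ltr_pdivrMr// -natr1 mulrDl mul1r => /andP[i1 i2].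
  have iJ : (i < J)%N.
    rewrite -(ltr_nat R) -(ltr_pM2r h0); apply: (le_lt_trans i1).
    by apply: lt_le_trans Jh; lra.
  by exists (Ordinal iJ) => /=; apply/andP; split; lra.
have pos x : X x -> exists i k : 'I_J, sq (node o h i k) h x.
  move=> Xx; have [i iP] := locate _ (XRe x Xx); have [k kP] := locate _ (XIm x Xx).
  by exists i, k; split; rewrite ?Re_node ?Im_node.
have near i k w : Q i k -> sq (node o h i k) h w -> exists2 x, X x & nrm (w - x) < r.
  move=> [x Xx [v vQ vx]] wQ; exists x => //.
  by have := nrm_dist v w x; have := sq_dist wQ vQ; rewrite /h in vx *; lra.
have Qg i k w : Q i k -> sq (node o h i k) h w -> cdiff g w.
  move=> q /(near _ _ _ q)[x Xx wx]; apply: (gd x) => //; lra.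
have QM i k w : Q i k -> sq (node o h i k) h w -> nrm (g w) <= M.
  move=> q /(near _ _ _ q)[x Xx wx]; have := gr x w Xx wx; rewrite /M; lra.
have Q1 i k w : Q i k -> sq (node o h i k) h w -> nrm ((fun _ : C => 1) w) <= M.
  by move=> _ _; rewrite nrm1 /M; lra.
have touch x i k : X x -> sq (node o h i k) h x -> Q i k.
  by move=> Xx xQ; exists x => //; exists x => //; rewrite subrr nrm0 ltW.
pose G n z := bsum Q o h J n (fun w => (w - z)^-1 * g w).
pose D n z := bsum Q o h J n (fun w => (w - z)^-1 * 1).
pose E n z := G n z - g z * D n z.
have DE n z : D n z = bsum Q o h J n (fun w => (w - z)^-1).
  by congr bsum; apply/funext => w; rewrite mulr1.
have EE n z : E n z = bsum Q o h J n (fun w => (w - z)^-1 * (g w - g z)).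
  rewrite /E /G /D addrC -mulNr -bsum_lin; congr bsum; apply/funext => w; ring.
have JJ0 : 0 < (J%:R * (J%:R : R)) by rewrite mulr_gt0// ltr0n.
have pointwise x (e : R) : X x -> 0 < e -> exists N, forall n, (N <= n)%N ->
    nrm (E n x) <= e /\ 2^-1 <= complex.Im (D n x).
  move=> Xx e0; pose e' := Num.min e 4^-1 / (J%:R * J%:R).
  have e'0 : 0 < e' by rewrite divr_gt0// lt_min e0; lra.
  have e'e : J%:R * (J%:R * e') <= e.
    by rewrite /e' mulrA mulrC divfK ?gt_eqF// ge_min lexx.
  have e'2 : J%:R * (J%:R * e') <= 4^-1.
    by rewrite /e' mulrA mulrC divfK ?gt_eqF// ge_min lexx orbT.
  have ev : forall i : 'I_J, exists N, forall n, (N <= n)%N -> forall k : 'I_J,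
      Q i k -> nrm (bd n (fun w => (w - x)^-1 * (g w - g x)) (node o h i k) h%:C) <= e' /\
        - e' <= complex.Im (bd n (fun w => (w - x)^-1) (node o h i k) h%:C).
    move=> i; apply: eventually_finite => k.
    have [q|nq] := pselect (Q i k); last by exists 0%N.
    have gx : cdiff g x by apply: (gd x) => //; rewrite subrr nrm0.
    have [N1 h1] := goursat_quotient h0 (fun w => Qg i k w q) gx e'0.
    have [N2 h2] : exists N, forall n, (N <= n)%N ->
        - e' <= complex.Im (bd n (fun w => (w - x)^-1) (node o h i k) h%:C).
      have [xQ|xQ] := pselect (sq (node o h i k) h x).
        by exists 0%N => n _; have := bd_inv_Im n h0 xQ; lra.
      have [N2 h2] := goursat_inv h0 xQ e'0; exists N2 => n /h2 {}h2.
      by have := le_trans (nrm_Im _) h2; rewrite ler_norml => /andP[].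
    exists (maxn N1 N2) => n; rewrite geq_max => /andP[n1 n2] _; split; [exact: h1|exact: h2].
  have [N NP] := eventually_finite ev; exists N => n /NP {}NP; split.
    apply: le_trans e'e; rewrite EE bE; apply: nrm_sum_le => i; apply: nrm_sum_le => k.
    rewrite /chi; case: asboolP => q; last by rewrite mul0r nrm0 ltW.
    by rewrite mul1r; have [] := NP i k q.
  have [i0 [k0 x0]] := pos x Xx.
  have Imsum (I : finType) (F : I -> C) : complex.Im (\sum_i F i) = \sum_i complex.Im (F i).
    exact: (big_morph (@complex.Im R) (@ImD R) (erefl _)).
  have low (i k : 'I_J) :
      - e' <= complex.Im (chi Q i k * bd n (fun w => (w - x)^-1) (node o h i k) h%:C).
    rewrite /chi; case: asboolP => q; last by rewrite mul0r /=; lra.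
    by rewrite mul1r; have [] := NP i k q.
  (* A square containing [x] contributes at least 1 and every other one at least [- e']; both error
     terms are at most [4^-1]. *)
  rewrite DE bE Imsum; apply: (@le_trans _ _ (1 - J%:R * e' - J%:R * (J%:R * e'))).
    have : J%:R * e' <= J%:R * (J%:R * e').
      by rewrite ler_wpM2l// ler_peMl ?(ltW e'0)// ler1n.
    by move: e'2; lra.
  apply: (sum_ge (i := i0)) => [|i|].
  - by rewrite mulr_ge0 ?(ltW e'0).
  - by rewrite Imsum; apply: sum_ge_low => k; exact: low.
  - rewrite Imsum; apply: (sum_ge (i := k0)) => //; first exact: ltW.
    rewrite /chi asboolT ?mul1r; first exact: bd_inv_Im.
    exact: touch x0.
have L : exists2 L : R, 0 < L & forall n x y, X x -> X y ->
    [/\ nrm (G n x - G n y) <= L * nrm (x - y), nrm (D n x - D n y) <= L * nrm (x - y) &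
      nrm (D n x) <= L].
  pose L := J%:R * (J%:R * ((M + M) / h)) + J%:R * (J%:R * (M + M)) + 1.
  have l1 : 0 <= J%:R * (J%:R * ((M + M) / h)).
    by rewrite !mulr_ge0 ?invr_ge0 ?(ltW h0)//; lra.
  have l2 : 0 <= J%:R * (J%:R * (M + M)) by rewrite !mulr_ge0//; lra.
  exists L => [|n x y Xx Xy]; first by rewrite /L; lra.
  have xy0 := nrm_ge0 (x - y).
  split.
  - apply: (le_trans (bsum_lipschitz _ _ h0 M0 QM Xx Xy)).
    by rewrite ler_wpM2r// /L; lra.
  - apply: (le_trans (bsum_lipschitz _ _ h0 M0 Q1 Xx Xy)).
    by rewrite ler_wpM2r// /L; lra.
  - apply: (le_trans (bsum_bound _ _ h0 M0 Q1 Xx)).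
    by rewrite /L; lra.
have [L0 L00 LP] := L.
(* The threshold on [n] is encoded by a real [s] as [s^-1 <= n], so that compactness yields one
   threshold for all of [X]. *)
have uniform (e : R) : 0 < e -> exists2 s : R, 0 < s & forall x, X x ->
    forall n : nat, s^-1 <= n%:R -> nrm (E n x) <= e /\ 4^-1 <= nrm (D n x).
  move=> e0; apply: (@compact_uniform R C X (fun s x => forall n : nat,
    s^-1 <= n%:R -> nrm (E n x) <= e /\ 4^-1 <= nrm (D n x)) cX) => [s s' x s'0 ss xP n ns|x Xx].
    by apply: xP; apply: le_trans ns; rewrite lef_pV2 ?posrE//; lra.
  have e2 : 0 < e / 2 by lra.
  have [N NP] := pointwise x _ Xx e2.
  have gx : cdiff g x by apply: (gd x) => //; rewrite subrr nrm0.
  have [K [K0 [d d0 dP]]] := cdiff_lip gx.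
  have gx0 := nrm_ge0 (g x).
  pose T := L0 + (nrm (g x) + K * L0) + L0 * L0 + K * L0 + L0 * K + 1.
  have KL := mulr_ge0 K0 (ltW L00); have LL := mulr_gt0 L00 L00.
  have gL := mulr_ge0 gx0 (ltW L00).
  pose W := L0 + nrm (g x) * L0 + K * L0 + 1.
  have W0 : 0 < W by rewrite /W; lra.
  pose s := Num.min (Num.min d (4^-1 / W)) (e / 2 / W).
  have s0 : 0 < s by rewrite !lt_min d0 !divr_gt0//; lra.
  exists N.+1%:R^-1; first by rewrite invr_gt0 ltr0n.
  apply/nbhs_nrmP; exists s => // y; rewrite !lt_min => /andP[/andP[yd y4] ye] Xy n.
  rewrite invrK ler_nat => /ltnW nN; have [E1 D1] := NP n nN.
  move: y4 ye; rewrite !ltr_pdivlMr//; set t := nrm (y - x) => y4 ye.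
  have t0 : 0 <= t by exact: nrm_ge0.
  have [G2 D2 _] := LP n y x Xy Xx; have [_ _ D3] := LP n y y Xy Xy.
  have W1 : L0 * t + nrm (g x) * L0 * t + K * L0 * t + t = t * W by rewrite /W; ring.
  have LT := mulr_ge0 (ltW L00) t0; have gLT := mulr_ge0 gL t0; have KLT := mulr_ge0 KL t0.
  split; last first.
    have D4 : 2^-1 <= nrm (D n x).
      by apply: (le_trans D1); exact: le_trans (ler_norm _) (nrm_Im _).
    by have := nrm_dist (D n y) (D n x) 0; rewrite !subr0 nrmBC -/t in D2 *; lra.
  have -> : E n y = E n x + (G n y - G n x) - g x * (D n y - D n x) - (g y - g x) * D n y.
    by rewrite /E; ring.
  have := nrmB (E n x + (G n y - G n x) - g x * (D n y - D n x)) ((g y - g x) * D n y).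
  have := nrmB (E n x + (G n y - G n x)) (g x * (D n y - D n x)).
  have := nrmD (E n x) (G n y - G n x); rewrite !nrmM.
  have := ler_wpM2l gx0 D2.
  have := ler_pM (nrm_ge0 _) (nrm_ge0 _) (dP y yd) D3; rewrite -/t.
  by move: G2; rewrite -/t; lra.
apply: approx_lim => e e0; have e4 : 0 < e / 4 by lra.
have [s s0 sP] := uniform _ e4.
pose n := (Num.truncn s^-1).+1.
have ns : s^-1 <= n%:R by apply/ltW; exact: truncnS_gt.
exists (fun z => G n z * (D n z)^-1).
  apply: approxM => //; first exact: (bsum_approx _ _ h0 bX oX QM).
  apply: (approx_inv (m := 4^-1)) => //; first exact: (bsum_approx _ _ h0 bX oX Q1).
  by move=> z Xz; have [] := sP z Xz n ns.
move=> z Xz; have [E1 D1] := sP z Xz n ns.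
have D0 : D n z != 0 by rewrite -nrm_gt0; apply: lt_le_trans D1; lra.
have -> : g z - G n z / D n z = - (E n z / D n z) by rewrite /E; field.
have Dp : 0 < nrm (D n z) by rewrite nrm_gt0.
rewrite nrmN nrm_div ler_pdivrMr//; apply: (le_trans E1).
by have := ler_wpM2l (ltW e0) D1; lra.
Qed.
End runge.

(** * Winding numbers *)

Section quadrants.
Variable R : realType.
Local Notation C := R[i].

Definition opp_quad (p q : bool * bool) := (p.1 != q.1) && (p.2 != q.2).

(* Quarter turns from the quadrant of sign pattern [p] to that of [q], for
   quadrants that are equal or adjacent. *)
Definition turn (p q : bool * bool) : int :=
  if p.1 == q.1 then
    if p.2 == q.2 then 0 else if p.1 == p.2 then -1 else 1
  else if p.2 == q.2 then if p.1 == p.2 then 1 else -1 else 0.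

Lemma turn_add p q r : ~~ opp_quad p q -> ~~ opp_quad q r -> ~~ opp_quad p r ->
  turn p q + turn q r = turn p r.
Proof. by case: p => [[] []]; case: q => [[] []]; case: r => [[] []]. Qed.

(** The half-open quadrants partition the plane, so paths need not cross the axes transversally. *)
Definition quad (u : C) := (0 < complex.Re u, 0 < complex.Im u).
Definition qturn (u v : C) := turn (quad u) (quad v).
Definition nonopp (u v : C) := ~~ opp_quad (quad u) (quad v).

Lemma qturn_add u v w : nonopp u v -> nonopp v w -> nonopp u w ->
  qturn u v + qturn v w = qturn u w.
Proof. exact: turn_add. Qed.

(** Between opposite quadrants both coordinates change sign, so each coordinate of [u - v] is at
    least as large in absolute value as that of [u]. *)
Lemma nonopp_close u v : nrm (u - v) < nrm u -> nonopp u v.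
Proof.
apply: contraTT; rewrite negbK /opp_quad /quad /= -leNgt => /andP[h1 h2].
rewrite -(@ler_pXn2r _ 2) ?nnegrE ?nrm_ge0 // !nrm_sqr !(ReD, ImD, ReN, ImN).
have sq_le (x y : R) : (0 < x) != (0 < y) -> x ^+ 2 <= (x - y) ^+ 2.
  case: (ltP 0 x) => x0; case: (ltP 0 y) => y0 // _.
    by have := mulr_ge0 (ltW x0) (_ : 0 <= - y); have := sqr_ge0 y; nra.
  by have := sqr_ge0 y; nra.
by apply: lerD; exact: sq_le.
Qed.

(* A continuous branch of the argument of [z - a] near [X], counted in quarter
   turns. *)
Definition has_arg (X : set C) (a : C) := exists F : C -> int,
  exists2 delta : R, 0 < delta & forall z z', X z -> X z' -> nrm (z - z') < delta ->
    F z' - F z = qturn (z - a) (z' - a).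

Lemma subBB (z z' a : C) : z - a - (z' - a) = z - z'. Proof. by ring. Qed.

Lemma has_arg_far X a (k : R) : 0 < k -> (forall z, X z -> nrm z + k <= nrm a) ->
  has_arg X a.
Proof.
move=> k0 h; exists (fun z => qturn (- a) (z - a)); exists k => // z z' Xz Xz' zz.
have Ez w : - a - (w - a) = - w by ring.
rewrite -(@qturn_add (- a) (z - a) (z' - a)).
- by rewrite addrAC subrr add0r.
- by apply: nonopp_close; rewrite Ez !nrmN; have := h _ Xz; lra.
- apply: nonopp_close; rewrite subBB.
  have := nrmD (a - z) z; rewrite subrK nrmBC; have := h _ Xz; lra.
- by apply: nonopp_close; rewrite Ez !nrmN; have := h _ Xz'; lra.
Qed.

(** The branch is corrected by the turn from [z - b] to [z - c]. The increments agree because [t1]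
    and [t2] both compute the turn from [z - b] to [z' - c], once through [z' - b] and once through
    [z - c]. *)
Lemma has_arg_step X b c (k : R) : 0 < k -> has_arg X b ->
  (forall z, X z -> nrm (b - c) + k <= nrm (z - b)) -> has_arg X c.
Proof.
move=> k0 [F [d d0 FP]] h.
exists (fun z => F z + qturn (z - b) (z - c)); exists (Num.min d k); first by rewrite lt_min d0.
move=> z z' Xz Xz'; rewrite lt_min => /andP[zd zk].
have hz := h _ Xz; have hz' := h _ Xz'; have bc := nrm_ge0 (b - c); have zz0 := nrm_ge0 (z - z').
have E1 w : w - b - (w - c) = - (b - c) by ring.
have zc : k <= nrm (z - c).
  by have := nrmD (z - c) (- (b - c)); rewrite (_ : z - c + _ = z - b) ?nrmN; [lra | ring].
have n1 : nonopp (z - b) (z' - c).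
  apply: nonopp_close; have -> : z - b - (z' - c) = z - z' - (b - c) by ring.
  by have := nrmB (z - z') (b - c); lra.
have t1 : qturn (z - b) (z' - b) + qturn (z' - b) (z' - c) = qturn (z - b) (z' - c).
  apply: qturn_add => //; first by apply: nonopp_close; rewrite subBB; lra.
  by apply: nonopp_close; rewrite E1 nrmN; lra.
have t2 : qturn (z - b) (z - c) + qturn (z - c) (z' - c) = qturn (z - b) (z' - c).
  apply: qturn_add => //; first by apply: nonopp_close; rewrite E1 nrmN; lra.
  by apply: nonopp_close; rewrite subBB; lra.
by apply: (addrI (qturn (z - b) (z - c))); rewrite t2 -t1 -(FP _ _ Xz Xz' zd); ring.
Qed.

Lemma has_arg_outer X a : outer X a -> has_arg X a.
Proof.
elim=> {a} [a k k0 h|b c k k0 _ IH h]; first exact: has_arg_far h.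
exact: has_arg_step h.
Qed.

Lemma has_arg_union (A B : set C) a (r : R) : 0 < r ->
  (forall z z', A z -> B z' -> r <= nrm (z - z')) ->
  has_arg A a -> has_arg B a -> has_arg (A `|` B) a.
Proof.
move=> r0 AB [F [d d0 FP]] [G [e e0 GP]].
exists (fun z => if `[< A z >] then F z else G z).
exists (Num.min r (Num.min d e)); first by rewrite !lt_min r0 d0.
move=> z z' zAB zAB'; rewrite !lt_min => /and3P[zr zd ze].
case: asboolP => Az'; case: asboolP => Az; [exact: FP| | |].
- by exfalso; case: zAB => // Bz; have := AB _ _ Az' Bz; rewrite nrmBC; lra.
- by exfalso; case: zAB' => // Bz; have := AB _ _ Az Bz; lra.
- by case: zAB => // Bz; case: zAB' => // Bz'; exact: GP.
Qed.

(* Winding number obstruction: the squares of a fine grid around [a] whose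
   center is neither in X nor outer would have a boundary lying near X on which
   the total turn around [a] is both 4 and 0. *)
Theorem outer_of_has_arg (X : set C) (a : C) : compact X -> ~ X a -> has_arg X a -> outer X a.
Proof.
move=> cX Xa [F [delta delta0 FP]]; apply: contrapT => na.
have [B B0 XB] := compact_nrm_bounded cX.
have [rho rho0 Xrho] := compact_dist cX Xa.
(* Boundary nodes will lie within [4 * h] of [X]. The points of [X] chosen near adjacent nodes are
   then closer than [delta], and [a] is too far away for any turn between them to be ambiguous. *)
pose h := Num.min delta rho / 16.
have hd : 16 * h <= delta by rewrite /h mulrC divfK // ge_min lexx.
have hr : 16 * h <= rho by rewrite /h mulrC divfK // ge_min lexx orbT.
have h0 : 0 < h by rewrite divr_gt0 // lt_min delta0.
have [m mh] : exists m : nat, B + nrm a + 1 + h <= m%:R * h.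
  exists (Num.truncn ((B + nrm a + 1 + h) / h)).+1; rewrite -ler_pdivrMr//.
  by apply/ltW; exact: truncnS_gt.
pose J := (m + m).+1.
(* This makes [a] the center of the square [(m, m)]: relative to [a], node coordinates are odd
   multiples of [h / 2], never 0, and quadrants can be read off the indices. *)
pose o : C := a - Complex (m%:R * h + h / 2) (m%:R * h + h / 2).
pose ctr i k : C := node o h i k + Complex (h / 2) (h / 2).
pose Q i k := ~ X (ctr i k) /\ ~ outer X (ctr i k).
have ctr_mm : ctr m m = a.
  apply/eqP; rewrite eq_complex /ctr ReD ImD Re_node Im_node /o ReD ImD !ReN !ImN /=.
  by apply/andP; split; apply/eqP; ring.
have far b : B + 1 <= nrm b -> outer X b.
  by move=> b1; apply: (@outer_far _ X b 1) => // z /XB; lra.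
have rectr i k : complex.Re (ctr i k) = complex.Re a + (i%:R - m%:R) * h /\
   complex.Im (ctr i k) = complex.Im a + (k%:R - m%:R) * h.
  by rewrite /ctr ReD ImD Re_node Im_node /o ReD ImD !ReN !ImN /=; split; ring.
have Jm : (J%:R - m%:R) * h = m%:R * h + h.
  by rewrite /J -natr1 natrD; ring.
have aR := nrm_Re a; have aI := nrm_Im a.
have border i : [/\ ~ Q 0%N i, ~ Q J i, ~ Q i 0%N & ~ Q i J].
  split=> -[_]; apply; apply: far.
  - apply: le_trans (nrm_Re _); rewrite (rectr _ _).1 sub0r mulNr.
    by move: aR; rewrite ler_norml => /andP[? ?]; rewrite ler0_norm; lra.
  - apply: le_trans (nrm_Re _); rewrite (rectr _ _).1 Jm.
    by move: aR; rewrite ler_norml => /andP[? ?]; rewrite ger0_norm; lra.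
  - apply: le_trans (nrm_Im _); rewrite (rectr _ _).2 sub0r mulNr.
    by move: aI; rewrite ler_norml => /andP[? ?]; rewrite ler0_norm; lra.
  - apply: le_trans (nrm_Im _); rewrite (rectr _ _).2 Jm.
    by move: aI; rewrite ler_norml => /andP[? ?]; rewrite ger0_norm; lra.
pose x i k : int := (`[< Q i k >])%:R.
have xb : (forall i, x 0%N i = 0) /\ (forall i, x J i = 0) /\ (forall i, x i 0%N = 0) /\
    (forall i, x i J = 0).
  by split; [|split; [|split]] => i; have [b1 b2 b3 b4] := border i; rewrite /x asboolF.
case: xb => xb1 [xb2 [xb3 xb4]].
pose N i k := node o h i k - a.
pose H i k := qturn (N i k) (N i.+1 k); pose V i k := qturn (N i k) (N i k.+1).
have quadN i k : quad (N i k) = (m < i, m < k)%N.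
  have pos (l : nat) : (0 < (l%:R - m%:R) * h - h / 2) = (m < l)%N.
    have [ml|lm] := ltnP m l.
      have : (m%:R + 1 : R) <= l%:R by rewrite natr1 ler_nat.
      by move=> /(ler_wpM2r (ltW h0)); lra.
    have : (l%:R : R) <= m%:R by rewrite ler_nat.
    by move=> /(ler_wpM2r (ltW h0)) ?; apply/negbTE; rewrite -leNgt; lra.
  rewrite /quad /N ReD ImD Re_node Im_node /o ReD ImD !ReN !ImN /= -!pos.
  by congr (_, _); congr (0 < _); ring.
have loop i k : H i k + V i.+1 k - H i k.+1 - V i k = if (i == m) && (k == m) then 4 else 0.
  rewrite /H /V /qturn !quadN !ltnS [(m <= i)%N]leq_eqVlt [(m <= k)%N]leq_eqVlt.
  rewrite ![m == _]eq_sym; have [->|im] := eqVneq i m; rewrite ?ltnn.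
    by have [->|km] := eqVneq k m; rewrite ?ltnn //=; case: (m < k)%N.
  have [->|km] := eqVneq k m; rewrite ?ltnn //=; first by case: (m < i)%N.
  by case: (m < i)%N; case: (m < k)%N.
have total : \sum_(i < J) \sum_(k < J) x i k * (H i k + V i.+1 k - H i k.+1 - V i k) = 4.
  have mJ : (m < J)%N by rewrite /J ltnS leq_addr.
  rewrite (bigD1 (Ordinal mJ)) //= (bigD1 (Ordinal mJ)) //= loop !eqxx /=.
  rewrite big1 => [|k km]; last first.
    by rewrite loop eqxx /= ifF ?mulr0//; apply: negbTE.
  rewrite big1 => [|i im]; last first.
    by rewrite big1// => k _; rewrite loop ifF ?mulr0//; apply/negbTE; rewrite negb_and im.
  by rewrite /x asboolT ?mul1r ?addr0// /Q ctr_mm.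
have /choice[nx nxP] : forall w : C, exists y, (exists2 y', X y' & nrm (y' - w) < 4 * h) ->
    X y /\ nrm (y - w) < 4 * h.
  move=> w; have [[y Xy yw]|no] := pselect (exists2 y', X y' & nrm (y' - w) < 4 * h).
    by exists y.
  by exists 0 => /no.
(* The branch [F] is carried from [X] to the nearby nodes. Along an edge near [X] the turn becomes a
   difference of values of [G]. *)
pose G (w : C) := F (nx w) + qturn (nx w - a) (w - a).
have Gturn w w' : (exists2 y', X y' & nrm (y' - w) < 4 * h) ->
    (exists2 y', X y' & nrm (y' - w') < 4 * h) -> nrm (w - w') <= h ->
    qturn (w - a) (w' - a) = G w' - G w.
  move=> /nxP[] + + /nxP[]; rewrite /G; set y := nx w; set y' := nx w'.
  move=> Xy yw Xy' yw' ww.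
  have yy : nrm (y - y') < 10 * h.
    have := nrm_dist w y y'; have := nrm_dist w' w y'.
    by rewrite [nrm (w' - y')]nrmBC; lra.
  have yw2 : nrm (y - w') < 6 * h by have := nrm_dist w y w'; lra.
  have ya := Xrho _ Xy; have ya' := Xrho _ Xy'.
  have wa : 10 * h < nrm (w - a).
    by have := nrm_dist w y a; lra.
  have n1 : nonopp (y - a) (w' - a) by apply: nonopp_close; rewrite subBB; lra.
  have t1 : qturn (y - a) (y' - a) + qturn (y' - a) (w' - a) = qturn (y - a) (w' - a).
    by apply: qturn_add => //; apply: nonopp_close; rewrite subBB; lra.
  have t2 : qturn (y - a) (w - a) + qturn (w - a) (w' - a) = qturn (y - a) (w' - a).
    by apply: qturn_add => //; apply: nonopp_close; rewrite subBB; lra.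
  have yd : nrm (y - y') < delta by lra.
  by apply: (addrI (qturn (y - a) (w - a))); rewrite t2 -t1 -(FP y y' Xy Xy' yd); ring.
(* Of two adjacent squares take the one outside [Q]. Its center is in [X], or it is outer; in the
   latter case, if [X] were far from [w], one more step would make the other center outer. *)
have close i k i' k' (w : C) : sq (node o h i k) h w -> sq (node o h i' k') h w ->
    nrm (ctr i k - ctr i' k') <= h -> x i k - x i' k' != 0 ->
    exists2 y', X y' & nrm (y' - w) < 4 * h.
  have cs j l v : sq (node o h j l) h v -> nrm (ctr j l - v) <= h.
    move=> [/andP[v1 v2] /andP[v3 v4]]; apply: (le_trans (nrm_ReIm _)).
    rewrite ReD ImD !ReN !ImN ReD ImD /=.
    have : `|complex.Re (node o h j l) + h / 2 - complex.Re v| <= h / 2 by rewrite ler_norml; lra.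
    have : `|complex.Im (node o h j l) + h / 2 - complex.Im v| <= h / 2 by rewrite ler_norml; lra.
    lra.
  have key j l j' l' : sq (node o h j' l') h w -> nrm (ctr j l - ctr j' l') <= h ->
      Q j l -> ~ Q j' l' -> exists2 y', X y' & nrm (y' - w) < 4 * h.
    move=> wq cc [q1 q2] nq; have cw := cs _ _ _ wq.
    have [Xc|nXc] := pselect (X (ctr j' l')); first by exists (ctr j' l') => //; lra.
    have oc : outer X (ctr j' l') by apply: contrapT => noc; exact: nq.
    apply: contrapT => no; apply: q2; apply: (outer_step h0 oc) => z Xz.
    rewrite [nrm (ctr j' l' - _)]nrmBC leNgt; apply/negP => lt; apply: no; exists z => //.
    by have := nrm_dist (ctr j' l') z w; lra.
  move=> w1 w2 cc; rewrite /x; case: asboolP => q1; case: asboolP => q2; rewrite ?subrr// => _.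
    exact: key w2 cc q1 q2.
  by apply: key w1 _ q2 q1; rewrite nrmBC.
pose H' i k := G (node o h i.+1 k) - G (node o h i k).
pose V' i k := G (node o h i k.+1) - G (node o h i k).
have qc i' k' : [/\ sq (node o h i' k') h (node o h i' k'), sq (node o h i' k') h (node o h i'.+1 k'),
    sq (node o h i' k') h (node o h i'.+1 k'.+1) & sq (node o h i' k') h (node o h i' k'.+1)].
  by have := sq_corners (node o h i' k') (ltW h0); rewrite -nodeSl -!nodeSr.
have : \sum_(i < J) \sum_(k < J) x i k * (H i k + V i.+1 k - H i k.+1 - V i k) = 0.
  rewrite (grid_boundary H V xb1 xb2 xb3 xb4).
  transitivity (\sum_(i < J) \sum_(k < J)
     ((x i k.+1 - x i k) * H' i k.+1 + (x i k - x i.+1 k) * V' i.+1 k)).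
    apply: eq_bigr => i _; apply: eq_bigr => k _; congr (_ + _).
      have [->|c0] := eqVneq (x i k.+1 - x i k) 0; first by rewrite !mul0r.
      have cc : nrm (ctr i k.+1 - ctr i k) <= h.
        rewrite /ctr nodeSr (_ : _ - _ = 'i * h%:C); last by ring.
        by rewrite nrmM nrm_i mul1r nrm_real ger0_norm// ltW.
      congr (_ * _); apply: Gturn.
      - by apply: close cc c0; [have [] := qc i k.+1 | have [] := qc i k].
      - by apply: close cc c0; [have [] := qc i k.+1 | have [] := qc i k].
      - rewrite nodeSl (_ : _ - _ = - h%:C); last by ring.
        by rewrite nrmN nrm_real ger0_norm// ltW.
    have [->|c0] := eqVneq (x i k - x i.+1 k) 0; first by rewrite !mul0r.
    have cc : nrm (ctr i k - ctr i.+1 k) <= h.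
      rewrite /ctr nodeSl (_ : _ - _ = - h%:C); last by ring.
      by rewrite nrmN nrm_real ger0_norm// ltW.
    congr (_ * _); apply: Gturn.
    - by apply: close cc c0; [have [] := qc i k | have [] := qc i.+1 k].
    - by apply: close cc c0; [have [] := qc i k | have [] := qc i.+1 k].
    - rewrite nodeSr (_ : _ - _ = - ('i * h%:C)); last by ring.
      by rewrite nrmN nrmM nrm_i mul1r nrm_real ger0_norm// ltW.
  (* Read backwards, the boundary sum of differences of [G] is a sum over closed squares, around
     each of which the differences cancel. *)
  rewrite -(grid_boundary H' V' xb1 xb2 xb3 xb4).
  rewrite big1// => i _; rewrite big1// => k _; rewrite /H' /V'; ring.
by rewrite total.
Qed.
End quadrants.

(** * Simple connectedness and filling of holes *)

Section simply_connected.
Variable R : realType.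
Local Notation C := R[i].

Lemma qturnC (u v : C) : qturn u v = - qturn v u.
Proof. by rewrite /qturn; case: (quad u) (quad v) => [[] []] [[] []]. Qed.

Lemma qturnn (u : C) : qturn u u = 0.
Proof. by rewrite /qturn; case: (quad u) => [[] []]. Qed.

Lemma nonopp_ball (c x y : C) : nrm (x - c) * 4 < nrm c -> nrm (y - c) * 4 < nrm c ->
  nonopp x y.
Proof.
move=> hx hy; apply: nonopp_close; have := nrm_dist c x y; have := nrm_dist x c 0.
have := nrm_ge0 (x - c).
rewrite !subr0 [nrm (c - x)]nrmBC [nrm (c - y)]nrmBC; lra.
Qed.

Definition clamp (x : R) := Num.max 0 (Num.min 1 x).

Lemma clampP x : [\/ x <= 0 /\ clamp x = 0, 0 <= x <= 1 /\ clamp x = x |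
  1 <= x /\ clamp x = 1].
Proof.
rewrite /clamp; have [x1|x1] := leP 1 x; first by apply: Or33; rewrite max_r.
have [x0|x0] := leP x 0; first exact: Or31.
by apply: Or32; split; lra.
Qed.

Lemma clamp_lipschitz x y : `|clamp x - clamp y| <= `|x - y|.
Proof.
have := ler_norm (x - y); have := ler_norm (y - x); rewrite [`|y - x|]distrC ler_norml.
by case: (clampP x) => -[? ->]; case: (clampP y) => -[? ->]; lra.
Qed.

(** The piecewise linear path as one sum: the term [k] varies only while [t] runs from [k / N] to
    [(k + 1) / N]. Continuity then needs no gluing. *)
Definition polygon (N : nat) (p : nat -> C) (t : R) : C :=
  p 0%N + \sum_(0 <= k < N) (clamp (N%:R * t - k%:R))%:C * (p k.+1 - p k).

Lemma polygon_continuous N p : continuous (polygon N p).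
Proof.
pose K := \sum_(0 <= k < N) N%:R * nrm (p k.+1 - p k).
have K0 : 0 <= K by apply: sumr_ge0 => k _; rewrite mulr_ge0 ?nrm_ge0.
move=> t A /nbhs_nrmP[r r0 rA]; rewrite nbhs_simpl /=.
have d0 : 0 < r / (K + 1) by rewrite divr_gt0//; lra.
exists (r / (K + 1)) => // u /= tu; apply: rA.
apply: (@le_lt_trans _ _ (K * `|t - u|)); last first.
  move: tu; rewrite ltr_pdivlMr; last lra.
  by have := normr_ge0 (t - u); lra.
rewrite /polygon opprD addrACA subrr add0r -sumrB /K mulr_suml.
apply: (le_trans (nrm_sum _ _ _)); apply: ler_sum => k _.
rewrite -mulrBl nrmM -rmorphB nrm_real mulrAC ler_wpM2r ?nrm_ge0//.
apply: (le_trans (clamp_lipschitz _ _)).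
rewrite (_ : _ - _ = N%:R * (u - t)); last by ring.
by rewrite normrM distrC normr_nat.
Qed.

Lemma polygon_segment N p k (s : R) : (k < N)%N -> 0 <= s <= 1 ->
  polygon N p ((k%:R + s) / N%:R) = p k + s%:C * (p k.+1 - p k).
Proof.
move=> kN /andP[s0 s1]; have N0 : (N%:R : R) != 0 by rewrite pnatr_eq0; lia.
rewrite /polygon (big_cat_nat (n := k)) //=; last exact: ltnW.
rewrite (big_cat_nat (m := k) (n := k.+1)) //= big_nat1.
rewrite (eq_big_nat _ _ (F2 := fun j => p j.+1 - p j)); last first.
  move=> j /andP[_ jk]; rewrite [N%:R * _]mulrC divfK// /clamp.
  have : (j%:R + 1 : R) <= k%:R by rewrite natr1 ler_nat.
  move=> h; rewrite min_l; last lra.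
  by rewrite max_r// mul1r.
rewrite telescope_sumr// [N%:R * _]mulrC divfK// (_ : k%:R + s - k%:R = s); last by ring.
rewrite [X in _ + (_ + (_ + X))]big_nat big1 => [|j /andP[kj jN]]; last first.
  rewrite /clamp.
  have : (k%:R + 1 : R) <= j%:R by rewrite natr1 ler_nat.
  move=> h; rewrite min_r; last lra.
  by rewrite max_l ?mul0r//; lra.
by rewrite /clamp min_r// max_r//; ring.
Qed.

Section winding.
Variables (Omega : set C) (a : C).

(** The segment stays within [r] of either end, while a point outside [Omega] is at least [4 * r]
    from both. Seen from such a point, no two points of the segment lie in opposite quadrants. *)
Definition link (u v : C) := exists2 r : R, nrm (u - v) < r &
  (forall w, nrm (w - u) < 4 * r -> Omega w) /\ (forall w, nrm (w - v) < 4 * r -> Omega w).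

Lemma linkC u v : link u v -> link v u.
Proof. by move=> [r uv [ru rv]]; exists r; rewrite 1?nrmBC. Qed.

(* The integer is the total turn around [a] along the polygonal path. *)
Inductive chain : C -> int -> C -> Prop :=
| chain0 u : chain u 0 u
| chainS u n v w : chain u n v -> link v w -> chain u (n + qturn (v - a) (w - a)) w.

Lemma chain_trans u n v m w : chain u n v -> chain v m w -> chain u (n + m) w.
Proof.
move=> uv vw; elim: vw uv => [x|x k y z _ IH yz] uv; first by rewrite addr0.
by rewrite addrA; apply: chainS yz; exact: IH.
Qed.

Lemma chain_sym u n v : chain u n v -> chain v (- n) u.
Proof.
elim=> [x|x k y z _ IH yz]; first by rewrite oppr0; exact: chain0.
rewrite opprD addrC -qturnC; apply: chain_trans IH.
by rewrite -[X in chain _ X _]add0r; apply: chainS (linkC yz); exact: chain0.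
Qed.

Lemma chain_fun u n v : chain u n v -> exists N p, [/\ p 0%N = u, p N = v,
  (forall k, (k < N)%N -> link (p k) (p k.+1)) &
  n = \sum_(0 <= k < N) qturn (p k - a) (p k.+1 - a)].
Proof.
elim=> [x|x k y z _ [N [p [p0 pN pl pw]]] yz].
  by exists 0%N, (fun _ => x); split=> //; rewrite big_geq.
exists N.+1, (fun j => if (j <= N)%N then p j else z); split=> //.
- by rewrite ltnn.
- move=> j; rewrite ltnS => jN; rewrite jN; case: ltnP => [jN'|Nj]; first exact: pl.
  have jE : j = N by apply/eqP; rewrite eqn_leq jN.
  by rewrite jE pN.
- rewrite big_nat_recr//= leqnn ltnn pN pw; congr (_ + _).
  by apply: eq_big_nat => j /andP[_ jN]; rewrite jN (ltnW jN).
Qed.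

(** On a fine grid the homotopy has the same total turn along consecutive rows: each cell
    contributes 0, and the two end columns agree since the base point is fixed. The last row is
    constant, so its turn is 0, and the first row refines the polygon of the chain. *)
Lemma closed_chain u n : loops_contract Omega -> ~ Omega a -> Omega u -> chain u n u -> n = 0.
Proof.
move=> loops na Ou /chain_fun[N [p [p0 pN pl ->]]].
have [N0|N0] := posnP N; first by rewrite N0 big_geq.
have N0' : (N%:R : R) != 0 by rewrite pnatr_eq0; lia.
have Npos : 0 < (N%:R : R) by rewrite ltr0n.
pose g := polygon N p.
have gk k : (k <= N)%N -> g (k%:R / N%:R) = p k.
  case: (ltnP k N) => [kN _|Nk kN].
    by rewrite -[k%:R]addr0 /g polygon_segment ?mul0r ?addr0// lexx ler01.
  have {kN Nk} -> : k = N by lia.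
  have -> : (N%:R / N%:R : R) = (N.-1%:R + 1) / N%:R by rewrite natr1 prednK.
  rewrite /g polygon_segment ?ler01 ?lexx//; last by rewrite prednK.
  by rewrite prednK// mul1r addrC subrK.
have seg k (s : R) : (k < N)%N -> 0 <= s <= 1 ->
  exists2 r, nrm (g ((k%:R + s) / N%:R) - p k) < r & forall w, nrm (w - p k) < 4 * r -> Omega w.
  move=> kN s01; have [r pr [rk _]] := pl k kN; exists r => //.
  rewrite /g polygon_segment// addrAC subrr add0r nrmM nrm_real.
  move/andP: s01 => [s0 s1]; rewrite ger0_norm// nrmBC.
  by have := ler_wpM2r (nrm_ge0 (p k - p k.+1)) s1; lra.
have gO t : t \in `[0, 1] -> Omega (g t).
  rewrite in_itv /= => /andP[t0 t1].
  have [k [s [kN s01 ->]]] : exists k s, [/\ (k < N)%N, 0 <= s <= 1 & t = (k%:R + s) / N%:R].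
    have [t1'|t1'] := ltP t 1; last first.
      exists N.-1, 1; rewrite natr1 prednK// divff//; split; [lia | lra | lra].
    exists (Num.truncn (t * N%:R)), (t * N%:R - (Num.truncn (t * N%:R))%:R).
    have := truncn_itv (mulr_ge0 t0 (ltW Npos)); rewrite -natr1 => /andP[h1 h2].
    split; [|lra|by rewrite addrC subrK mulfK].
    by rewrite -(ltr_nat R); apply: le_lt_trans h1 _; rewrite gtr_pMl.
  have [r hr hO] := seg k s kN s01; apply: hO.
  by have := nrm_ge0 (g ((k%:R + s) / N%:R) - p k); lra.
have g0 : g 0 = u by rewrite -p0 -(gk 0%N)// mul0r.
have g1 : g 1 = u by rewrite -pN -(gk N)// divff.
have [] := loops g _ gO _.
- by apply: continuous_subspaceT => t; exact: polygon_continuous.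
- by rewrite g0 g1.
move=> H [cH HO H0 H1 He].
(* Uniform continuity measured against the distance to [a], in the form that [nonopp_close] asks
   for. *)
have nbd : exists2 r : R, 0 < r & forall y, (`[0, 1]%classic `*` `[0, 1]%classic) y ->
    forall y', (`[0, 1]%classic `*` `[0, 1]%classic) y' ->
    `|y.1 - y'.1| < r -> `|y.2 - y'.2| < r -> nrm (H y - H y') < nrm (H y - a).
  apply: (@compact_uniform R (R * R)%type (`[0, 1]%classic `*` `[0, 1]%classic) (fun r y => forall y',
      (`[0, 1]%classic `*` `[0, 1]%classic) y' ->
    `|y.1 - y'.1| < r -> `|y.2 - y'.2| < r -> nrm (H y - H y') < nrm (H y - a))).
  - by apply: compact_setX; exact: segment_compact.
  - move=> e e' y e'0 ee h y' Sy' y1 y2; apply: h => //.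
      exact: lt_le_trans ee.
    exact: lt_le_trans ee.
  move=> x Sx; have Hxa : 0 < nrm (H x - a).
    rewrite nrm_gt0 subr_eq0; apply/eqP => Hx; apply: na; rewrite -Hx.
    by case: x Sx {Hx} => s t [] /= ? ?; apply: HO.
  have /subspace_continuousP/(_ x Sx) := cH.
  move=> /(_ [set w | nrm (w - H x) < nrm (H x - a) / 4]) nb.
  have /nb : nbhs (H x) [set w | nrm (w - H x) < nrm (H x - a) / 4].
    by apply/nbhs_nrmP; exists (nrm (H x - a) / 4) => //; rewrite divr_gt0.
  rewrite nbhs_simpl /= /within /= => /nbhs_ballP[d /= d0 dP].
  exists (d / 2); first by rewrite divr_gt0.
  have d2 : d / 2 < d by rewrite ltr_pdivrMr// ltr_pMr// ltr1n.
  apply/nbhs_ballP; exists (d / 2); first by rewrite /= divr_gt0.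
  move=> y [/= xy1 xy2] Sy y' Sy' y1 y2.
  have h1 : nrm (H y - H x) < nrm (H x - a) / 4.
    apply: dP => //; split; rewrite /ball /=; [exact: lt_trans xy1 d2 | exact: lt_trans xy2 d2].
  have h2 : nrm (H y' - H x) < nrm (H x - a) / 4.
    apply: dP => //; split; rewrite /ball /=.
      rewrite (_ : x.1 - y'.1 = (x.1 - y.1) + (y.1 - y'.1)); last by ring.
      by apply: (le_lt_trans (ler_normD _ _)); rewrite [d]splitr; apply: ltrD.
    rewrite (_ : x.2 - y'.2 = (x.2 - y.2) + (y.2 - y'.2)); last by ring.
    by apply: (le_lt_trans (ler_normD _ _)); rewrite [d]splitr; apply: ltrD.
  have := nrm_dist (H x) (H y) (H y'); have := nrm_dist (H y) (H x) a.
  by rewrite [nrm (H x - H y')]nrmBC [nrm (H x - H y)]nrmBC; lra.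
have {nbd} [r r0 rP] := nbd.
(* A multiple of [N], so that the vertices of the polygon are grid points, with mesh smaller than
   [r]. *)
pose m := (Num.truncn r^-1).+1; pose M := (N * m)%N.
have M0 : 0 < (M%:R : R) by rewrite ltr0n /M muln_gt0 N0.
have Mr : M%:R^-1 < r.
  rewrite -[r]invrK ltf_pV2 ?posrE ?invr_gt0//.
  apply: (@lt_le_trans _ _ m%:R); first exact: truncnS_gt.
  by rewrite ler_nat /M leq_pmull.
pose q j k := H (j%:R / M%:R, k%:R / M%:R) - a.
have inS j : (j <= M)%N -> j%:R / M%:R \in `[0, 1 : R].
  by move=> jM; rewrite in_itv /= divr_ge0//= ler_pdivrMr// mul1r ler_nat.
have near j k j' k' : (j <= M)%N -> (k <= M)%N -> (j' <= M)%N -> (k' <= M)%N ->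
    (j' = j \/ j' = j.+1) -> (k' = k \/ k' = k.+1) -> nonopp (q j k) (q j' k').
  move=> jM kM jM' kM' jj kk; apply: nonopp_close; rewrite /q subBB.
  have step (x y : nat) : (y = x \/ y = x.+1) -> `|x%:R / M%:R - y%:R / M%:R| < r.
    case=> ->; first by rewrite subrr normr0.
    by rewrite -natr1 -mulrBl opprD addrA subrr add0r mulN1r normrN ger0_norm// invr_ge0 ltW.
  by apply: rP; rewrite /=; do ?[split; exact: inS]; exact: step.
pose row j := \sum_(0 <= k < M) qturn (q j k) (q j k.+1).
have rowE j : (j < M)%N -> row j = row j.+1.
  move=> jM; apply/eqP; rewrite -subr_eq0 /row -sumrB.
  rewrite (eq_big_nat _ _ (F2 := fun k => - (qturn (q j k.+1) (q j.+1 k.+1) - qturn (q j k) (q j.+1 k)))).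
    rewrite sumrN telescope_sumr//.
    have E0 : q j 0%N = q j.+1 0%N.
      by rewrite /q mul0r !(He _ _).1// inS// ltnW.
    have E1 : q j M = q j.+1 M.
      by rewrite /q divff ?gt_eqF// !(He _ _).2// inS// ltnW.
    by rewrite -E0 -E1 !qturnn subrr oppr0.
  move=> k /andP[_ kM].
  have t1 : qturn (q j k) (q j k.+1) + qturn (q j k.+1) (q j.+1 k.+1) = qturn (q j k) (q j.+1 k.+1).
    by apply: qturn_add; apply: near; rewrite ?(ltnW jM) ?(ltnW kM); auto.
  have t2 : qturn (q j k) (q j.+1 k) + qturn (q j.+1 k) (q j.+1 k.+1) = qturn (q j k) (q j.+1 k.+1).
    by apply: qturn_add; apply: near; rewrite ?(ltnW jM) ?(ltnW kM); auto.
  have -> : qturn (q j k) (q j k.+1) =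
      qturn (q j k) (q j.+1 k) + qturn (q j.+1 k) (q j.+1 k.+1) - qturn (q j k.+1) (q j.+1 k.+1).
    by rewrite t2 -t1 addrK.
  ring.
have row0 : row 0%N = 0.
  have : forall j, (j <= M)%N -> row 0%N = row j.
    elim=> // j IH jM; rewrite IH; [exact: rowE | exact: ltnW].
  move=> /(_ M (leqnn M)) ->; rewrite /row big_nat big1// => k /andP[_ kM].
  by rewrite /q divff ?gt_eqF// !H1 ?qturnn// ?inS// ltnW.
rewrite -[RHS]row0 /row.
(* Along one edge the path stays within a quarter of the distance from [p n'] to [a], so no two of
   its points are opposite and the small turns telescope to the turn of the edge. *)
have blocks n' : (n' <= N)%N -> \sum_(0 <= k < n') qturn (p k - a) (p k.+1 - a) =
    \sum_(0 <= k < n' * m) qturn (q 0%N k) (q 0%N k.+1).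
  elim: n' => [|n' IH] nN; first by rewrite !big_geq.
  rewrite big_nat_recr//= IH ?(ltnW nN)// mulSnr.
  rewrite [RHS](big_cat_nat (n := (n' * m)%N)) ?leq_addr//=; congr (_ + _).
  have q0 k : (k <= M)%N -> q 0%N k = g (k%:R / M%:R) - a.
    by move=> kM; rewrite /q mul0r H0 ?inS.
  have m0 : (m%:R : R) != 0 by rewrite pnatr_eq0.
  have pos l : (l <= m)%N -> (n' * m + l <= M)%N /\
      (n' * m + l)%:R / M%:R = (n'%:R + l%:R / m%:R) / N%:R :> R.
    move=> lm; split; first by rewrite /M; nia.
    by rewrite /M natrD !natrM; field; rewrite N0' m0.
  have ball l : (l <= m)%N -> nrm (q 0%N (n' * m + l)%N - (p n' - a)) * 4 < nrm (p n' - a).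
    move=> lm; have [lM ->] : (n' * m + l <= M)%N /\ q 0%N (n' * m + l)%N = g ((n'%:R + l%:R / m%:R) / N%:R) - a.
      by have [h1 h2] := pos l lm; split=> //; rewrite q0// h2.
    have [|s hs hO] := seg n' (l%:R / m%:R) nN.
      by rewrite divr_ge0//= ler_pdivrMr ?mul1r ?ler_nat// ltr0n.
    have : 4 * s <= nrm (a - p n').
      by rewrite leNgt; apply/negP => /hO.
    rewrite subBB [nrm (a - _)]nrmBC; lra.
  have nn l l' : (l <= m)%N -> (l' <= m)%N -> nonopp (q 0%N (n' * m + l)%N) (q 0%N (n' * m + l')%N).
    by move=> /ball b1 /ball b2; exact: nonopp_ball b1 b2.
  have tele l : (l <= m)%N -> \sum_(n' * m <= k < n' * m + l) qturn (q 0%N k) (q 0%N k.+1) =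
      qturn (q 0%N (n' * m + 0)%N) (q 0%N (n' * m + l)%N).
    elim: l => [|l IHl] lm; first by rewrite addn0 big_geq// qturnn.
    rewrite addnS big_nat_recr ?leq_addr//= IHl ?(ltnW lm)// -addnS.
    by apply: qturn_add; apply: nn => //; exact: ltnW.
  rewrite tele//; have [h1 h2] := pos 0%N isT; have [h3 h4] := pos m (leqnn m).
  have -> : q 0%N (n' * m + 0)%N = p n' - a.
    by rewrite q0// h2 mul0r addr0 gk// ltnW.
  have -> : q 0%N (n' * m + m)%N = p n'.+1 - a.
    by rewrite q0// h4 divff// natr1 gk.
  by [].
by rewrite blocks.
Qed.

Lemma small_link u w (r : R) : 0 < r -> (forall v, nrm (v - u) < 8 * r -> Omega v) ->
  nrm (u - w) < r -> link u w.
Proof.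
move=> r0 h uw; exists r => //; split=> v vw; apply: h; first lra.
by have := nrm_dist w v u; rewrite [nrm (w - u)]nrmBC; lra.
Qed.

Lemma chain_exists u v : open Omega -> connected Omega -> Omega u -> Omega v ->
  exists n, chain u n v.
Proof.
move=> oO cO Ou; move: v; apply: connected_induction => // [|z Oz].
  by exists u => //; exists 0; exact: chain0.
have [r r0 rP] := (openP _).1 oO z Oz; have r8 : 0 < r / 8 by lra.
have h v : nrm (v - z) < 8 * (r / 8) -> Omega v by move=> ?; apply: rP; lra.
exists (r / 8) => // w; rewrite nrmBC => zw; have l := small_link r8 h zw.
by split=> -[n c]; eexists; [exact: chainS c l | exact: chainS c (linkC l)].
Qed.

(** The branch at [z] is the total turn of some chain from a base point; [closed_chain] makes its
    increments independent of the choice. *)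
Lemma has_arg_simply_connected (L : set C) : simply_connected_domain Omega ->
  ~ Omega a -> compact L -> L `<=` Omega -> has_arg L a.
Proof.
move=> [[u Ou] oO cO loops] na cL LO.
have [r r0 rP] := compact_in_open cL oO LO.
have /choice[F FP] : forall z, exists n, Omega z -> chain u n z.
  move=> z; have [Oz|] := pselect (Omega z); last by exists 0.
  by have [n c] := chain_exists oO cO Ou Oz; exists n.
exists F; exists (r / 8); first lra.
move=> z z' Lz Lz' zz.
have l : link z z'.
  apply: (@small_link _ _ (r / 8)) => //; first lra.
  by move=> v vz; apply: (rP z) => //; lra.
have c1 := chainS (FP z (LO _ Lz)) l; have c2 := FP z' (LO _ Lz').
have := closed_chain loops na Ou (chain_trans c1 (chain_sym c2)).
by move=> /eqP; rewrite subr_eq0 => /eqP <-; ring.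
Qed.
End winding.

(** For compact [X] this is the polynomially convex hull: [X] together with the bounded components
    of its complement. *)
Definition hull (X : set C) : set C := ~` outer X.

Lemma outer_open (X : set C) : open (outer X).
Proof.
apply/openP => z [a k k0 h|b c k k0 ob h]; exists (k / 2); try lra.
- move=> w wa; apply: (@outer_far _ _ w (k / 2)) => [|x Xx]; first lra.
  have := h _ Xx; have := nrmD (a - w) w; rewrite subrK nrmBC; lra.
- move=> w wc; apply: (@outer_step _ _ b w (k / 2)) => // [|x Xx]; first lra.
  by have := h _ Xx; have := nrm_dist c b w; rewrite [nrm (c - w)]nrmBC; lra.
Qed.

Lemma sub_hull (X : set C) : X `<=` hull X.
Proof. by move=> z Xz /outer_notin. Qed.

(** The slack of every step is halved: a point that violated the halved inequality would itself be
    reached by that step, hence would not be in the hull. *)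
Lemma outer_hull (X : set C) a : outer X a -> outer (hull X) a.
Proof.
elim=> {a} [a k k0 h|b c k k0 ob IH h].
  have k2 : 0 < k / 2 by lra.
  apply: (outer_far k2) => z hz; rewrite leNgt; apply/negP => lt; apply: hz.
  apply: (outer_far k2) => x Xx; have := h x Xx; lra.
have k2 : 0 < k / 2 by lra.
apply: (outer_step k2 IH) => z hz; rewrite leNgt; apply/negP => lt; apply: hz.
apply: (outer_step k2 ob) => x Xx; have := h x Xx; rewrite [nrm (b - z)]nrmBC; lra.
Qed.

Lemma hull_outer (X : set C) a : ~ hull X a -> outer (hull X) a.
Proof. by move=> /contrapT; exact: outer_hull. Qed.

Lemma hull_compact (X : set C) : compact X -> compact (hull X).
Proof.
move=> cX; have [B B0 XB] := compact_nrm_bounded cX.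
apply: (@closed_bounded_compact _ _ (B + 1)).
  by rewrite /hull closedC; exact: outer_open.
move=> z hz; rewrite leNgt; apply/negP => lt; apply: hz.
by apply: (@outer_far _ _ _ 1) => // x /XB; lra.
Qed.

Lemma hull_sub (X Omega : set C) : simply_connected_domain Omega -> compact X ->
  X `<=` Omega -> hull X `<=` Omega.
Proof.
move=> sO cX XO z hz; apply: contrapT => nz; apply: hz.
apply: outer_of_has_arg => //; first by move/XO.
exact: has_arg_simply_connected sO nz cX XO.
Qed.

(** A case of Janiszewski's theorem. Branches of the argument on [A] and on [B] glue because the
    sets are at positive distance, and [outer_of_has_arg] returns to pole pushing. *)
Lemma outer_union (A B : set C) : compact A -> compact B -> A `&` B = set0 ->
  (forall a, ~ A a -> outer A a) -> (forall b, ~ B b -> outer B b) ->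
  forall z, ~ (A `|` B) z -> outer (A `|` B) z.
Proof.
move=> cA cB AB oA oB z nz.
have [r r0 rP] : exists2 r : R, 0 < r & forall x w, A x -> nrm (w - x) < r -> (~` B) w.
  apply: compact_in_open => //; first by rewrite openC; exact: compact_closedC.
  by move=> w Aw Bw; have : (A `&` B) w by []; rewrite AB.
apply: outer_of_has_arg => //; first exact: compactU.
apply: (has_arg_union r0).
- by move=> x y Ax By; rewrite leNgt; apply/negP; rewrite nrmBC => /(rP x y Ax).
- by apply/has_arg_outer/oA => Az; apply: nz; left.
- by apply/has_arg_outer/oB => Bz; apply: nz; right.
Qed.
End simply_connected.

(** * Taylor expansions *)

Section cauchy_estimates.
Variable R : realType.
Local Notation C := R[i].

Lemma primitive_root_exists n : (0 < n)%N -> exists w : C, n.-primitive_root w.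
Proof.
move=> n0; have [r] := closed_field_poly_normal ('X^n - 1 : {poly C}).
rewrite (monicP (monicXnsubC _ n0)) scale1r => pE.
have rn : all n.-unity_root r by apply/allP => z; rewrite -root_prod_XsubC -pE.
have sz : (n <= size r)%N.
  by rewrite -ltnS -(size_prod_XsubC r id) -pE size_XnsubC.
have ur : uniq r by rewrite -separable_prod_XsubC -pE separable_Xn_sub_1// pnatr_eq0 -lt0n.
by have /hasP[w _ wP] := has_prim_root n0 rn ur sz; exists w.
Qed.

(** Averaging over the [N]-th roots of unity replaces the integral over the circle. It isolates one
    coefficient exactly because [N] exceeds [k] and every exponent of [p]. *)
Lemma cauchy_coef (p : {poly C}) (r M : R) k : 0 <= r ->
  (forall z, nrm z = r -> nrm p.[z] <= M) -> nrm p`_k * r ^+ k <= M.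
Proof.
move=> r0 pM; pose N := (size p + k).+1.
have [w wP] := @primitive_root_exists N isT.
have wN := prim_expr_order wP.
have w0 : w != 0 by apply: contra_eq_neq wN => ->; rewrite expr0n eq_sym oner_neq0.
have nw : nrm w = 1.
  apply/eqP; rewrite -(@pexpr_eq1 _ _ N) ?nrm_ge0//.
  by rewrite -nrmX wN nrm1.
have sum0 i : (i < N)%N -> i != k -> \sum_(j < N) (w ^+ i / w ^+ k) ^+ j = 0.
  move=> iN ik; set x := w ^+ i / w ^+ k.
  have x1 : x - 1 != 0.
    rewrite subr_eq0 /x; apply: contra_neq ik => /(canRL (divfK (expf_neq0 _ w0))).
    rewrite mul1r => /eqP; rewrite (eq_prim_root_expr wP) !modn_small; first by move/eqP.
      by rewrite /N; lia.
    by [].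
  have xN : x ^+ N = 1 by rewrite /x expr_div_n -!exprM ![(_ * N)%N]mulnC !exprM wN !expr1n divr1.
  by apply: (mulfI x1); rewrite -subrX1 xN subrr mulr0.
have avg : \sum_(j < N) p.[r%:C * w ^+ j] / w ^+ k ^+ j = N%:R * (p`_k * r%:C ^+ k).
  transitivity (\sum_(i < N) p`_i * r%:C ^+ i * \sum_(j < N) (w ^+ i / w ^+ k) ^+ j).
    have pN : (size p <= N)%N by rewrite /N; lia.
    under eq_bigr => j _ do rewrite (horner_coef_wide _ pN) mulr_suml.
    rewrite exchange_big /=; apply: eq_bigr => i _; rewrite mulr_sumr; apply: eq_bigr => j _.
    by rewrite exprMn expr_div_n -(exprM w j i) -(exprM w i j) (mulnC i j) !mulrA.
  have kN : (k < N)%N by rewrite /N; lia.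
  rewrite (bigD1 (Ordinal kN)) //= divff ?expf_neq0// [X in _ + X]big1 => [|i ik]; last first.
    by rewrite sum0 ?mulr0.
  under eq_bigr => j _ do rewrite expr1n.
  by rewrite sumr_const card_ord addr0 mulrC.
have Np : 0 < (N%:R : R) by rewrite ltr0n.
have : N%:R * (nrm p`_k * r ^+ k) <= N%:R * M.
  have -> : N%:R * (nrm p`_k * r ^+ k) = nrm (N%:R * (p`_k * r%:C ^+ k)).
    by rewrite !nrmM nrm_nat nrmX nrm_real ger0_norm.
  rewrite -avg; apply: nrm_sum_le => j; rewrite nrm_div !nrmX nw !expr1n divr1.
  by apply: pM; rewrite nrmM nrmX nw expr1n mulr1 nrm_real ger0_norm.
by rewrite ler_pM2l.
Qed.

(** The bound does not involve the degree of [p], so it passes to uniform limits of polynomials. The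
    factor 2 sums a geometric series of ratio at most [2^-1]. *)
Lemma poly_remainder (p : {poly C}) (r M : R) N (w : C) : 0 < r ->
  (forall z, nrm z <= r -> nrm p.[z] <= M) -> nrm w <= r / 2 ->
  nrm (p.[w] - \sum_(k < N) p`_k * w ^+ k) <= 2 * M * (nrm w / r) ^+ N.
Proof.
move=> r0 pM wr; have M0 : 0 <= M by apply: le_trans (pM 0 _); rewrite ?nrm0 ?nrm_ge0// ltW.
pose t := nrm w / r; have t0 : 0 <= t by rewrite divr_ge0 ?nrm_ge0// ltW.
have t2 : t <= 2^-1 by rewrite /t ler_pdivrMr//; lra.
have coefM k : nrm (p`_k * w ^+ k) <= M * t ^+ k.
  rewrite nrmM nrmX /t expr_div_n mulrA ler_pdivlMr ?exprn_gt0// mulrAC.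
  apply: ler_wpM2r; first by rewrite exprn_ge0 ?nrm_ge0.
  by apply: cauchy_coef => [|z zr]; [exact: ltW | apply: pM; rewrite zr].
have tail m : \sum_(N <= k < N + m) t ^+ k <= 2 * t ^+ N.
  have -> : \sum_(N <= k < N + m) t ^+ k = t ^+ N * \sum_(0 <= k < m) t ^+ k.
    rewrite -{1}[N]add0n [(N + m)%N]addnC big_addn addnK mulr_sumr.
    by apply: eq_bigr => k _; rewrite exprD mulrC.
  rewrite [2 * _]mulrC ler_wpM2l ?exprn_ge0//.
  have : (1 - t) * \sum_(0 <= k < m) t ^+ k <= 1.
    have -> : (1 - t) * \sum_(0 <= k < m) t ^+ k = 1 - t ^+ m.
      by rewrite big_mkord -opprB mulNr -subrX1 opprB.
    by rewrite gerBl exprn_ge0.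
  set s := \sum_(_ <= _ < _) _.
  have s0 : 0 <= s by apply: sumr_ge0 => k _; rewrite exprn_ge0.
  by have := ler_wpM2r s0 t2; lra.
rewrite (@horner_coef_wide _ (N + size p)) ?leq_addl//.
rewrite -(big_mkord predT (fun k => p`_k * w ^+ k)) -(big_mkord predT (fun k => p`_k * w ^+ k)).
rewrite (big_cat_nat (n := N)) ?leq_addr//= addrAC subrr add0r.
apply: (le_trans (nrm_sum _ _ _)).
apply: (le_trans (ler_sum _ (fun k _ => coefM k))).
by rewrite -mulr_sumr [2 * M]mulrC -mulrA ler_wpM2l// tail.
Qed.

Lemma complex_limit (u : nat -> C) (e : nat -> R) :
  (forall n m, nrm (u n - u m) <= e n + e m) -> exists l, forall n, nrm (u n - l) <= 2 * e n.
Proof.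
move=> ue.
have [x xP] := @nested_intervals R (fun n => complex.Re (u n) - e n) (fun n => complex.Re (u n) + e n)
  (fun n m => ltac:(have := le_trans (nrm_Re _) (ue n m); rewrite ReD ReN ler_norml; lra)).
have [y yP] := @nested_intervals R (fun n => complex.Im (u n) - e n) (fun n => complex.Im (u n) + e n)
  (fun n m => ltac:(have := le_trans (nrm_Im _) (ue n m); rewrite ImD ImN ler_norml; lra)).
exists (Complex x y) => n; apply: (le_trans (nrm_ReIm _)); rewrite ReD ImD ReN ImN /=.
have : `|complex.Re (u n) - x| <= e n by rewrite ler_norml; have := xP n; lra.
have : `|complex.Im (u n) - y| <= e n by rewrite ler_norml; have := yP n; lra.
lra.
Qed.

Lemma inv_nat_lt (e : R) : 0 < e -> exists n, n.+1%:R^-1 < e.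
Proof.
move=> e0; exists (Num.truncn e^-1); rewrite -[X in _ < X]invrK ltf_pV2 ?posrE ?invr_gt0//.
exact: truncnS_gt.
Qed.

Lemma le_inv_nat (x y K : R) : 0 <= K -> (forall n, x <= y + K * n.+1%:R^-1) -> x <= y.
Proof.
move=> K0 h; rewrite leNgt; apply/negP => yx.
have [|n nP] := @inv_nat_lt ((x - y) / (K + 1)); first by rewrite divr_gt0//; lra.
have i0 : 0 < (n.+1%:R^-1 : R) by rewrite invr_gt0 ltr0n.
have := h n; move: nP i0; move: (n.+1%:R^-1 : R) => i; rewrite ltr_pdivlMr; last lra.
lra.
Qed.

Definition shift_poly (z : C) (p : {poly C}) := p \Po ('X + z%:P).

Lemma horner_shift z p w : (shift_poly z p).[w] = p.[w + z].
Proof. by rewrite /shift_poly horner_comp !hornerE. Qed.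

Lemma shift_polyK (z : C) (P : {poly C}) : shift_poly z (shift_poly (- z) P) = P.
Proof.
by rewrite /shift_poly -comp_polyA comp_polyD comp_polyX comp_polyC polyCN addrK comp_polyXr.
Qed.

Definition disc (z : C) (r : R) : set C := [set w | nrm (w - z) <= r].

(** By [cauchy_coef] the coefficients of the approximating polynomials form Cauchy sequences, and
    the remainder estimate survives in the limit. The first clause is Cauchy's estimate for the
    difference of [f] and a polynomial; it makes Taylor coefficients depend continuously on the
    function. *)
Lemma approx_taylor (f : C -> C) (zeta : C) (r : R) : 0 < r ->
  approximable (disc zeta r) f ->
  exists a : C^nat,
  [/\ (forall (p : {poly C}) (e : R), (forall z, disc zeta r z -> nrm (f z - p.[z]) <= e) ->
        forall k, nrm ((shift_poly zeta p)`_k - a k) * r ^+ k <= e),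
      taylor_expansion f zeta a & cdiff f zeta].
Proof.
move=> r0 fA; pose e n : R := n.+1%:R^-1.
have e0 n : 0 < e n by rewrite invr_gt0 ltr0n.
have /choice[p pP] : forall n, exists p : {poly C}, forall z, disc zeta r z -> nrm (f z - p.[z]) <= e n.
  by move=> n; exact: fA.
pose c n := shift_poly zeta (p n).
have cP n w : nrm w <= r -> nrm (f (w + zeta) - (c n).[w]) <= e n.
  by move=> wr; rewrite horner_shift; apply: pP; rewrite /disc /= addrK.
have rk k : 0 < r ^+ k by rewrite exprn_gt0.
have coefB (q s : {poly C}) (d : R) k : (forall w, nrm w <= r -> nrm (q.[w] - s.[w]) <= d) ->
    nrm (q`_k - s`_k) * r ^+ k <= d.
  move=> h; rewrite -coefB; apply: cauchy_coef => [|z zr]; first exact: ltW.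
  by rewrite hornerD hornerN; apply: h; rewrite zr.
have /choice[a aP] : forall k, exists l, forall n, nrm ((c n)`_k - l) <= 2 * (e n / r ^+ k).
  move=> k; apply: complex_limit => n m; rewrite -mulrDl ler_pdivlMr//.
  apply: coefB => w wr; have := nrm_dist (f (w + zeta)) (c n).[w] (c m).[w].
  by rewrite [nrm (_ - f _)]nrmBC; have := cP n w wr; have := cP m w wr; lra.
have bB : exists2 B : R, 0 <= B & forall w, nrm w <= r -> nrm (f (w + zeta)) <= B.
  have bX : bounded_on (disc zeta r) id.
    exists (r + nrm zeta) => w; rewrite /disc /= => wr.
    by have := nrmD (w - zeta) zeta; rewrite subrK; lra.
  have [B BP] := approx_bounded bX fA; exists B; last first.
    by move=> w wr; apply: BP; rewrite /disc /= addrK.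
  apply: le_trans (nrm_ge0 _) (BP zeta _); by rewrite /disc /= subrr nrm0 ltW.
have [B B0 BP] := bB.
have remainder N w : nrm w <= r / 2 ->
    nrm (f (w + zeta) - \sum_(k < N) a k * w ^+ k) <= 2 * (B + 1) * (nrm w / r) ^+ N.
  move=> wr; have wr' : nrm w <= r by lra.
  have t0 : 0 <= nrm w / r by rewrite divr_ge0 ?nrm_ge0// ltW.
  have t1 : nrm w / r <= 1 by rewrite ler_pdivrMr// mul1r.
  (* The error against the polynomial [c n] is [e n] for the value and at most [2 * e n] for each of
     the [N] terms. *)
  apply: (@le_inv_nat _ _ (1 + N%:R * 2)); first by have := ler0n R N; lra.
  move=> n; have pn : nrm ((c n).[w] - \sum_(k < N) (c n)`_k * w ^+ k) <= 2 * (B + 1) * (nrm w / r) ^+ N.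
    apply: poly_remainder => // z zr.
    have := nrm_dist (f (z + zeta)) (c n).[z] 0; rewrite !subr0 nrmBC.
    have := cP n z zr; have := BP z zr.
    have : e n <= 1 by rewrite invf_le1 ?ltr0n// ler1n.
    lra.
  have sn : nrm (\sum_(k < N) (c n)`_k * w ^+ k - \sum_(k < N) a k * w ^+ k) <= N%:R * (2 * e n).
    rewrite -sumrB; apply: nrm_sum_le => k; rewrite -mulrBl nrmM nrmX.
    have := aP k n; rewrite mulrA ler_pdivlMr// => h; apply: le_trans h.
    by rewrite ler_wpM2l ?nrm_ge0// lerXn2r ?nnegrE ?nrm_ge0// ltW.
  have := nrm_dist (c n).[w] (f (w + zeta)) (\sum_(k < N) a k * w ^+ k).
  have := nrm_dist (\sum_(k < N) (c n)`_k * w ^+ k) (c n).[w] (\sum_(k < N) a k * w ^+ k).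
  have := cP n w wr'; rewrite -/(e n); lra.
exists a; split.
- move=> q d qd k; apply: (@le_inv_nat _ _ 3); first lra.
  move=> n; have h1 : nrm ((shift_poly zeta q)`_k - (c n)`_k) * r ^+ k <= d + e n.
    apply: coefB => w wr; rewrite horner_shift.
    have := nrm_dist (f (w + zeta)) q.[w + zeta] (c n).[w]; have := cP n w wr.
    by rewrite [nrm (_ - f _)]nrmBC; have := qd (w + zeta); rewrite /disc /= addrK => /(_ wr); lra.
  have := aP k n; rewrite mulrA ler_pdivlMr// => h2.
  have := ler_wpM2r (ltW (rk k)) (nrm_dist (c n)`_k (shift_poly zeta q)`_k (a k)).
  by rewrite mulrDl -/(e n); lra.
- apply/nbhs_nrmP; exists (r / 2); first lra.
  move=> z zr; apply/(@cvgrPdist_le _ _ _ _ _ _ _) => d0 /pos_complex[d dpos ->].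
  have zr' := ltW zr; have t0 : 0 <= nrm (z - zeta) / r < 1.
    by rewrite divr_ge0 ?nrm_ge0 ?(ltW r0)//= ltr_pdivrMr// mul1r; lra.
  have d2 : 0 < d / (2 * (B + 1)) by rewrite divr_gt0//; lra.
  have [N NP] := geometric_lt t0 d2; exists N => // n /= Nn.
  rewrite normE lecR /series /= big_mkord.
  have := remainder n (z - zeta) zr'; rewrite subrK => /le_trans; apply.
  move: NP; rewrite ltr_pdivlMr; last lra.
  move=> /ltW; apply: le_trans; rewrite mulrC ler_wpM2r//; first lra.
  by case/andP: t0 => t00 t01; apply: ler_wiXn2l => //; exact: ltW.
- exists (a 1%N) => d d0.
  have fz : f zeta = a 0%N.
    apply/eqP; rewrite -subr_eq0 -nrm_eq0; apply/eqP/le_anti; rewrite nrm_ge0 andbT.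
    have := remainder 1%N 0; rewrite nrm0 big_ord1 expr0 mulr1 mul0r expr1 mulr0 add0r; apply.
    lra.
  pose K := 2 * (B + 1) / r ^+ 2; have K0 : 0 < K by rewrite /K divr_gt0 ?exprn_gt0//; lra.
  exists (Num.min (r / 2) (d / K)).
    by rewrite lt_min; apply/andP; split; rewrite divr_gt0.
  move=> w; rewrite lt_min => /andP[w1 w2].
  have := remainder 2%N (w - zeta) (ltW w1).
  rewrite !big_ord_recr big_ord0 /= add0r expr0 mulr1 expr1 subrK -fz.
  rewrite opprD addrA => /le_trans; apply.
  have -> : 2 * (B + 1) * (nrm (w - zeta) / r) ^+ 2 = K * nrm (w - zeta) * nrm (w - zeta).
    by rewrite /K; field; lra.
  rewrite ler_wpM2r ?nrm_ge0//; move: w2; rewrite ltr_pdivlMr//; lra.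
Qed.

(** One step suffices: [b] lies on the ray from [z] through [a], and [T] puts it far enough out to
    satisfy [outer_far]. *)
Lemma disc_outer (z : C) (r : R) a : 0 <= r -> ~ disc z r a -> outer (disc z r) a.
Proof.
move=> r0; rewrite /disc /= => /negP; rewrite -ltNge => ra.
pose n := nrm (a - z); have n0 : 0 < n by rewrite /n; lra.
pose T : R := 1 + (2 * nrm z + r + 1) / n.
have z0 := nrm_ge0 z.
have T1 : 1 <= T by rewrite lerDl divr_ge0// ?(ltW n0)//; lra.
have Tn : T * n = n + (2 * nrm z + r + 1) by rewrite /T mulrDl mul1r divfK ?gt_eqF.
pose b := z + T%:C * (a - z).
have bz : nrm (b - z) = T * n.
  by rewrite /b addrAC subrr add0r nrmM nrm_real ger0_norm//; lra.
apply: (@outer_step _ _ b a (n - r)); first by rewrite /n; lra.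
  apply: (@outer_far _ _ _ 1) => // w; rewrite /disc /= => wr.
  have := nrmD (w - z) z; rewrite subrK; have := nrmB b z; rewrite bz Tn; lra.
move=> w; rewrite /disc /= => wr.
have -> : nrm (b - a) = (T - 1) * n.
  rewrite (_ : b - a = (T - 1)%:C * (a - z)); last by rewrite /b rmorphB /=; ring.
  by rewrite nrmM nrm_real ger0_norm//; lra.
have := nrm_dist w b z; rewrite bz [nrm (b - w)]nrmBC; lra.
Qed.

Lemma disc_compact (z : C) (r : R) : compact (disc z r).
Proof.
apply: (@closed_bounded_compact _ _ (r + nrm z)).
  rewrite -[disc z r]setCK closedC; apply/openP => w; rewrite /disc /= => /negP; rewrite -ltNge => rw.
  exists (nrm (w - z) - r); first lra.
  by move=> v vw; apply/negP; rewrite -ltNge; have := nrm_dist v w z; rewrite [nrm (w - v)]nrmBC; lra.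
by move=> w; rewrite /disc /= => wr; have := nrmD (w - z) z; rewrite subrK; lra.
Qed.

Lemma approx_disc (f : C -> C) z (r eta : R) : 0 <= r -> 0 < eta ->
  (forall w, nrm (w - z) < r + eta -> cdiff f w) -> approximable (disc z r) f.
Proof.
move=> r0 eta0 fd; apply: runge; first exact: disc_compact.
  by move=> a; exact: disc_outer.
exists eta => // x w; rewrite /disc /= => xr wx; apply: fd.
by have := nrm_dist x w z; lra.
Qed.
End cauchy_estimates.

(** * Pade approximants *)

Section rational_functions.
Variable R : realType.
Local Notation C := R[i].
Local Notation tofrac := (@FracField.tofrac {poly C}).

Lemma frac_cross (r : {fraction {poly C}}) (A B : {poly C}) : B != 0 ->
  r = tofrac A / tofrac B ->
  (frac (repr r)).1 * B = A * (frac (repr r)).2.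
Proof.
move=> B0 rE; have B0' : tofrac B != 0 by rewrite tofrac_eq0.
have : r * tofrac B = tofrac A by rewrite rE divfK.
rewrite -{1}(reprK r); set x := repr r; rewrite !piE.
move/eqP; rewrite FracField.equivf_def /FracField.mulf !numden_Ratio ?oner_neq0 ?mulf_neq0 ?denom_ratioP ?oner_neq0//.
by move/eqP; rewrite !mulr1 => ->; rewrite mulrC.
Qed.

(** [A / B] and the reduced form agree by cross multiplication. A root of the reduced denominator at
    [z] would, as [B.[z] != 0], be a root of the reduced numerator, against coprimality. *)
Lemma reval_frac (A B : {poly C}) z : B.[z] != 0 ->
  ~~ pole (tofrac A / tofrac B) z /\
  reval (tofrac A / tofrac B) z = A.[z] / B.[z].
Proof.
move=> Bz; have B0 : B != 0 by apply: contraNneq Bz => ->; rewrite horner0.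
set r := _ / _; have := frac_cross B0 (erefl r).
rewrite /pole /reval /rnum /rden; set x := frac (repr r); set g := gcdp x.1 x.2.
have x20 : x.2 != 0 by exact: denom_ratioP.
have g0 : g != 0 by rewrite gcdp_eq0 (negbTE x20) andbF.
set n := x.1 %/ g; set d := x.2 %/ g.
have nE : x.1 = n * g by rewrite divpK// dvdp_gcdl.
have dE : x.2 = d * g by rewrite divpK// dvdp_gcdr.
rewrite nE dE mulrAC mulrA => /(mulIf g0) nB.
have cop : coprimep n d by apply: coprimep_div_gcd; rewrite x20 orbT.
have nBz : n.[z] * B.[z] = A.[z] * d.[z] by rewrite -!hornerM nB.
have dz : ~~ root d z.
  apply/negP => dz; have dz0 : d.[z] = 0 by apply/eqP.
  have nz : n.[z] != 0 by apply: coprimep_root dz; rewrite coprimep_sym.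
  by move: nBz; rewrite dz0 mulr0 => /eqP; rewrite mulf_eq0 (negbTE nz) (negbTE Bz).
by split=> //; apply/eqP; rewrite eqr_div// nBz.
Qed.

Definition pnorm (m : nat) (p : {poly C}) : R := \sum_(i < m) nrm p`_i.

Lemma pnorm_ge0 m p : 0 <= pnorm m p.
Proof. by apply: sumr_ge0 => i _; exact: nrm_ge0. Qed.

Lemma horner_pnorm m (p : {poly C}) w : (size p <= m)%N -> nrm w <= 1 -> nrm p.[w] <= pnorm m p.
Proof.
move=> pm w1; rewrite (horner_coef_wide _ pm); apply: (le_trans (nrm_sum _ _ _)).
apply: ler_sum => i _; rewrite nrmM nrmX ler_piMr ?nrm_ge0//.
by rewrite exprn_ile1 ?nrm_ge0.
Qed.

(* Remainders of the long division of [A] by [B] in increasing powers. *)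
Fixpoint series_rem (A B : {poly C}) (n : nat) : {poly C} :=
  if n is m.+1 then drop_poly 1 (series_rem A B m - (series_rem A B m)`_0 *: B) else A.

Definition series_quot A B n := (series_rem A B n)`_0.

Lemma series_remE (A B : {poly C}) n : B`_0 = 1 ->
  A = B * (\sum_(k < n) series_quot A B k *: 'X^k) + 'X^n * series_rem A B n.
Proof.
move=> B1; elim: n => [|n IH]; first by rewrite big_ord0 mulr0 add0r expr0 mul1r.
rewrite {1}IH big_ord_recr /=.
set p := series_rem A B n; set s := p - _.
have s0 : s`_0 = 0 by rewrite /s coefB coefZ B1 mulr1 subrr.
have sE : drop_poly 1 s * 'X = s.
  rewrite -[RHS](poly_take_drop 1) expr1 -[LHS]add0r; congr (_ + _).
  by apply/polyP => i; rewrite coef0 coef_take_poly; case: i => [|i]; rewrite ?s0.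
have pE : p = (p`_0)%:P * B + drop_poly 1 s * 'X by rewrite sE /s mul_polyC addrC subrK.
rewrite {1}pE /series_quot -/p -mul_polyC exprS; ring.
Qed.

Lemma series_rem_size (A B : {poly C}) m n : (size A <= m)%N -> (size B <= m)%N ->
  (size (series_rem A B n) <= m)%N.
Proof.
move=> Am Bm; elim: n => [//|n IH] /=; rewrite size_drop_poly.
apply: leq_trans (leq_subr _ _) _; apply: leq_trans (size_polyD _ _) _.
by rewrite geq_max IH size_polyN (leq_trans (size_scale_leq _ _)).
Qed.

Lemma series_rem_pnorm (A B : {poly C}) m n : (0 < m)%N -> (size A <= m)%N -> (size B <= m)%N ->
  pnorm m (series_rem A B n) <= (1 + pnorm m B) ^+ n * pnorm m A.
Proof.
move=> m0 Am Bm; elim: n => [|n IH]; first by rewrite expr0 mul1r.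
have B0 := pnorm_ge0 m B; have p0 := pnorm_ge0 m (series_rem A B n).
rewrite exprS -mulrA; apply: (@le_trans _ _ ((1 + pnorm m B) * pnorm m (series_rem A B n))).
  have sz := series_rem_size n Am Bm.
  rewrite /=; set p := series_rem A B n in sz p0 *; set s := p - _.
  have s_size : (size s <= m)%N.
    apply: leq_trans (size_polyD _ _) _.
    by rewrite geq_max sz size_polyN (leq_trans (size_scale_leq _ _)).
  apply: (@le_trans _ _ (pnorm m s)).
    rewrite /pnorm; under eq_bigr => i _ do rewrite coef_drop_poly addn1.
    have -> : \sum_(i < m) nrm s`_i.+1 = \sum_(i < m.+1) nrm s`_i - nrm s`_0.
      by rewrite big_ord_recl addrAC subrr add0r.
    rewrite big_ord_recr /= [s`_m]nth_default// nrm0 addr0.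
    by rewrite gerBl nrm_ge0.
  apply: (@le_trans _ _ (pnorm m p + nrm p`_0 * pnorm m B)).
    rewrite /pnorm mulr_sumr -big_split; apply: ler_sum => i _ /=.
    by rewrite coefB coefZ -nrmM; exact: nrmB.
  have : nrm p`_0 <= pnorm m p.
    rewrite /pnorm; case: (m) m0 => // m' _; rewrite big_ord_recl lerDl.
    by apply: sumr_ge0 => i _; exact: nrm_ge0.
  by move=> /(ler_wpM2r B0); lra.
by rewrite ler_pM2l//; lra.
Qed.

Lemma poly_near1 (B : {poly C}) : B.[0] = 1 ->
  exists2 d : R, 0 < d & forall w, nrm w < d -> 2^-1 <= nrm B.[w].
Proof.
move=> B1; pose m := size B; have Bn := pnorm_ge0 m (drop_poly 1 B).
exists (Num.min 1 (2^-1 / (pnorm m (drop_poly 1 B) + 1))).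
  by rewrite lt_min ltr01 divr_gt0//; lra.
move=> w; rewrite lt_min => /andP[w1]; rewrite ltr_pdivlMr => [wd|]; last lra.
have BE : B.[w] = 1 + (drop_poly 1 B).[w] * w.
  rewrite -{1}(poly_take_drop 1 B) hornerD hornerM hornerXn expr1; congr (_ + _).
  rewrite -B1 horner_coef0 (_ : take_poly 1 B = (B`_0)%:P) ?hornerC//.
  by apply/polyP => i; rewrite coef_take_poly coefC; case: i.
have h : nrm (drop_poly 1 B).[w] <= pnorm m (drop_poly 1 B).
  by apply: horner_pnorm; rewrite ?ltW// size_drop_poly leq_subr.
have := nrmB (1 + (drop_poly 1 B).[w] * w) ((drop_poly 1 B).[w] * w).
rewrite BE addrK nrm1 nrmM.
have := ler_wpM2r (nrm_ge0 w) h; have := nrm_ge0 w; lra.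
Qed.

(** After [n] terms of the long division the error is [w ^+ n] times the remainder over [B'.[w]].
    Remainders grow at most like [L ^+ n], so the error decays like [2^-1 ^+ n] for [|w|] below
    [L^-1 / 2]. *)
Lemma taylor_rational (A B : {poly C}) zeta : (shift_poly zeta B)`_0 = 1 ->
  taylor_expansion (fun z => A.[z] / B.[z]) zeta
    (series_quot (shift_poly zeta A) (shift_poly zeta B)).
Proof.
set A' := shift_poly zeta A; set B' := shift_poly zeta B => B1.
pose m := (maxn (size A') (size B')).+1.
have Am : (size A' <= m)%N by rewrite /m ltnW// ltnS leq_maxl.
have Bm : (size B' <= m)%N by rewrite /m ltnW// ltnS leq_maxr.
have [d d0 dP] : exists2 d : R, 0 < d & forall w, nrm w < d -> 2^-1 <= nrm B'.[w].
  by apply: poly_near1; rewrite horner_coef0.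
pose L := 1 + pnorm m B'; have L1 : 1 <= L by rewrite lerDl pnorm_ge0.
apply/nbhs_nrmP; exists (Num.min d (L^-1 / 2)).
  by rewrite lt_min d0 divr_gt0// invr_gt0; lra.
move=> z; rewrite lt_min => /andP[zd zL]; set w := z - zeta in zd zL *.
have zE : z = w + zeta by rewrite subrK.
have Bw := dP w zd; have Bw0 : B'.[w] != 0 by rewrite -nrm_gt0; lra.
have fz : A.[z] / B.[z] = A'.[w] / B'.[w] by rewrite !horner_shift -zE.
rewrite fz; apply/(@cvgrPdist_le _ _ _ _ _ _ _) => e' /pos_complex[e e0 ->].
have A0 := pnorm_ge0 m A'.
have e1 : 0 < e / (2 * (pnorm m A' + 1)) by rewrite divr_gt0//; lra.
have r01 : 0 <= (2^-1 : R) < 1 by rewrite invr_ge0 ler0n invf_lt1// ltr1n.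
have [N NP] := geometric_lt r01 e1.
exists N => // n /= Nn; rewrite normE lecR /series /= big_mkord.
have /(congr1 (horner^~ w)) := series_remE A' n B1.
rewrite hornerD !hornerM horner_sum hornerXn.
under eq_bigr => k _ do rewrite hornerZ hornerXn.
set S := \sum_(k < n) _ => ->.
have -> : (B'.[w] * S + w ^+ n * (series_rem A' B' n).[w]) / B'.[w] - S =
   w ^+ n * (series_rem A' B' n).[w] / B'.[w] by field.
rewrite nrm_div nrmM nrmX ler_pdivrMr; last by rewrite nrm_gt0.
have wL : nrm w * L <= 2^-1.
  have L0 : 0 < L by lra.
  have -> : 2^-1 = L^-1 / 2 * L by field; rewrite gt_eqF.
  by apply: ler_wpM2r; [lra | exact: ltW].
have h1 : nrm (series_rem A' B' n).[w] <= L ^+ n * pnorm m A'.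
  apply: le_trans (series_rem_pnorm n _ Am Bm) => //.
  apply: horner_pnorm; first exact: series_rem_size.
  have := ler_wpM2l (nrm_ge0 w) L1; rewrite mulr1; lra.
have wn := exprn_ge0 n (nrm_ge0 w).
apply: (le_trans (ler_wpM2l wn h1)); rewrite mulrA -exprMn.
have h2 : (nrm w * L) ^+ n <= 2^-1 ^+ N.
  apply: (@le_trans _ _ (2^-1 ^+ n)).
    by rewrite lerXn2r ?nnegrE ?invr_ge0// mulr_ge0 ?nrm_ge0//; lra.
  by case/andP: r01 => r0 r1; apply: ler_wiXn2l => //; exact: ltW.
move: NP; rewrite ltr_pdivlMr; last lra.
have := ler_wpM2r A0 h2; have := ler_wpM2l (ltW e0) Bw.
have : 0 <= (2^-1 : R) ^+ N by rewrite exprn_ge0.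
lra.
Qed.

Lemma coef_unique (B D J : {poly C}) n : B`_0 = 1 -> B * D = 'X^n * J ->
  forall k, (k < n)%N -> D`_k = 0.
Proof.
move=> B1 BD k kn.
have cop : coprimep ('X^n) B.
  by rewrite coprimep_expl// coprimep_sym coprimepX rootE horner_coef0 B1 oner_neq0.
have : 'X^n %| B * D by rewrite BD dvdp_mulr.
rewrite Gauss_dvdpr// => /dvdpP[u ->]; by rewrite coefMXn kn.
Qed.

(** The linearised condition can be divided by [B], whose constant coefficient is 1. Here [A] and
    [B] are written in powers of [z - zeta], whence the shift by [- zeta]. *)
Lemma is_pade_intro (f : C -> C) zeta p q (a : C^nat) (A B J : {poly C}) :
  taylor_expansion f zeta a -> (size A <= p.+1)%N -> (size B <= q.+1)%N -> B`_0 = 1 ->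
  B * (\sum_(k < (p + q).+1) a k *: 'X^k) = A + 'X^((p + q).+1) * J ->
  is_pade f zeta p q
    (tofrac (shift_poly (- zeta) A) / tofrac (shift_poly (- zeta) B)).
Proof.
move=> fa sA sB B1 BT.
have sz (P : {poly C}) : size (shift_poly (- zeta) P) = size P.
  by rewrite /shift_poly size_comp_poly2// size_XaddC.
exists (shift_poly (- zeta) A), (shift_poly (- zeta) B); split; rewrite ?sz//.
  by rewrite horner_shift subrr horner_coef0.
exists a, (series_quot A B); split; first exact: fa.
  have := @taylor_rational (shift_poly (- zeta) A) (shift_poly (- zeta) B) zeta.
  by rewrite !shift_polyK; apply.
move=> v vpq; apply/eqP; rewrite -subr_eq0; apply/eqP.
pose n := (p + q).+1.
have vn : (v < n)%N by [].
have AE : B * (\sum_(k < n) series_quot A B k *: 'X^k) = A - 'X^n * series_rem A B n.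
  by rewrite [X in _ = X - _](series_remE A n B1) addrK.
have := @coef_unique B (\sum_(k < n) series_quot A B k *: 'X^k - \sum_(k < n) a k *: 'X^k)
  (- (series_rem A B n + J)) n B1 _ v vn.
rewrite coefB !coef_sum => H.
have pick (c : nat -> C) : \sum_(k < n) (c k *: 'X^k)`_v = c v.
  rewrite (bigD1 (Ordinal vn)) //= coefZ coefXn eqxx mulr1 big1 ?addr0// => i iv.
  rewrite coefZ coefXn (_ : (v == i) = false) ?mulr0//; apply/negbTE.
  by apply: contra iv => /eqP vi; apply/eqP/val_inj.
move: H; rewrite !pick; apply.
by rewrite mulrBr BT AE; ring.
Qed.
End rational_functions.

(** * Stability of Pade approximants under perturbation *)

Section pade_stability.
Variable R : realType.
Local Notation C := R[i].

Definition seq_cont (n : nat) (a0 : C^nat) (F : C^nat -> C) :=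
  forall e : R, 0 < e -> exists2 d : R, 0 < d &
    forall a : C^nat, (forall k, (k <= n)%N -> nrm (a k - a0 k) <= d) -> nrm (F a - F a0) <= e.

Lemma seq_cont_cst n a0 c : seq_cont n a0 (fun _ => c).
Proof. by move=> e e0; exists 1 => // a _; rewrite subrr nrm0 ltW. Qed.

Lemma seq_cont_proj n a0 k : (k <= n)%N -> seq_cont n a0 (fun a => a k).
Proof. by move=> kn e e0; exists e => // a; exact. Qed.

Lemma seq_contD n a0 F G : seq_cont n a0 F -> seq_cont n a0 G ->
  seq_cont n a0 (fun a => F a + G a).
Proof.
move=> cF cG e e0; have e2 : 0 < e / 2 by lra.
have [d d0 dP] := cF _ e2; have [d' d0' dP'] := cG _ e2.
exists (Num.min d d') => [|a ad]; first by rewrite lt_min d0.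
rewrite opprD addrACA; apply: (le_trans (nrmD _ _)); rewrite [e]splitr; apply: lerD.
  by apply: dP => k /ad; rewrite le_min => /andP[].
by apply: dP' => k /ad; rewrite le_min => /andP[].
Qed.

Lemma seq_contM n a0 F G : seq_cont n a0 F -> seq_cont n a0 G ->
  seq_cont n a0 (fun a => F a * G a).
Proof.
move=> cF cG e e0; pose f := nrm (F a0); pose g := nrm (G a0).
have f0 : 0 <= f by exact: nrm_ge0.
have g0 : 0 <= g by exact: nrm_ge0.
have e1 : 0 < Num.min 1 (e / (f + g + 1)) by rewrite lt_min ltr01 divr_gt0//; lra.
have [d d0 dP] := cF _ e1; have [d' d0' dP'] := cG _ e1.
exists (Num.min d d') => [|a ad]; first by rewrite lt_min d0.
have := dP a (fun k kn => le_trans (ad k kn) _); rewrite ge_min lexx => /(_ isT).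
have := dP' a (fun k kn => le_trans (ad k kn) _); rewrite ge_min lexx orbT => /(_ isT).
rewrite !le_min => /andP[G1 G2] /andP[F1 F2].
have -> : F a * G a - F a0 * G a0 =
  (F a - F a0) * (G a - G a0) + F a0 * (G a - G a0) + (F a - F a0) * G a0 by ring.
apply: (le_trans (nrmD _ _)); apply: (le_trans (lerD (nrmD _ _) (lexx _))).
rewrite !nrmM -/f -/g; set t := e / _ in F2 G2.
have tE : t * (f + g + 1) = e by rewrite /t divfK// gt_eqF//; lra.
have := ler_pM (nrm_ge0 _) (nrm_ge0 _) F1 G2; have := ler_wpM2l f0 G2.
have := ler_wpM2r g0 F2; lra.
Qed.

Lemma seq_contV n a0 F : F a0 != 0 -> seq_cont n a0 F -> seq_cont n a0 (fun a => (F a)^-1).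
Proof.
move=> F0 cF e e0; pose f := nrm (F a0); have f0 : 0 < f by rewrite nrm_gt0.
have e1 : 0 < Num.min (f / 2) (e * f ^+ 2 / 2).
  by rewrite lt_min !divr_gt0// mulr_gt0// exprn_gt0.
have [d d0 dP] := cF _ e1; exists d => // a /dP; rewrite le_min => /andP[h1 h2].
have h3 : f / 2 <= nrm (F a).
  by have := nrm_dist (F a) (F a0) 0; rewrite !subr0 [nrm (F a0 - _)]nrmBC -/f; lra.
have Fa : F a != 0 by rewrite -nrm_gt0; lra.
have -> : (F a)^-1 - (F a0)^-1 = - (F a - F a0) / (F a * F a0) by field; rewrite Fa F0.
rewrite nrm_div nrmN nrmM -/f ler_pdivrMr; last by rewrite mulr_gt0// nrm_gt0.
apply: (le_trans h2); have -> : e * f ^+ 2 / 2 = e * (f / 2 * f) by ring.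
by rewrite ler_pM2l// ler_pM2r.
Qed.

Lemma seq_cont_sum n a0 (I : Type) (r : seq I) (P : pred I) (F : I -> C^nat -> C) :
  (forall i, seq_cont n a0 (F i)) -> seq_cont n a0 (fun a => \sum_(i <- r | P i) F i a).
Proof.
move=> cF; elim: r => [|i r IH].
  by move=> e e0; exists 1 => // a _; rewrite !big_nil subrr nrm0 ltW.
case Pi : (P i); last by move=> e /IH[d d0 dP]; exists d => // a /dP; rewrite !big_cons Pi.
by move=> e /(seq_contD (cF i) IH)[d d0 dP]; exists d => // a /dP; rewrite !big_cons Pi.
Qed.

Lemma seq_cont_prod n a0 (I : Type) (r : seq I) (P : pred I) (F : I -> C^nat -> C) :
  (forall i, seq_cont n a0 (F i)) -> seq_cont n a0 (fun a => \prod_(i <- r | P i) F i a).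
Proof.
move=> cF; elim: r => [|i r IH].
  by move=> e e0; exists 1 => // a _; rewrite !big_nil subrr nrm0 ltW.
case Pi : (P i); last by move=> e /IH[d d0 dP]; exists d => // a /dP; rewrite !big_cons Pi.
by move=> e /(seq_contM (cF i) IH)[d d0 dP]; exists d => // a /dP; rewrite !big_cons Pi.
Qed.

Lemma seq_cont_det n a0 m (A : C^nat -> 'M[C]_m) :
  (forall i j, seq_cont n a0 (fun a => A a i j)) -> seq_cont n a0 (fun a => \det (A a)).
Proof.
move=> cA; apply: seq_cont_sum => s; apply: seq_contM; first exact: seq_cont_cst.
by apply: seq_cont_prod => i; exact: cA.
Qed.

Lemma seq_cont_adj n a0 m (A : C^nat -> 'M[C]_m) i j :
  (forall i j, seq_cont n a0 (fun a => A a i j)) -> seq_cont n a0 (fun a => (\adj (A a)) i j).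
Proof.
move=> cA; have cof : seq_cont n a0 (fun a => (-1) ^+ (j + i) * \det (row' j (col' i (A a)))).
  apply: seq_contM; first exact: seq_cont_cst.
  apply: seq_cont_det => k l e' e0'; have [d d0 dP] := cA (lift j k) (lift i l) e' e0'.
  by exists d => // a /dP; rewrite !mxE.
by move=> e /cof[d d0 dP]; exists d => // a /dP; rewrite !mxE.
Qed.

Variables (p q : nat).
Local Notation n := (p + q).+1.

Definition trunc (a : C^nat) : {poly C} := \sum_(k < n) a k *: 'X^k.

Lemma coef_trunc a m : (trunc a)`_m = if (m < n)%N then a m else 0.
Proof.
rewrite /trunc coef_sum; case: ltnP => mn.
  rewrite (bigD1 (Ordinal mn)) //= coefZ coefXn eqxx mulr1 big1 ?addr0// => i im.
  rewrite coefZ coefXn (_ : (m == i) = false) ?mulr0//; apply/negbTE.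
  by apply: contra im => /eqP mi; apply/eqP/val_inj.
rewrite big1// => i _; rewrite coefZ coefXn (_ : (m == i) = false) ?mulr0//.
by apply/negbTE; rewrite neq_ltn (leq_trans (ltn_ord i) mn) orbT.
Qed.

Definition den (x : 'cV[C]_q) : {poly C} := 1 + \sum_(j < q) x j 0 *: 'X^(j.+1).

(** The Toeplitz system of the denominator: the unknown [j] is the coefficient of ['X^(j.+1)], and
    row [i] kills the coefficient of ['X^((p + i).+1)] in the product. The test guards the truncated
    subtraction, coefficients of negative index being 0. *)
Definition pade_mx (a : C^nat) : 'M[C]_q :=
  \matrix_(i, j) (if (j <= p + i)%N then a (p + i - j)%N else 0).
Definition pade_vec (a : C^nat) : 'cV[C]_q := \col_i - a (p + i).+1.
(** Cramer's rule, which shows the solution to be continuous in [a] wherever the determinant does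
    not vanish. *)
Definition pade_sol (a : C^nat) : 'cV[C]_q :=
  (\det (pade_mx a))^-1 *: (\adj (pade_mx a) *m pade_vec a).

Lemma pade_solP a : \det (pade_mx a) != 0 -> pade_mx a *m pade_sol a = pade_vec a.
Proof.
by move=> d0; rewrite -scalemxAr mulmxA mul_mx_adj mul_scalar_mx scalerA mulVf// scale1r.
Qed.

Lemma coef_sumXM (x : 'cV[C]_q) (T : {poly C}) m :
  ((\sum_(j < q) x j 0 *: 'X^(j.+1)) * T)`_m =
  \sum_(j < q) x j 0 * (if (m < j.+1)%N then 0 else T`_(m - j.+1)).
Proof.
rewrite mulr_suml coef_sum; apply: eq_bigr => j _.
by rewrite -scalerAl coefZ coefXnM.
Qed.

Lemma pade_mxP a (x : 'cV[C]_q) (i : 'I_q) :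
  ((\sum_(j < q) x j 0 *: 'X^(j.+1)) * trunc a)`_(p + i).+1 = (pade_mx a *m x) i 0.
Proof.
rewrite coef_sumXM mxE; apply: eq_bigr => j _; rewrite mxE mulrC; congr (_ * _).
have iq := ltn_ord i; rewrite ltnS ltnNge; have [ji|//] := leqP j (p + i)%N.
have h : (p + i - j < n)%N by lia.
by rewrite /= subSS coef_trunc h.
Qed.

Lemma den_trunc_coef a (x : 'cV[C]_q) (i : 'I_q) :
  (den x * trunc a)`_(p + i).+1 = (pade_mx a *m x - pade_vec a) i 0.
Proof.
rewrite /den mulrDl mul1r coefD pade_mxP coef_trunc ifT; last by have := ltn_ord i; lia.
by move: (pade_mx a *m x) => y; rewrite !mxE opprK addrC.
Qed.

Lemma split_gap (P : {poly C}) : (forall i : 'I_q, P`_(p + i).+1 = 0) ->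
  P = take_poly p.+1 P + 'X^n * drop_poly n P.
Proof.
move=> P0; apply/polyP => m; rewrite coefD coef_take_poly coefXnM coef_drop_poly.
case: ltnP => [mp|pm].
  by rewrite ifT ?addr0//; lia.
rewrite add0r; case: ltnP => [mn|nm]; last by rewrite subnK.
have mq : (m - p.+1 < q)%N by lia.
by have := P0 (Ordinal mq); rewrite /= -addSn subnKC.
Qed.

Lemma den0 x : (den x)`_0 = 1.
Proof.
by rewrite coefD coef1 coef_sum big1 ?addr0// => j _; rewrite coefZ coefXn mulr0.
Qed.

Lemma size_den x : (size (den x) <= q.+1)%N.
Proof.
apply: leq_trans (size_polyD _ _) _; rewrite geq_max size_poly1 /=.
apply: leq_trans (size_sum _ _ _) _; apply/bigmax_leqP => j _.
by apply: leq_trans (size_scale_leq _ _) _; rewrite size_polyXn ltnS.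
Qed.

(* If A0/B0 is in lowest terms and has full denominator degree, the linear
   system for the denominator is regular: a kernel vector gives B1 with
   A0 B1 = A1 B0, so B0 divides B1, whose constant coefficient is 0. *)
Lemma pade_det_neq0 a (A0 B0 J : {poly C}) :
  (size A0 <= p.+1)%N -> size B0 = q.+1 -> B0`_0 = 1 -> coprimep A0 B0 ->
  B0 * trunc a = A0 + 'X^n * J -> \det (pade_mx a) != 0.
Proof.
move=> sA sB B1 cop BT; rewrite -det_tr; apply/det0P => -[v v0 vM].
pose x := v^T; have Mx : pade_mx a *m x = 0.
  by rewrite -[LHS]trmxK trmx_mul /x trmxK vM trmx0.
pose D := \sum_(j < q) x j 0 *: 'X^(j.+1).
have sD : (size D <= q.+1)%N.
  apply: leq_trans (size_sum _ _ _) _; apply/bigmax_leqP => j _.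
  by apply: leq_trans (size_scale_leq _ _) _; rewrite size_polyXn ltnS.
have D0 : D`_0 = 0.
  by rewrite coef_sum big1// => j _; rewrite coefZ coefXn mulr0.
have DT : D * trunc a = take_poly p.+1 (D * trunc a) + 'X^n * drop_poly n (D * trunc a).
  by apply: split_gap => i; rewrite pade_mxP Mx mxE.
set A1 := take_poly p.+1 _ in DT; set J1 := drop_poly n _ in DT.
have sA1 : (size A1 <= p.+1)%N by exact: size_take_poly.
have cross : A0 * D = A1 * B0.
  (* A multiple of ['X^n] of degree at most [p + q < n] is 0. *)
  have E : A0 * D - A1 * B0 = 'X^n * (J1 * B0 - J * D).
    have -> : A0 = B0 * trunc a - 'X^n * J by rewrite BT addrK.
    have -> : A1 = D * trunc a - 'X^n * J1 by rewrite {1}DT addrK.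
    ring.
  have sE : (size (A0 * D - A1 * B0)%R <= n)%N.
    apply: leq_trans (size_polyD _ _) _; rewrite size_polyN geq_max.
    have pq : (p.+1 + q.+1 = n.+1)%N by rewrite addSn addnS.
    apply/andP; split; apply: leq_trans (size_polyMleq _ _) _; rewrite -subn1 leq_subLR add1n -pq.
      exact: leq_add.
    by rewrite sB leq_add2r.
  apply/eqP; rewrite -subr_eq0; apply/eqP/polyP => m; rewrite coef0.
  have [mn|nm] := ltnP m n; first by rewrite E coefXnM mn.
  by rewrite nth_default// (leq_trans sE).
have : B0 %| A0 * D by rewrite cross dvdp_mull.
rewrite Gauss_dvdpr 1?coprimep_sym// => /dvdpP[u uE].
have B0n : B0 != 0 by rewrite -size_poly_eq0 sB.
have u0 : u`_0 = 0.
  by move: D0; rewrite uE coef0M B1 mulr1.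
have D00 : D = 0.
  have [u00|un] := eqVneq u 0; first by rewrite uE u00 mul0r.
  have su : (size u <= 1)%N.
    by move: sD; rewrite uE size_mul// sB addnS /= -(add1n q) leq_add2r.
  by rewrite uE (size1_polyC su) u0 polyC0 mul0r.
move/negP: v0; apply; apply/eqP/rowP => j; rewrite mxE.
have := congr1 (fun P : {poly C} => P`_j.+1) D00; rewrite coef0 => <-.
rewrite /D coef_sum (bigD1 j) //= coefZ coefXn eqxx mulr1 big1 ?addr0 ?mxE// => i ij.
rewrite coefZ coefXn eqSS (_ : (nat_of_ord j == i) = false) ?mulr0//; apply/negbTE.
by apply: contra ij => /eqP ji; apply/eqP/val_inj.
Qed.

Lemma den_sol a (A0 B0 J : {poly C}) :
  (size A0 <= p.+1)%N -> size B0 = q.+1 -> B0`_0 = 1 ->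
  B0 * trunc a = A0 + 'X^n * J -> \det (pade_mx a) != 0 -> den (pade_sol a) = B0.
Proof.
move=> sA sB B1 BT det0; pose x : 'cV[C]_q := \col_j B0`_j.+1.
have Bx : den x = B0.
  rewrite /den; apply/polyP => -[|m].
    by rewrite coefD coef1 coef_sum big1 ?addr0 ?B1// => j _; rewrite coefZ coefXn mulr0.
  rewrite coefD coef1 add0r coef_sum; have [mq|qm] := ltnP m q.
    rewrite (bigD1 (Ordinal mq)) //= coefZ coefXn eqxx mulr1 big1 ?addr0 ?mxE// => i im.
    rewrite coefZ coefXn eqSS (_ : (m == i) = false) ?mulr0//; apply/negbTE.
    by apply: contra im => /eqP mi; apply/eqP/val_inj.
  rewrite nth_default ?sB// big1// => i _; rewrite coefZ coefXn eqSS.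
  rewrite (_ : (m == i) = false) ?mulr0//.
  by apply/negbTE; rewrite neq_ltn (leq_trans (ltn_ord i) qm) orbT.
have Mx : pade_mx a *m x = pade_vec a.
  apply/colP => i; apply/eqP; rewrite -subr_eq0; apply/eqP.
  have subE (y z : 'cV[C]_q) : y i 0 - z i 0 = (y - z) i 0 by rewrite !mxE.
  rewrite subE -den_trunc_coef Bx BT.
  rewrite coefD coefXnM ifT; last by have := ltn_ord i; lia.
  by rewrite addr0 nth_default//; apply: leq_trans sA _; rewrite ltnS leq_addr.
have uM : pade_mx a \in unitmx by rewrite unitmxE unitfE.
by rewrite -Bx; congr den; rewrite -[LHS](mulKmx uM) pade_solP// -Mx mulKmx.
Qed.

(** The determinant is nonzero at [a0] by [pade_det_neq0], hence nearby. All coefficients produced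
    by Cramer's rule are then continuous at [a0], where [den_sol] identifies them with those of [A0]
    and [B0]. *)
Theorem pade_stable (a0 : C^nat) (A0 B0 J : {poly C}) :
  (size A0 <= p.+1)%N -> size B0 = q.+1 -> B0`_0 = 1 -> coprimep A0 B0 ->
  B0 * trunc a0 = A0 + 'X^n * J ->
  forall e : R, 0 < e -> exists2 d : R, 0 < d &
    forall a : C^nat, (forall k, (k <= p + q)%N -> nrm (a k - a0 k) <= d) ->
    exists A B J' : {poly C}, [/\ (size A <= p.+1)%N, (size B <= q.+1)%N, B`_0 = 1,
      B * trunc a = A + 'X^n * J' &
      forall m, nrm (A`_m - A0`_m) <= e /\ nrm (B`_m - B0`_m) <= e].
Proof.
move=> sA sB B1 cop BT e e0.
have det0 := pade_det_neq0 sA sB B1 cop BT.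
have cM i j : seq_cont (p + q) a0 (fun a => pade_mx a i j).
  have [ji|ij] := leqP j (p + i)%N.
    have h : (p + i - j <= p + q)%N by have := ltn_ord i; lia.
    move=> e' /(seq_cont_proj a0 h)[d d0 dP]; exists d => // a /dP.
    by rewrite !mxE ji.
  by move=> e' e'0; exists 1 => // a _; rewrite !mxE leqNgt ij /= subrr nrm0 ltW.
have cdet := seq_cont_det cM.
have csol j : seq_cont (p + q) a0 (fun a => pade_sol a j 0).
  have c : seq_cont (p + q) a0 (fun a => (\det (pade_mx a))^-1 *
      \sum_(i < q) (\adj (pade_mx a)) j i * (-1 * a (p + i).+1)).
    apply: seq_contM; first exact: seq_contV.
    apply: seq_cont_sum => i; apply: seq_contM; first exact: seq_cont_adj.
    apply: seq_contM; first exact: seq_cont_cst.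
    by apply: seq_cont_proj; have := ltn_ord i; lia.
  have E a : pade_sol a j 0 = (\det (pade_mx a))^-1 *
      \sum_(i < q) (\adj (pade_mx a)) j i * (-1 * a (p + i).+1).
    rewrite [LHS]mxE; congr (_ * _); rewrite [LHS]mxE; apply: eq_bigr => i _; congr (_ * _).
    by rewrite mxE mulN1r.
  by move=> e' /c[d d0 dP]; exists d => // a ad; rewrite (E a) (E a0); exact: dP.
have cT m : seq_cont (p + q) a0 (fun a => (trunc a)`_m).
  have [mn|nm] := ltnP m n.
    have h : (m <= p + q)%N by [].
    by move=> e' /(seq_cont_proj a0 h)[d d0 dP]; exists d => // a /dP; rewrite !coef_trunc mn.
  by move=> e' e'0; exists 1 => // a _; rewrite !coef_trunc ltnNge nm /= subrr nrm0 ltW.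
have cden m : seq_cont (p + q) a0 (fun a => (den (pade_sol a))`_m).
  have c : seq_cont (p + q) a0 (fun a => (m == 0)%:R + \sum_(j < q) pade_sol a j 0 * (m == j.+1)%:R).
    apply: seq_contD; first exact: seq_cont_cst.
    by apply: seq_cont_sum => j; apply: seq_contM; [exact: csol | exact: seq_cont_cst].
  have E a : (den (pade_sol a))`_m = (m == 0)%:R + \sum_(j < q) pade_sol a j 0 * (m == j.+1)%:R.
    rewrite /den coefD coef1 coef_sum; congr (_ + _); apply: eq_bigr => j _.
    by rewrite coefZ coefXn.
  by move=> e' /c[d d0 dP]; exists d => // a ad; rewrite (E a) (E a0); exact: dP.
have cnum m : seq_cont (p + q) a0 (fun a => (den (pade_sol a) * trunc a)`_m).
  have c : seq_cont (p + q) a0 (fun a => \sum_(j < m.+1) (den (pade_sol a))`_j * (trunc a)`_(m - j)).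
    by apply: seq_cont_sum => j; apply: seq_contM.
  have E a : (den (pade_sol a) * trunc a)`_m =
      \sum_(j < m.+1) (den (pade_sol a))`_j * (trunc a)`_(m - j) by exact: coefM.
  by move=> e' /c[d d0 dP]; exists d => // a ad; rewrite (E a) (E a0); exact: dP.
have unif (F : nat -> C^nat -> C) N : (forall m, seq_cont (p + q) a0 (F m)) ->
    exists2 d : R, 0 < d & forall a : C^nat,
      (forall k, (k <= p + q)%N -> nrm (a k - a0 k) <= d) ->
      forall m, (m < N)%N -> nrm (F m a - F m a0) <= e.
  move=> cF; elim: N => [|N [d d0 dP]]; first by exists 1.
  have [d' d0' dP'] := cF N e e0; exists (Num.min d d') => [|a ad m]; first by rewrite lt_min d0.
  rewrite ltnS leq_eqVlt => /orP[/eqP->|mN].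
    by apply: dP' => k /ad; rewrite le_min => /andP[].
  by apply: dP => // k /ad; rewrite le_min => /andP[].
have [d1 d10 D1] := unif _ p.+1 cnum; have [d2 d20 D2] := unif _ q.+1 cden.
have ndet : 0 < nrm (\det (pade_mx a0)) / 2 by rewrite divr_gt0// nrm_gt0.
have [d3 d30 D3] := cdet _ ndet.
exists (Num.min d1 (Num.min d2 d3)) => [|a ad]; first by rewrite !lt_min d10 d20.
have near d' : Num.min d1 (Num.min d2 d3) <= d' ->
    forall k, (k <= p + q)%N -> nrm (a k - a0 k) <= d'.
  by move=> h k kp; exact: le_trans (ad k kp) h.
have {}D1 := D1 a (near d1 ltac:(by rewrite ge_min lexx)).
have {}D2 := D2 a (near d2 ltac:(by rewrite !ge_min lexx orbT)).
have {}D3 := D3 a (near d3 ltac:(by rewrite !ge_min lexx !orbT)).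
have deta : \det (pade_mx a) != 0.
  rewrite -nrm_gt0; have := nrm_dist (\det (pade_mx a)) (\det (pade_mx a0)) 0.
  by rewrite !subr0 nrmBC; lra.
have dsol0 := den_sol sA sB B1 BT det0.
exists (take_poly p.+1 (den (pade_sol a) * trunc a)), (den (pade_sol a)),
  (drop_poly n (den (pade_sol a) * trunc a)); split.
- exact: size_take_poly.
- exact: size_den.
- exact: den0.
- by apply: split_gap => i; rewrite den_trunc_coef pade_solP// subrr mxE.
move=> m; split.
  rewrite coef_take_poly; case: ltnP => mp.
    have := D1 m mp; rewrite dsol0 BT coefD coefXnM ifT ?addr0//; lia.
  by rewrite nth_default ?(leq_trans sA)// subr0 nrm0 ltW.
have [mq|qm] := ltnP m q.+1; first by have := D2 m mq; rewrite dsol0.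
by rewrite !nth_default ?subr0 ?nrm0 ?ltW ?sB//; exact: leq_trans (size_den _) qm.
Qed.
End pade_stability.

(** * The space of holomorphic functions *)

Section holo_space.
Variable R : realType.
Local Notation C := R[i].

Lemma entourage_nrm (E : set (C * C)) : entourage E ->
  exists2 e : R, 0 < e & forall x y, nrm (y - x) < e -> E (x, y).
Proof.
rewrite -entourage_ballE => -[e' /= /pos_complex[e e0 ->] EE]; exists e => // x y xy.
by apply: EE => /=; rewrite -ball_normE /= normE ltcR nrmBC.
Qed.

Lemma nrm_entourage (e : R) : 0 < e -> entourage [set xy : C * C | nrm (xy.2 - xy.1) < e].
Proof.
move=> e0; rewrite -entourage_ballE; exists e%:C; first by rewrite /= ltcR.
by move=> [x y] /=; rewrite -ball_normE /= normE ltcR nrmBC.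
Qed.

(** The filter generated by the sets of functions close to [f] on one compact set converges to [f]
    in the family topology, so every neighbourhood belongs to it. *)
Lemma family_nbhs (D : set C) (f : {family compactly_in D, C -> C})
    (W : set {family compactly_in D, C -> C}) : nbhs f W ->
  exists L (e : R), [/\ compact L, L `<=` D, 0 < e &
    forall g : C -> C, (forall z, L z -> nrm (g z - f z) < e) -> W g].
Proof.
move=> fW.
pose G := filter_from [set Le : set C * R | [/\ compact Le.1, Le.1 `<=` D & 0 < Le.2]]
  (fun Le => [set g : C -> C | forall z, Le.1 z -> nrm (g z - f z) < Le.2]).
have FG : Filter G.
  apply: filter_from_filter.
    by exists (set0, 1); split=> //=; exact: compact0.
  move=> [L1 e1] [L2 e2] [/= c1 s1 p1] [/= c2 s2 p2].
  exists (L1 `|` L2, Num.min e1 e2); first split=> /=.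
  - exact: compactU.
  - by move=> z [/s1|/s2].
  - by rewrite lt_min p1.
  - move=> g /= gP; split=> z Lz.
      by have := gP z (or_introl Lz); rewrite lt_min => /andP[].
    by have := gP z (or_intror Lz); rewrite lt_min => /andP[].
have : {family compactly_in D, G --> (f : C -> C)}.
  apply/fam_cvgP => A [AD cA] P /uniform_nbhs[E [entE EP]].
  have [e e0 eE] := entourage_nrm entE.
  exists (A, e); first by split.
  by move=> g gP; apply: EP => z Az; apply: eE; exact: gP.
move=> /(_ W fW)[[L e] [/= cL LD e0] LW].
by exists L, e; split.
Qed.

Lemma holo_nbhsP (D : set C) (f : holo D) (V : set (holo D)) : nbhs f V <->
  exists L (e : R), [/\ compact L, L `<=` D, 0 < e &
    forall g : holo D, (forall z, L z -> nrm (holo_fun g z - holo_fun f z) < e) -> V g].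
Proof.
split.
  case=> _ /= [] [W oW <- /=] Wf WV.
  have [|L [e [cL LD e0 LW]]] := @family_nbhs D (\val f) W.
    exact: open_nbhs_nbhs.
  by exists L, e; split=> // g gf; apply: WV; exact: LW.
move=> [L [e [cL LD e0 LV]]].
have nb := @fam_nbhs _ _ (compactly_in D) L [set xy : C * C | nrm (xy.2 - xy.1) < e]
  (\val f) (nrm_entourage e0) (conj LD cL).
move: nb; rewrite nbhsE => -[W [oW Wf] WL].
exists (\val @^-1` W); last by move=> g Wg; apply: LV => z Lz; exact: WL _ Wg z Lz.
by split; [exists W | exact: Wf].
Qed.

Lemma holo_cdiff (D : set C) (f : holo D) z : D z -> cdiff (holo_fun f) z.
Proof.
move=> Dz; apply/cdiffP; have /set_mem[fd _] : \val f \in @holomorphic_on R D := valP f.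
exact: fd.
Qed.

Lemma holo_make (D : set C) (f : C -> C) : open D -> (forall z, D z -> cdiff f z) ->
  exists g : holo D, forall z, D z -> holo_fun g z = f z.
Proof.
move=> oD fd; pose g := (fun z => if `[< D z >] then f z else 0) : {family compactly_in D, C -> C}.
have gH : @holomorphic_on R D g.
  split=> z Dz; last by rewrite /g asboolF.
  apply/cdiffP; have [r r0 rD] := (openP D).1 oD z Dz.
  by apply: cdiff_ext r0 _ (fd z Dz) => w /rD Dw; rewrite /g asboolT.
exists (SigSub (mem_set gH) : holo D) => z Dz.
by rewrite /holo_fun /= /g asboolT.
Qed.
End holo_space.

(** * Countable families of targets and compact sets, joint approximation *)

Section approximation_families.
Variable R : realType.
Local Notation C := R[i].

Lemma outer_near (X : set C) (c b : C) (r : R) : 0 < r ->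
  (forall x, X x -> r <= nrm (x - c)) -> nrm (b - c) < r / 4 -> outer X c <-> outer X b.
Proof.
move=> r0 h bc; have r4 : 0 < r / 4 by lra.
split=> o; apply: (outer_step r4 o) => x Xx; have := h x Xx.
  by rewrite [nrm (c - b)]nrmBC; lra.
by have := nrm_dist b x c; lra.
Qed.

Lemma connected_outer (D X : set C) z : open D -> connected D -> compact X ->
  D `&` X = set0 -> D z -> outer X z -> forall w, D w -> outer X w.
Proof.
move=> oD cD cX DX Dz oz; apply: connected_induction => //; first by exists z.
move=> w Dw; have nXw : ~ X w by move=> Xw; have : (D `&` X) w by []; rewrite DX.
have [r r0 rP] := compact_dist cX nXw.
by exists (r / 4) => [|v]; [lra | exact: outer_near rP].
Qed.

Definition rat_point (x : rat * rat) : C := Complex (ratr x.1) (ratr x.2).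

Lemma rat_point_dense (z : C) (e : R) : 0 < e -> exists x, nrm (z - rat_point x) < e.
Proof.
move=> e0; have e2 : 0 < e / 2 by lra.
have rd (t : R) : exists q : rat, `|t - ratr q| < e / 2.
  have [|q] := @rat_in_itvoo R (t - e / 2) (t + e / 2); first lra.
  by rewrite in_itv /= => /andP[q1 q2]; exists q; rewrite ltr_norml; lra.
have [a aP] := rd (complex.Re z); have [b bP] := rd (complex.Im z); exists (a, b).
apply: (le_lt_trans (nrm_ReIm _)); rewrite ReD ImD ReN ImN /=; lra.
Qed.

Definition rat_poly (s : seq (rat * rat)) : {poly C} := Poly (map rat_point s).

Lemma rat_poly_dense (X : set C) (h : {poly C}) (e : R) : bounded_on X id -> 0 < e ->
  exists s, forall z, X z -> nrm (h.[z] - (rat_poly s).[z]) <= e.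
Proof.
move=> [B XB]; pose M := Num.max B 0.
have M0 : 0 <= M by rewrite le_max lexx orbT.
have XM z : X z -> nrm z <= M by move=> /XB zB; rewrite le_max zB.
elim/poly_ind: h e => [|p c IH] e e0.
  by exists [::] => z _; rewrite /rat_poly /= horner0 subrr nrm0 ltW.
have e1 : 0 < e / (2 * (M + 1)) by rewrite divr_gt0//; lra.
have e2 : 0 < e / 2 by lra.
have [s sP] := IH _ e1; have [x xP] := rat_point_dense c e2.
exists (x :: s) => z Xz; rewrite /rat_poly /= cons_poly_def !hornerE.
rewrite -/(rat_poly s).
have -> : p.[z] * z + c - ((rat_poly s).[z] * z + rat_point x) =
  (p.[z] - (rat_poly s).[z]) * z + (c - rat_point x) by ring.
apply: (le_trans (nrmD _ _)); rewrite nrmM.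
have := ler_pM (nrm_ge0 _) (nrm_ge0 _) (sP z Xz) (XM z Xz).
have : e / (2 * (M + 1)) * M <= e / 2.
  by rewrite mulrAC ler_pdivrMr; [have := mulr_ge0 M0 (ltW e0); lra | lra].
lra.
Qed.

Definition balls (bs : seq (rat * rat * nat)) : set C :=
  [set z | exists2 b, b \in bs & nrm (z - rat_point b.1) < b.2.+1%:R^-1].

Lemma balls_open bs : open (balls bs).
Proof.
apply/openP => z [b bin zb]; exists (b.2.+1%:R^-1 - nrm (z - rat_point b.1)).
  by rewrite subr_gt0.
move=> w wz; exists b => //; have := nrm_dist z w (rat_point b.1).
by move: wz; move: (b.2.+1%:R^-1 : R) => r; lra.
Qed.

Definition core (Omega : set C) (m : nat) bs : set C :=
  [set z | [/\ ~ Omega z, nrm z <= m%:R & ~ balls bs z]].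

Lemma core_compact Omega m bs : open Omega -> compact (core Omega m bs).
Proof.
move=> oO; apply: (@closed_bounded_compact _ _ m%:R); last by move=> z [].
have -> : core Omega m bs = ~` Omega `&` (disc 0 m%:R `&` ~` balls bs).
  apply/seteqP; split=> z; first by move=> [h1 h2 h3]; split=> //; split=> //; rewrite /disc /= subr0.
  by move=> [h1 []]; rewrite /disc /= subr0 => h2 h3; split.
apply: closedI; first by rewrite closedC.
apply: closedI; first by apply: compact_closedC; exact: disc_compact.
by rewrite closedC; exact: balls_open.
Qed.

(* The complement of [core] has to be connected to infinity by balls chosen in
   advance from a countable family; [ok] says that the balls used so far connect
   to infinity whatever set is left, and connectedness of [~` K] brings them to a
   point of [Omega], whence every other component of the complement is reached. *)
Lemma core_cover (Omega K : set C) zeta : open Omega -> connected Omega -> Omega zeta ->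
  compact K -> K `&` Omega = set0 -> connected (~` K) ->
  exists m bs, K `<=` core Omega m bs /\
    forall a, ~ core Omega m bs a -> outer (core Omega m bs) a.
Proof.
move=> oO cO Oz cK KO coK.
have [B B0 KB] := compact_nrm_bounded cK.
pose m := (Num.truncn B).+1; have Bm : B < m%:R by exact: truncnS_gt.
pose ok bs := (forall z, balls bs z -> ~ K z) /\
  forall X : set C, compact X -> (forall x, X x -> nrm x <= m%:R) -> (forall x, X x -> ~ balls bs x) ->
    forall z, balls bs z -> outer X z.
pose Z := [set z | exists2 bs, ok bs & balls bs z].
have extend z : ~ K z -> exists2 r : R, 0 < r &
    forall w v, nrm (w - z) < r -> nrm (v - z) < r -> Z w -> Z v.
  move=> nKz; have [rho rho0 Krho] := compact_dist cK nKz.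
  have [|n nP] := @inv_nat_lt _ (rho / 2); first lra.
  pose s : R := n.+1%:R^-1; have s0 : 0 < s by rewrite invr_gt0 ltr0n.
  have s4 : 0 < s / 4 by lra.
  (* The ball of radius [s] about [c] contains [w] and [v], and it misses [K] since [s < rho / 2].
     Inside it one pushes from [w] to [c] and from [c] to any point. *)
  have [c cP] := rat_point_dense z s4.
  exists (s / 4) => // w v wz vz [bs [bK bX] bw].
  have wc : nrm (w - rat_point c) < s / 2 by have := nrm_dist z w (rat_point c); lra.
  have vc : nrm (v - rat_point c) < s / 2 by have := nrm_dist z v (rat_point c); lra.
  exists ((c, n) :: bs); last first.
    by exists (c, n); rewrite ?mem_head//= -/s; lra.
  split=> [y [b]|X cX Xm XU y [b]]; rewrite in_cons => /orP[/eqP->|bin] /=.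
  - rewrite -/s => yc Ky; have := Krho y Ky; have := nrm_dist (rat_point c) y z.
    by rewrite [nrm (rat_point c - z)]nrmBC; move: nP; rewrite -/s; lra.
  - by move=> yb; apply: bK; exists b.
  - rewrite -/s => yc.
    have Xs x : X x -> s <= nrm (x - rat_point c).
      move=> Xx; rewrite leNgt; apply/negP => xc; apply: (XU x Xx).
      by exists (c, n); rewrite ?mem_head.
    have ow : outer X w.
      apply: bX => // x Xx bx; apply: (XU x Xx); case: bx => b' b'in xb.
      by exists b' => //; rewrite in_cons b'in orbT.
    have oc : outer X (rat_point c).
      have k0 : 0 < s - 2 * nrm (w - rat_point c) by lra.
      apply: (outer_step k0 ow) => x Xx.
      by have := Xs x Xx; have := nrm_dist w x (rat_point c); lra.
    have k0 : 0 < s - nrm (y - rat_point c) by lra.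
    by apply: (outer_step k0 oc) => x /Xs; rewrite [nrm (rat_point c - y)]nrmBC; lra.
  - move=> yb; apply: bX => //; last by exists b.
    move=> x Xx bx; apply: (XU x Xx); case: bx => b' b'in xb.
    by exists b' => //; rewrite in_cons b'in orbT.
have [bs [bK bX] bz] : Z zeta.
  have nKz : ~ K zeta by move=> Kz; have : (K `&` Omega) zeta by []; rewrite KO.
  apply: (@connected_induction _ (~` K)) nKz => //.
  - by rewrite openC; exact: compact_closedC.
  (* The first ball lies beyond modulus [m + 1], so all its points are outer at once; index 0 means
     radius 1. *)
  - have [x xP] := @rat_point_dense ((m%:R + 3)%:C) 1 ltr01.
    have xm : m%:R + 2 < nrm (rat_point x).
      have := nrm_dist (rat_point x) (m%:R + 3)%:C 0; rewrite !subr0 nrm_real ger0_norm; first lra.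
      by rewrite addr_ge0.
    have xb z : nrm (z - rat_point x) < 1 -> m%:R + 1 < nrm z.
      by have := nrm_dist z (rat_point x) 0; rewrite !subr0 nrmBC; lra.
    exists (rat_point x); first by move=> /KB; lra.
    exists [:: (x, 0%N)]; last by exists (x, 0%N); rewrite ?mem_head//= subrr nrm0 invr1.
    split=> [z [b]|X cX Xm XU z [b]]; rewrite inE => /eqP-> /=; rewrite invr1 => /xb zm.
      by move=> /KB; lra.
    by apply: (@outer_far _ _ _ 1) => // y /Xm; lra.
  - move=> z nKz; have [r r0 rP] := extend z nKz; exists r => // w wz.
    have zz : nrm (z - z) < r by rewrite subrr nrm0.
    by split; exact: rP.
exists m, bs; have cC := @core_compact Omega m bs oO; split.
  move=> z Kz; split; [|by have := KB z Kz; lra|by move=> /bK].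
  by move=> Oz'; have : (K `&` Omega) z by []; rewrite KO.
have oC : forall z, balls bs z -> outer (core Omega m bs) z.
  by apply: bX => // x [].
move=> a nCa; have [Oa|nOa] := pselect (Omega a).
  apply: (@connected_outer Omega _ zeta) Oa => //; last exact: oC.
  by apply/seteqP; split=> // z [? []].
have [ba|nba] := pselect (balls bs a); first exact: oC.
have am : m%:R < nrm a by rewrite ltNge; apply/negP => am; apply: nCa; split.
by apply: (@outer_far _ _ _ (nrm a - m%:R)) => [|z [_ zm _]]; lra.
Qed.

Lemma cdiff_poly (p : {poly C}) z : cdiff (horner p) z.
Proof.
elim/poly_ind: p => [|p c IH].
  by apply: (@cdiff_ext _ (fun _ => 0) _ z 1) => // [w _|]; [rewrite horner0|exact: cdiff_cst].
apply: (@cdiff_ext _ (fun w => p.[w] * w - (- c)) _ z 1) => // [w _|].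
  by rewrite !hornerE opprK.
by apply: cdiffB; [apply: cdiffM => //; exact: cdiff_id | exact: cdiff_cst].
Qed.

Lemma joint_approx (Omega L X : set C) (f : C -> C) (h : {poly C}) (e : R) :
  simply_connected_domain Omega -> (forall z, Omega z -> cdiff f z) ->
  compact L -> L `<=` Omega -> compact X -> X `&` Omega = set0 ->
  (forall a, ~ X a -> outer X a) -> 0 < e ->
  exists P : {poly C}, (forall z, L z -> nrm (f z - P.[z]) <= e) /\
    (forall z, X z -> nrm (h.[z] - P.[z]) <= e).
Proof.
move=> sO fd cL LO cX XO oX e0; have [_ oO _ _] := sO.
have cH := hull_compact cL; have HO := hull_sub sO cL LO.
have [r1 r10 r1P] := compact_in_open cH oO HO.
have HX : hull L `<=` ~` X.
  by move=> z /HO Oz Xz; have : (X `&` Omega) z by []; rewrite XO.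
have oXc : open (~` X) by rewrite openC; exact: compact_closedC.
have [r2 r20 r2P] := compact_in_open cH oXc HX.
(* The switch from [f] to [h] is at distance [2 * eta] from the hull. Points within [eta] of the
   hull stay in the first zone, and points within [2 * eta] of [X] in the second. *)
pose eta := Num.min r1 r2 / 4.
have min0 : 0 < Num.min r1 r2 by rewrite lt_min r10.
have m1 : Num.min r1 r2 <= r1 by rewrite ge_min lexx.
have m2 : Num.min r1 r2 <= r2 by rewrite ge_min lexx orbT.
have eta0 : 0 < eta by rewrite /eta; lra.
pose g z := if `[< exists2 x, hull L x & nrm (z - x) < 2 * eta >] then f z else h.[z].
have gA : approximable (hull L `|` X) g.
  apply: runge; first exact: compactU.
    apply: outer_union => //; last exact: hull_outer.
    by apply/seteqP; split=> // z [/HX].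
  exists eta => // x w [Hx|Xx] wx.
    apply: (cdiff_ext eta0 _ (fd w _)).
      move=> v vw; rewrite /g asboolT//; exists x => //.
      by have := nrm_dist w v x; lra.
    by apply: (r1P x) => //; rewrite /eta in wx; lra.
  apply: (cdiff_ext eta0 _ (cdiff_poly h w)) => v vw; rewrite /g asboolF// => -[y Hy vy].
  apply: (r2P y x Hy _ Xx); have := nrm_dist v x y; have := nrm_dist w v x.
  by rewrite [nrm (x - v)]nrmBC /eta in wx vw vy *; lra.
have [P PP] := gA e e0; exists P; split=> z zin.
  have zH : hull L z by exact: sub_hull.
  have := PP z (or_introl zH); rewrite /g asboolT//; exists z => //.
  by rewrite subrr nrm0; lra.
have := PP z (or_intror zin); rewrite /g asboolF// => -[y Hy zy].
by apply: (r2P y z Hy _ zin); rewrite /eta in zy; lra.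
Qed.

Definition exhaustion (Omega : set C) (n : nat) : set C :=
  [set z | nrm z <= n%:R /\ forall w, ~ Omega w -> n.+1%:R^-1 <= nrm (w - z)].

Lemma exhaustion_sub (Omega : set C) n : exhaustion Omega n `<=` Omega.
Proof.
move=> z [_ h]; apply: contrapT => nz; have := h z nz.
by rewrite subrr nrm0 leNgt invr_gt0 ltr0n.
Qed.

Lemma exhaustion_mono (Omega : set C) n n' : (n <= n')%N ->
  exhaustion Omega n `<=` exhaustion Omega n'.
Proof.
move=> nn z [zn zO]; split; first by apply: le_trans zn _; rewrite ler_nat.
move=> w /zO; apply: le_trans; rewrite lef_pV2 ?posrE ?ltr0n//.
by rewrite ler_nat ltnS.
Qed.

Lemma exhaustion_compact (Omega : set C) n : compact (exhaustion Omega n).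
Proof.
apply: (@closed_bounded_compact _ _ n%:R); last by move=> z [].
rewrite -[exhaustion _ _]setCK closedC; apply/openP => z nz.
have [zn|zn] := leP (nrm z) n%:R; last first.
  exists (nrm z - n%:R); first lra.
  move=> w wz [wn _]; have := nrm_dist w z 0; rewrite !subr0 nrmBC; lra.
have /existsNP[w /not_implyP[nw /negP]] : ~ forall w, ~ Omega w -> n.+1%:R^-1 <= nrm (w - z).
  by move=> h; apply: nz.
rewrite -ltNge => wz; exists (n.+1%:R^-1 - nrm (w - z)); first by rewrite subr_gt0.
move=> v vz [_ /(_ w nw)]; have := nrm_dist z w v; rewrite [nrm (z - v)]nrmBC.
by move: wz vz; move: (n.+1%:R^-1 : R) => t; lra.
Qed.

Lemma exhaustion_cover (Omega L : set C) : open Omega -> compact L -> L `<=` Omega ->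
  exists n, L `<=` exhaustion Omega n.
Proof.
move=> oO cL LO; have [B B0 LB] := compact_nrm_bounded cL.
have [r r0 rP] := compact_in_open cL oO LO.
have [k kP] := inv_nat_lt r0.
exists (maxn (Num.truncn B).+1 k) => z Lz; split.
  apply: le_trans (LB z Lz) _; apply: le_trans (ltW (truncnS_gt B)) _.
  by rewrite ler_nat leq_maxl.
move=> w nw; rewrite leNgt; apply/negP => wz; apply: nw; apply: (rP z) => //.
apply: lt_trans wz _; apply: le_lt_trans kP.
by rewrite lef_pV2 ?posrE ?ltr0n// ler_nat ltnS leq_maxr.
Qed.
End approximation_families.

(** * Baire's theorem for holomorphic functions *)

Section baire.
Variable R : realType.
Local Notation C := R[i].
Variable Omega : set C.
Hypothesis sO : simply_connected_domain Omega.

Let oO : open Omega. Proof. by case: sO. Qed.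

(** The inequality is not strict, so that membership survives the passage to a limit. A triple holds
    the center, the index in the exhaustion and the radius. *)
Definition tube (x : holo Omega * nat * R) : set (holo Omega) :=
  [set f | forall z, exhaustion Omega x.1.2 z -> nrm (holo_fun f z - holo_fun x.1.1 z) <= x.2].

Lemma tube_center x : 0 < x.2 -> tube x x.1.1.
Proof. by move=> x0 z _; rewrite subrr nrm0 ltW. Qed.

Lemma nbhs_tube (f : holo Omega) (V : set (holo Omega)) (n : nat) : nbhs f V ->
  exists n' (e : R), [/\ (n <= n')%N, 0 < e & tube (f, n', e) `<=` V].
Proof.
move=> /holo_nbhsP[L [e [cL LO e0 LV]]]; have [k kP] := exhaustion_cover oO cL LO.
exists (maxn n k), (e / 2); split; [by rewrite leq_maxl | lra |].
move=> g gP; apply: LV => z /kP zk.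
have := gP z (exhaustion_mono (leq_maxr n k) zk) => /=; lra.
Qed.

Lemma tube_nbhs (x : holo Omega * nat * R) : 0 < x.2 -> nbhs x.1.1 (tube x).
Proof.
move=> x0; apply/holo_nbhsP; exists (exhaustion Omega x.1.2), x.2; split=> //.
- exact: exhaustion_compact.
- exact: exhaustion_sub.
- by move=> g gP z /gP/ltW.
Qed.

Lemma holo_poly (P : {poly C}) : exists g : holo Omega, forall z, Omega z -> holo_fun g z = P.[z].
Proof. by apply: holo_make => // z _; exact: cdiff_poly. Qed.

Lemma poly_approx (f : holo Omega) n (e : R) : 0 < e ->
  exists P : {poly C}, forall z, exhaustion Omega n z -> nrm (holo_fun f z - P.[z]) <= e.
Proof.
move=> e0; have [|P [PP _]] := @joint_approx R Omega (exhaustion Omega n) set0 (holo_fun f) 0 e sO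
  (fun z => @holo_cdiff R Omega f z) (@exhaustion_compact R Omega n) (@exhaustion_sub R Omega n)
  compact0 (set0I _) _ e0.
  by move=> a _; apply: (@outer_far _ _ _ 1).
by exists P.
Qed.

(** Density gives a point [f] of [U] within a quarter of the radius; replacing it by a polynomial
    and the new radius cost at most a quarter each. Polynomial centers are what makes the limit in
    [baire_holo] holomorphic. *)
Lemma tube_step (x : holo Omega * nat * R) (U : set (holo Omega)) : 0 < x.2 -> open U -> dense U ->
  exists y : holo Omega * nat * R, [/\ 0 < y.2, y.2 <= x.2 / 2, (x.1.2 < y.1.2)%N,
    exists P : {poly C}, forall z, Omega z -> holo_fun y.1.1 z = P.[z] &
    tube y `<=` tube x `&` U].
Proof.
move=> x0 oU dU.
pose x4 : holo Omega * nat * R := (x.1.1, x.1.2, x.2 / 4).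
have x40 : 0 < x4.2 by rewrite /x4 /=; lra.
have [f [fx fU]] : (tube x4)° `&` U !=set0.
  by apply: dU; [exists x.1.1; exact: (tube_nbhs x40) | exact: open_interior].
have fx4 : tube x4 f by exact: interior_subset.
have fUn : nbhs f U by apply: open_nbhs_nbhs.
have [n [e [xn e0 eU]]] := nbhs_tube x.1.2.+1 fUn.
have d0 : 0 < Num.min e x.2 / 4 by rewrite divr_gt0// lt_min e0.
have de : Num.min e x.2 <= e by rewrite ge_min lexx.
have dx : Num.min e x.2 <= x.2 by rewrite ge_min lexx orbT.
have [P PP] := poly_approx f n d0; have [g gP] := holo_poly P.
exists (g, n, Num.min e x.2 / 4); split=> //=; first lra.
  by exists P.
move=> h hg; split.
  move=> z zx; have zn : exhaustion Omega n z by apply: exhaustion_mono zx; exact: ltnW.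
  have := hg z zn; have := PP z zn; have := fx4 z zx; rewrite /= gP; last exact: exhaustion_sub zn.
  have := nrm_dist (holo_fun f z) (holo_fun h z) (holo_fun x.1.1 z).
  have := nrm_dist P.[z] (holo_fun h z) (holo_fun f z).
  by rewrite [nrm (P.[z] - _)]nrmBC; lra.
apply: eU => z zn /=.
have := hg z zn; have := PP z zn; rewrite /= gP; last exact: exhaustion_sub zn.
have := nrm_dist P.[z] (holo_fun h z) (holo_fun f z).
by rewrite [nrm (P.[z] - _)]nrmBC; lra.
Qed.

(** Nested tubes have a pointwise limit of their centers. Near each point of [Omega] it is a uniform
    limit of polynomials, so [approx_taylor] gives differentiability, and the limit lies in every
    tube. *)
Theorem baire_holo (U : (set (holo Omega))^nat) :
  (forall j, open (U j) /\ dense (U j)) -> dense (\bigcap_j U j).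
Proof.
move=> Uod V [f0 Vf0] oV.
have Vn : nbhs f0 V by apply: open_nbhs_nbhs.
have [n0 [e0 [_ e00 e0V]]] := nbhs_tube 0 Vn.
have /choice[s sP] : forall xj : (holo Omega * nat * R) * nat, exists y : holo Omega * nat * R,
    0 < xj.1.2 -> [/\ 0 < y.2, y.2 <= xj.1.2 / 2, (xj.1.1.2 < y.1.2)%N,
    exists P : {poly C}, forall z, Omega z -> holo_fun y.1.1 z = P.[z] &
    tube y `<=` tube xj.1 `&` U xj.2].
  move=> [x j] /=; have [x0|x0] := ltP 0 x.2; last by exists x; rewrite ltNge x0.
  by have [y yP] := tube_step x0 (Uod j).1 (Uod j).2; exists y.
pose x := fix x j := if j is i.+1 then s (x i, i) else (f0, n0, e0).
have xpos j : 0 < (x j).2 by elim: j => [//|j IH]; have [] := sP (x j, j) IH.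
have xS j := sP (x j, j) (xpos j).
pose e j := (x j).2; pose g j := holo_fun (x j).1.1; pose L j := exhaustion Omega (x j).1.2.
have nested j k : tube (x (j + k)%N) `<=` tube (x j).
  elim: k => [|k IH]; first by rewrite addn0.
  rewrite addnS; apply: subset_trans IH.
  by have [_ _ _ _ h] := xS (j + k)%N; move=> f /h[].
have Lmono j : (j <= (x j).1.2)%N.
  by elim: j => // j IH; have [_ _ h _ _] := xS j; exact: leq_ltn_trans h.
have ehalf j : e j <= e0 * 2^-1 ^+ j.
  elim: j => [|j IH]; first by rewrite expr0 mulr1.
  by have [_ h _ _ _] := xS j; rewrite exprS; rewrite /e /= in IH h *; lra.
have esmall (d : R) : 0 < d -> exists N, forall j, (N <= j)%N -> e j < d.
  move=> d0; have [|N NP] := @geometric_lt R (2^-1) (d / e0) _ (divr_gt0 d0 e00).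
    by rewrite invr_ge0 ler0n invf_lt1// ltr1n.
  exists N => j Nj; apply: le_lt_trans (ehalf j) _.
  move: NP; rewrite ltr_pdivlMr// mulrC; apply: le_lt_trans.
  rewrite ler_pM2l//; by apply: ler_wiXn2l => //; lra.
have near j k z : L j z -> nrm (g (j + k)%N z - g j z) <= e j.
  by move=> Lz; apply: (nested j k) => //; exact: tube_center.
have Lsub j k : (j <= k)%N -> L j `<=` L k.
  move=> jk; apply: exhaustion_mono; elim: k jk => [|k IH].
    by rewrite leqn0 => /eqP->.
  rewrite leq_eqVlt => /orP[/eqP->//|]; rewrite ltnS => /IH h.
  by have [_ _ h' _ _] := xS k; exact: leq_trans h (ltnW h').
(* Points in no [L j] get the junk value 0. *)
have /choice[F FP] : forall z, exists l, forall j, L j z -> nrm (l - g j z) <= e j.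
  move=> z; have [[j0 Lj0]|no] := pselect (exists j, L j z); last first.
    by exists 0 => j Lz; case: no; exists j.
  have [|l lP] := @complex_limit R (fun k => g (j0 + k)%N z) (fun k => e (j0 + k)%N).
    move=> k k'; have Lk i : L (j0 + i)%N z by apply: Lsub Lj0; rewrite leq_addr.
    have ek i : 0 <= e i := ltW (xpos i).
    wlog kk : k k' / (k <= k')%N.
      move=> H; have [/H//|/ltnW/H h] := leqP k k'.
      by rewrite nrmBC [e (j0 + k)%N + _]addrC.
    rewrite nrmBC -(subnKC kk) addnA.
    apply: le_trans (near (j0 + k)%N (k' - k)%N z (Lk k)) _.
    by rewrite lerDl -addnA subnKC.
  exists l => j Lj; rewrite leNgt; apply/negP => lt.
  have [|N NP] := esmall ((nrm (l - g j z) - e j) / 2); first lra.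
  pose i := (N + j)%N.
  have h1 := lP i; have h2 : nrm (g (j + (j0 + N))%N z - g j z) <= e j by exact: near.
  have E : (j + (j0 + N) = j0 + i)%N by rewrite /i; lia.
  rewrite E in h2; have := NP (j0 + i)%N ltac:(rewrite /i; lia).
  have := nrm_dist (g (j0 + i)%N z) l (g j z); rewrite [nrm (l - g (j0 + i)%N z)]nrmBC; lra.
have Fd z : Omega z -> cdiff F z.
  move=> Oz; have [r r0 rO] := (openP Omega).1 oO z Oz.
  have r2 : 0 < r / 2 by lra.
  have [|k kP] := @exhaustion_cover R Omega (disc z (r / 2)) oO (@disc_compact R z (r / 2)).
    by move=> w; rewrite /disc /= => wz; apply: rO; lra.
  have [|a [_ _ //]] := @approx_taylor R F z (r / 2) r2.
  move=> d d0; have [N NP] := esmall d d0.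
  (* A successor, because the first center [f0] need not be a polynomial. *)
  pose j := (N + k).+1; have [_ _ _ [P PP] _] := xS (N + k)%N.
  exists P => w wz; have Lw : L j w.
    apply: exhaustion_mono (kP w wz).
    by apply: leq_trans (Lmono j); apply: leqW; exact: leq_addl.
  have := FP w j Lw; rewrite /g PP; last exact: exhaustion_sub Lw.
  by move=> h; apply: (le_trans h); apply/ltW/NP; rewrite /j; lia.
have [f fF] := @holo_make R Omega F oO Fd.
have ft j : tube (x j) f.
  by move=> z Lz; rewrite fF; [exact: FP | exact: exhaustion_sub Lz].
exists f; split; first exact: e0V (ft 0%N).
by move=> j _; have [_ _ _ _ h] := xS j; have [] := h _ (ft j.+1).
Qed.
End baire.

(** * Density *)

Section density.
Variable R : realType.
Local Notation C := R[i].
Local Notation tofrac := (@FracField.tofrac {poly C}).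

Lemma roots_bounded (P : {poly C}) : P != 0 -> exists B : R, forall w, root P w -> nrm w <= B.
Proof.
move=> P0; have [r rE] := closed_field_poly_normal P.
exists (\sum_(x <- r) nrm x) => w.
rewrite rE rootZ ?lead_coef_eq0// root_prod_XsubC => wr.
by rewrite (big_rem w)//= lerDl; apply: sumr_ge0 => i _; exact: nrm_ge0.
Qed.

Lemma shift_poly_eq0 (z : C) (P : {poly C}) : P != 0 -> shift_poly z P != 0.
Proof.
apply: contra_neq => sP; rewrite -(shift_polyK (- z) P) opprK sP.
by rewrite /shift_poly comp_poly0.
Qed.

Lemma horner_close (P Q : {poly C}) (N : nat) (e rho : R) (w : C) :
  (size P <= N)%N -> (size Q <= N)%N -> (forall m, nrm (P`_m - Q`_m) <= e) ->
  1 <= rho -> nrm w <= rho -> nrm (P.[w] - Q.[w]) <= N%:R * (e * rho ^+ N).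
Proof.
move=> sP sQ PQ r1 wr; have r0 : 0 <= rho by lra.
rewrite (horner_coef_wide _ sP) (horner_coef_wide _ sQ) -sumrB; apply: nrm_sum_le => m.
rewrite -mulrBl nrmM nrmX; apply: ler_pM; rewrite ?exprn_ge0 ?nrm_ge0//.
apply: (@le_trans _ _ (rho ^+ m)); first by rewrite lerXn2r ?nnegrE ?nrm_ge0.
by apply: ler_weXn2l => //; exact: ltnW.
Qed.

(* [G] is a Taylor polynomial of [A0 / (1 + u X^q)] with [u] small: it is close
   to [A0] on a large disc, and the Pade system of [G] is regular although that
   of [A0] is degenerate. *)
Lemma perturbed_rational (p q : nat) (A0 : {poly C}) (rho eta M : R) :
  (size A0 <= p.+1)%N -> 1 <= rho -> 0 < eta -> eta <= 2^-1 ->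
  (forall w, root A0 w -> nrm w <= rho) ->
  (forall w, nrm w <= rho -> nrm A0.[w] <= M) ->
  exists B0 G J : {poly C}, [/\ size B0 = q.+1, B0`_0 = 1, coprimep A0 B0,
    B0 * trunc p q (fun k => G`_k) = A0 + 'X^((p + q).+1) * J &
    forall w, nrm w <= rho -> nrm (B0.[w] - 1) <= eta /\ nrm (G.[w] - A0.[w]) <= 4 * eta * M].
Proof.
move=> sA rho1 eta0 eta2 rootA AM; pose n := (p + q).+1.
pose u : C := if q == 0%N then 0 else (eta / rho ^+ q)%:C.
have rhoq : 0 < rho ^+ q by apply: exprn_gt0; lra.
have uq : nrm u * rho ^+ q <= eta.
  rewrite /u; case: ifP => _; first by rewrite nrm0 mul0r ltW.
  by rewrite nrm_real ger0_norm ?divr_ge0 ?(ltW eta0) ?(ltW rhoq)// divfK// gt_eqF.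
pose y : {poly C} := - (u *: 'X^q).
have yw w : nrm w <= rho -> nrm y.[w] <= eta.
  move=> wr; rewrite /y hornerN hornerZ hornerXn nrmN nrmM nrmX; apply: le_trans uq.
  by rewrite ler_wpM2l ?nrm_ge0// lerXn2r ?nnegrE ?nrm_ge0//; lra.
pose B0 : {poly C} := 1 - y.
(* The inverse of [B0] modulo ['X^n]: [y ^+ n] is a multiple of ['X^n] when [q] is positive, and 0
   when [q = 0]. *)
pose S : {poly C} := \sum_(k < n) y ^+ k.
have BS : B0 * S = 1 - y ^+ n by rewrite /B0 -[1 - y]opprB mulNr -subrX1 opprB.
pose G := A0 * S.
have [Y yn] : exists Y, y ^+ n = 'X^n * Y.
  rewrite /y /u; case: posnP => [q0|q0].
    by exists 0; rewrite scale0r oppr0 expr0n mulr0.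
  exists ((- (eta / rho ^+ q)%:C%:P) ^+ n * 'X^(q * n - n)).
  rewrite -mul_polyC -mulNr exprMn -exprM mulrCA -exprD subnKC//.
  by rewrite -{1}[n]mul1n leq_mul2r q0 orbT.
have B0w w : B0.[w] = 1 - y.[w] by rewrite /B0 hornerD hornerN hornerC.
have BG w : nrm w <= rho -> nrm (B0.[w] - 1) <= eta.
  by move=> /yw; rewrite B0w (_ : _ - 1 = - y.[w]) ?nrmN//; ring.
exists B0, G, (- (A0 * Y + B0 * drop_poly n G)).
split.
- rewrite /B0 /y /u opprK addrC; case: eqP => [->|/eqP q0].
    by rewrite scale0r add0r size_poly1.
  have e0 : (eta / rho ^+ q)%:C != 0 :> C.
    by rewrite -nrm_gt0 nrm_real normr_gt0 gt_eqF// divr_gt0.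
  rewrite size_polyDl size_scale// size_polyXn// size_poly1 ltnS lt0n//.
- rewrite -horner_coef0 B0w (_ : y.[0] = 0) ?subr0//.
  rewrite /y hornerN hornerZ hornerXn /u; case: eqP => [_|/eqP q0].
    by rewrite mul0r oppr0.
  by rewrite expr0n (negbTE q0) mulr0 oppr0.
(* The roots of [A0] lie in the disc of radius [rho], where [B0] is within [2^-1] of 1. *)
- apply/Pdiv.ClosedField.coprimepP => w /rootA wr; have := BG w wr.
  rewrite /root; apply: contraTneq => ->; rewrite sub0r nrmN nrm1 -ltNge; lra.
- have -> : trunc p q (fun k => G`_k) = G - 'X^n * drop_poly n G.
    have -> : trunc p q (fun k => G`_k) = take_poly n G.
      by apply/polyP => m; rewrite coef_trunc coef_take_poly.
    by rewrite -{2}(poly_take_drop n G) mulrC addrK.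
  rewrite mulrBr {1}/G mulrCA BS yn; ring.
move=> w wr; split; first exact: BG.
clearbody y.
have y1 : (1 - y.[w]) != 0.
  rewrite -nrm_gt0; have := nrmD (1 - y.[w]) y.[w]; rewrite subrK nrm1; have := yw w wr; lra.
have SE : S.[w] - 1 = (y.[w] - y.[w] ^+ n) / (1 - y.[w]).
  have := congr1 (horner^~ w) BS; rewrite /= hornerM B0w hornerD hornerN hornerC horner_exp => H.
  by apply: (mulfI y1); rewrite mulrBr H; field.
have -> : G.[w] - A0.[w] = A0.[w] * (S.[w] - 1) by rewrite /G hornerM; ring.
rewrite nrmM SE nrm_div.
have h1 : nrm (y.[w] - y.[w] ^+ n) <= 2 * eta.
  apply: (le_trans (nrmB _ _)); rewrite nrmX.
  have : nrm y.[w] ^+ n <= nrm y.[w].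
    rewrite /n exprS ler_piMr ?nrm_ge0// exprn_ile1 ?nrm_ge0//.
    by have := yw w wr; lra.
  by have := yw w wr; lra.
have h2 : 2^-1 <= nrm (1 - y.[w]).
  have := nrmD (1 - y.[w]) y.[w]; rewrite subrK nrm1; have := yw w wr; lra.
have h3 : nrm (y.[w] - y.[w] ^+ n) / nrm (1 - y.[w]) <= 4 * eta.
  rewrite ler_pdivrMr; last lra.
  by have := ler_wpM2l (ltW eta0) h2; lra.
have := ler_pM (nrm_ge0 _) _ (AM w wr) h3; rewrite divr_ge0 ?nrm_ge0// => /(_ isT).
lra.
Qed.

Lemma sup_dist_le (X : set C) (A B h : {poly C}) (e : R) : 0 <= e ->
  (forall z, X z -> B.[z] != 0 /\ nrm (A.[z] / B.[z] - h.[z]) <= e) ->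
  (sup_dist X (tofrac A / tofrac B)%R h <= e%:E)%E.
Proof.
move=> e0 AB; apply: ge_ereal_sup => _ [->|[z Xz <-]]; first by rewrite lee_fin.
have [Bz ABz] := AB z Xz; have [npole ev] := reval_frac A Bz.
by rewrite /rdist (negbTE npole) ev lee_fin.
Qed.
End density.

Section dense_step.
Variable R : realType.
Local Notation C := R[i].
Local Notation tofrac := (@FracField.tofrac {poly C}).

Lemma pade_nbhs (Omega : set C) (zeta : C) (f1 : holo Omega) (p q : nat)
    (A0 B0 G J : {poly C}) (e : R) : open Omega -> Omega zeta ->
  (size A0 <= p.+1)%N -> size B0 = q.+1 -> B0`_0 = 1 -> coprimep A0 B0 ->
  B0 * trunc p q (fun k => G`_k) = A0 + 'X^((p + q).+1) * J ->
  (forall z, Omega z -> holo_fun f1 z = (shift_poly (- zeta) G).[z]) -> 0 < e ->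
  nbhs f1 [set f | exists A B : {poly C}, [/\ (size A <= p.+1)%N, (size B <= q.+1)%N,
    is_pade (holo_fun f) zeta p q
      (tofrac (shift_poly (- zeta) A) / tofrac (shift_poly (- zeta) B)) &
    forall m, nrm (A`_m - A0`_m) <= e /\ nrm (B`_m - B0`_m) <= e]].
Proof.
move=> oO Oz sA sB B1 cop BT f1G e0.
have [d d0 dP] := pade_stable sA sB B1 cop BT e0.
have [r r0 rO] := (openP Omega).1 oO zeta Oz.
(* With [r1 <= 1] the power [r1 ^+ (p + q)] is the least of those in Cauchy's estimates; the bound
   [r / 4] leaves room for approximation on the disc. *)
pose r1 := Num.min 1 (r / 4).
have r10 : 0 < r1 by rewrite lt_min ltr01 divr_gt0.
have r11 : r1 <= 1 by rewrite ge_min lexx.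
have r1r : r1 <= r / 4 by rewrite ge_min lexx orbT.
have dO : disc zeta r1 `<=` Omega by move=> z; rewrite /disc /= => zr; apply: rO; lra.
apply/holo_nbhsP; exists (disc zeta r1), (d * r1 ^+ (p + q)); split=> //.
- exact: disc_compact.
- by rewrite mulr_gt0// exprn_gt0.
move=> f fP.
have fA : approximable (disc zeta r1) (holo_fun f).
  by apply: (approx_disc (ltW r10) r10) => w wr; apply: holo_cdiff; apply: rO; lra.
have [a [aP fa _]] := approx_taylor r10 fA.
have [|A [B [J' [sA' sB' B1' BT' AB]]]] := dP a.
  move=> k kpq; have := aP (shift_poly (- zeta) G) (d * r1 ^+ (p + q)) _ k.
  rewrite shift_polyK nrmBC => H.
  rewrite -(ler_pM2r (exprn_gt0 k r10)); apply: le_trans (H _) _.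
    by move=> z zr; rewrite -f1G; [apply/ltW/fP | exact: dO].
  by rewrite ler_pM2l//; apply: ler_wiXn2l => //; exact: ltW.
exists A, B; split=> //; exact: is_pade_intro fa sA' sB' B1' BT'.
Qed.

Definition good (Omega : set C) (F : set (nat * nat)) zeta X h (e : R) : set (holo Omega) :=
  [set f | exists p q r, [/\ F (p, q), is_pade (holo_fun f) zeta p q r &
     (sup_dist X r h <= e%:E)%E]].

Lemma good_dense (Omega X : set C) (zeta : C) (F : set (nat * nat)) (pt qt : nat -> nat)
    (h : {poly C}) (eps : R) : simply_connected_domain Omega -> Omega zeta ->
  (forall n, F (pt n, qt n)) -> pt n @[n --> \oo] --> \oo ->
  compact X -> X `&` Omega = set0 -> (forall a, ~ X a -> outer X a) -> 0 < eps ->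
  dense (interior (@good Omega F zeta X h eps)).
Proof.
move=> sO Oz hF hpt cX XO oX eps0 V [f0 Vf0] oV.
have oO : open Omega by case: sO.
have [n [del [_ del0 tV]]] := nbhs_tube sO 0 (open_nbhs_nbhs (conj oV Vf0)).
pose e1 := Num.min del eps / 8.
have e10 : 0 < e1 by rewrite divr_gt0// lt_min del0.
have e1d : 8 * e1 <= del by rewrite /e1 mulrC divfK// ge_min lexx.
have e1e : 8 * e1 <= eps by rewrite /e1 mulrC divfK// ge_min lexx orbT.
have cL := @exhaustion_compact R Omega n.
have [P0 [P0L P0X]] := joint_approx h sO (fun z => @holo_cdiff R Omega f0 z) cL
  (@exhaustion_sub R Omega n) cX XO oX e10.
(* The zero polynomial has unbounded roots and cannot be coprime to a nonconstant denominator; it is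
   replaced by the constant [e1]. *)
have [P1 [P1n P1L P1X]] : exists P1 : {poly C}, [/\ P1 != 0,
    forall z, exhaustion Omega n z -> nrm (holo_fun f0 z - P1.[z]) <= 2 * e1 &
    forall z, X z -> nrm (h.[z] - P1.[z]) <= 2 * e1].
  have [P00|P00] := eqVneq P0 0; last first.
    by exists P0; split=> // z zX; [have := P0L z zX|have := P0X z zX]; lra.
  have ne1 : nrm e1%:C = e1 by rewrite nrm_real gtr0_norm.
  exists (e1%:C%:P); split; first by rewrite polyC_eq0 -nrm_gt0 ne1.
    move=> z /P0L; rewrite P00 horner0 hornerC subr0 => z1.
    by have := nrmB (holo_fun f0 z) e1%:C; rewrite ne1; lra.
  move=> z /P0X; rewrite P00 horner0 hornerC subr0 => z1.
  by have := nrmB h.[z] e1%:C; rewrite ne1; lra.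
pose A0 := shift_poly zeta P1.
have A0P z : A0.[z - zeta] = P1.[z] by rewrite /A0 horner_shift subrK.
have [N sA0] : exists N, (size A0 <= (pt N).+1)%N.
  have /cvgnyPge/(_ (size A0))[N _ /(_ N (leqnn N)) /= ?] := hpt.
  by exists N; apply: leqW.
pose p := pt N; pose q := qt N.
have [BL BL0 BLP] := compact_nrm_bounded cL.
have [BX BX0 BXP] := compact_nrm_bounded cX.
have [Br BrP] := roots_bounded (shift_poly_eq0 zeta P1n).
(* The disc of this radius contains both compact sets shifted by [zeta], and all roots of [A0]. *)
pose rho := 1 + BL + BX + nrm zeta + Num.max Br 0.
have z0 := nrm_ge0 zeta.
have m0 : 0 <= Num.max Br 0 by rewrite le_max lexx orbT.
have mB : Br <= Num.max Br 0 by rewrite le_max lexx.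
have rho1 : 1 <= rho by rewrite /rho; lra.
have rhoL z : exhaustion Omega n z -> nrm (z - zeta) <= rho.
  by move=> /BLP zB; have := nrmB z zeta; rewrite /rho; lra.
have rhoX z : X z -> nrm (z - zeta) <= rho.
  by move=> /BXP zB; have := nrmB z zeta; rewrite /rho; lra.
have [M0 M0P] : bounded_on (disc 0 rho) (horner A0).
  by apply: poly_bounded; exists rho => z; rewrite /disc /= subr0.
pose M := Num.max M0 0.
have M_ge0 : 0 <= M by rewrite le_max lexx orbT.
have MP w : nrm w <= rho -> nrm A0.[w] <= M.
  by move=> wr; rewrite le_max M0P// /disc /= subr0.
(* The first bound keeps perturbed denominators above [2^-1] in modulus, the second absorbs the size
   [M] of [A0] in both error estimates. *)
pose eta := Num.min (8^-1) (e1 / (4 * (M + 1))).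
have eta0 : 0 < eta by rewrite lt_min invr_gt0 ltr0n divr_gt0//; lra.
have eta8 : eta <= 8^-1 by rewrite ge_min lexx.
have etaM : 4 * (eta * (M + 1)) <= e1.
  have : eta <= e1 / (4 * (M + 1)) by rewrite ge_min lexx orbT.
  by rewrite ler_pdivlMr; lra.
have etaM0 : 0 <= eta * M by rewrite mulr_ge0// ltW.
have [|w /BrP wB|B0 [G [J [sB0 B01 cop BT close]]]] :=
    @perturbed_rational R p q A0 rho eta M sA0 rho1 eta0 _ _ MP; [lra|by rewrite /rho; lra|].
have [f1 f1G] := holo_poly sO (shift_poly (- zeta) G).
have f1E z : Omega z -> holo_fun f1 z = G.[z - zeta].
  by move=> /f1G ->; rewrite horner_shift.
exists f1; split.
  apply: tV => z Lz /=; rewrite f1E; last exact: exhaustion_sub Lz.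
  have [_ h1] := close _ (rhoL z Lz); have h2 := P1L z Lz.
  rewrite -A0P in h2; rewrite nrmBC.
  by have := nrm_dist A0.[z - zeta] (holo_fun f0 z) G.[z - zeta]; rewrite [nrm (A0.[_] - _)]nrmBC; lra.
pose K : nat := (p + q).+1.
have K0 : 0 < K%:R * rho ^+ K.
  by rewrite mulr_gt0 ?ltr0n// exprn_gt0//; lra.
have := pade_nbhs oO Oz sA0 sB0 B01 cop BT f1G (divr_gt0 eta0 K0).
apply: filterS => f [A [B [sA sB pAB AB]]].
exists p, q, (tofrac (shift_poly (- zeta) A) / tofrac (shift_poly (- zeta) B)).
split=> //; first exact: hF.
have sAK : (size A <= K)%N by apply: leq_trans sA _; rewrite ltnS leq_addr.
have sA0K : (size A0 <= K)%N by apply: leq_trans sA0 _; rewrite ltnS leq_addr.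
have sBK : (size B <= K)%N by apply: leq_trans sB _; rewrite ltnS leq_addl.
have sB0K : (size B0 <= K)%N by rewrite sB0 ltnS leq_addl.
apply: sup_dist_le => [|z Xz]; first exact: ltW.
rewrite !horner_shift; set w := z - zeta.
have wr : nrm w <= rho by exact: rhoX.
have KE : K%:R * (eta / (K%:R * rho ^+ K) * rho ^+ K) = eta.
  by rewrite mulrCA divfK// gt_eqF.
have hA : nrm (A.[w] - A0.[w]) <= eta.
  by rewrite -[leRHS]KE; apply: horner_close => // m; case: (AB m).
have hB : nrm (B.[w] - B0.[w]) <= eta.
  by rewrite -[leRHS]KE; apply: horner_close => // m; case: (AB m).
have [hB0 _] := close w wr.
have hB1 : nrm (1 - B.[w]) <= 2 * eta.
  by rewrite nrmBC; have := nrm_dist B0.[w] B.[w] 1; lra.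
have nB : 2^-1 <= nrm B.[w].
  by have := nrmD (1 - B.[w]) B.[w]; rewrite subrK nrm1; lra.
have Bw : B.[w] != 0 by rewrite -nrm_gt0; lra.
split=> //.
have hq : nrm (A.[w] / B.[w] - A0.[w]) <= e1.
  have -> : A.[w] / B.[w] - A0.[w] = ((A.[w] - A0.[w]) + A0.[w] * (1 - B.[w])) / B.[w].
    by field.
  rewrite nrm_div ler_pdivrMr; last lra.
  have h1 := nrmD (A.[w] - A0.[w]) (A0.[w] * (1 - B.[w])).
  have h2 : nrm (A0.[w] * (1 - B.[w])) <= M * (2 * eta).
    by rewrite nrmM; apply: ler_pM => //; rewrite ?nrm_ge0// MP.
  by have := ler_wpM2l (ltW e10) nB; lra.
have h3 := P1X z Xz; rewrite -A0P -/w in h3.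
have := nrm_dist A0.[w] (A.[w] / B.[w]) h.[z]; rewrite [nrm (A0.[w] - _)]nrmBC; lra.
Qed.
End dense_step.

(** * From countably many targets to all polynomials and compact sets *)

Lemma sup_dist_trans (R : realType) (X K : set R[i]) r (h h' : {poly R[i]}) (e e' : R) :
  (sup_dist X r h' <= e%:E)%E -> K `<=` X ->
  (forall z, X z -> nrm (h.[z] - h'.[z]) <= e') -> 0 <= e' ->
  (sup_dist K r h <= (e + e')%:E)%E.
Proof.
move=> Xh KX hh e'0; have ub := @ereal_sup_ubound R ([set 0%E] `|` [set rdist r h' z | z in X]).
have e0 : 0 <= e by rewrite -lee_fin; apply: le_trans Xh; apply: ub; left.
apply: ge_ereal_sup => _ [->|[z Kz <-]]; first by rewrite lee_fin addr_ge0.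
have : (rdist r h' z <= e%:E)%E.
  by apply: le_trans Xh; apply: ub; right; exists z => //; exact: KX.
rewrite /rdist; case: ifP => // _; rewrite !lee_fin => h1.
have := nrm_dist h'.[z] (reval r z) h.[z]; have := hh z (KX z Kz).
by rewrite [nrm (h.[z] - _)]nrmBC; move: h1; rewrite -/(nrm _) -/(nrm (_ - h.[z])); lra.
Qed.

Lemma squeeze_inv_nat (R : realType) (u : nat -> \bar R) :
  (forall n, (0 <= u n)%E) -> (forall n, (u n <= (2 * n.+1%:R^-1)%:E)%E) ->
  u n @[n --> \oo] --> 0%E.
Proof.
move=> u0 u2; apply: (@squeeze_cvge _ _ _ _ (fun=> 0%E) u (fun n => (2 * n.+1%:R^-1)%:E)).
- by near=> n; rewrite u0 u2.
- exact: cvg_cst.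
apply/fine_cvgP; split; first by near=> n.
rewrite -[X in _ --> X](mulr0 2); apply: cvgM; first exact: cvg_cst.
exact: cvg_harmonic.
Unshelve. all: by end_near.
Qed.

Theorem theorem1p1 (R : realType) (Omega : set R[i]) (zeta : R[i])
    (F : set (nat * nat)) (pt qt : nat -> nat)
    (hOmega : simply_connected_domain Omega) (hzeta : Omega zeta)
    (hF : forall n, F (pt n, qt n)) (hpt : pt n @[n --> \oo] --> \oo) :
  exists S : set (holo Omega),
    [/\ Gdelta S, dense S &
      forall f : holo Omega, S f ->
      forall (h : {poly R[i]}) (K : set R[i]),
        compact K -> K `&` Omega = set0 -> connected (~` K) ->
      exists (p q : nat -> nat) (r : nat -> {fraction {poly R[i]}}),
        [/\ forall n, F (p n, q n),
            forall n, is_pade (holo_fun f) zeta (p n) (q n) (r n) &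
            sup_dist K (r n) h @[n --> \oo] --> 0%E]].
Proof.
have [_ oO cO _] := hOmega.
(* Coefficients of the target, balls and radius of the core, accuracy. *)
pose idx : Type := (seq (rat * rat) * seq (rat * rat * nat) * nat * nat)%type.
pose X (i : idx) := core Omega i.1.2 i.1.1.2.
pose outerX (i : idx) := forall a, ~ X i a -> outer (X i) a.
pose O (i : idx) := interior
  (@good R Omega F zeta (X i) (rat_poly R i.1.1.1) (i.2.+1%:R^-1)).
(* Numbers that decode to no index, or to a core with points of its complement that are not outer,
   impose no condition. *)
pose U (j : nat) := if unpickle j is Some i then
  (if `[< outerX i >] then O i else setT) else setT.
have Uod j : open (U j) /\ dense (U j).
  have denseT : dense [set: holo Omega] by move=> V V0 _; rewrite setIT.
  rewrite /U; case: unpickle => [i|]; last by split; [exact: openT | exact: denseT].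
  case: asboolP => [oX|_]; last by split; [exact: openT | exact: denseT].
  split; first exact: open_interior.
  apply: (good_dense _ hOmega hzeta hF hpt) => //.
  - exact: core_compact.
  - by apply/seteqP; split=> // z [[]].
exists (\bigcap_j U j); split.
- by exists U => // j; case: (Uod j).
- exact: baire_holo.
move=> f Sf h K cK KO coK.
have [m [bs [KX oX]]] := core_cover oO cO hzeta cK KO coK.
have bX : bounded_on (core Omega m bs) id by exists m%:R => z [].
have step n : exists x : nat * nat * {fraction {poly R[i]}},
    [/\ F x.1, is_pade (holo_fun f) zeta x.1.1 x.1.2 x.2 &
        (sup_dist K x.2 h <= (2 * n.+1%:R^-1)%:E)%E].
  have n0 : 0 < n.+1%:R^-1 :> R by rewrite invr_gt0 ltr0n.
  have [hs hsP] := rat_poly_dense h bX n0.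
  pose i : idx := (hs, bs, m, n).
  have := Sf (pickle i) I; rewrite /U pickleK asboolT// => /interior_subset.
  move=> [p [q [r [Fpq fr rh]]]]; exists (p, q, r); split=> //.
  rewrite mulr_natl mulr2n; exact: sup_dist_trans rh KX hsP (ltW n0).
have /choice[x xP] := step.
exists (fun n => (x n).1.1), (fun n => (x n).1.2), (fun n => (x n).2); split=> [n|n|].
- by have [+ _ _] := xP n; case: (x n).1.
- by have [] := xP n.
apply: squeeze_inv_nat => n; last by have [] := xP n.
by apply: ereal_sup_ubound; left.
Qed.
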